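(* Let $\mathcal B$ be the basis of $\mathcal A$ consisting of $P_m^+$ ($m\in\mathbb Z_+$) and $P_n^-$ ($n\in\mathbb N$), and let $\mathcal B'$ be the basis of $\mathcal A$ consisting of $P_m^{+\,\prime}$ ($m\in\mathbb Z_+$) and $P_n^{-\,\prime}$ ($n\in\mathbb N$). Then the pair $(\mathcal B,\mathcal B')$ forms a bi-orthogonal system of $\mathcal A$ with respect to the non-degenerate bilinear form $\langle\cdot,\cdot\rangle$; that is, $\langle P_m^+,P_n^{+\,\prime}\rangle=0$ for $m\ne n$ in $\mathbb Z_+$, $\langle P_m^-,P_n^{-\,\prime}\rangle=0$ for $m\neq n$ in $\mathbb N$, and $\langle P_m^+,P_n^{-\,\prime}\rangle=0=\langle P_n^-,P_m^{+\,\prime}\rangle$ for all $m\in\mathbb Z_+$, $n\in\mathbb N$.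
   Context: $\mathbb Z_+=\{0,1,2,\dots\}$, $\mathbb N=\{1,2,\dots\}$. Parameters: $q\in\mathbb C$ with $0<|q|<1$ and a fixed square root $q^{1/2}$; $\underline t=(k_0,k_1,u_0,u_1)$ nonzero complex numbers with $k_0^2,k_1^2,u_1^2\notin\{\pm q^j:j\in\mathbb Z\}$. Set $a=k_1u_1$, $b=-k_1u_1^{-1}$, $c=q^{1/2}k_0u_0$, $d=-q^{1/2}k_0u_0^{-1}$ and assume $ef\notin q^{\mathbb Z}$ for all $e,f\in\{a,b,c,d\}$. $\mathcal A=\mathbb C[x^{\pm1}]$. Define linear operators on $\mathcal A$ by $(T_1f)(x)=k_1f(x)+k_1^{-1}\frac{(1-k_1u_1x)(1+k_1u_1^{-1}x)}{1-x^2}\bigl(f(x^{-1})-f(x)\bigr)$ and $(T_0f)(x)=k_0f(x)+k_0^{-1}\frac{(1-q^{1/2}k_0u_0x^{-1})(1+q^{1/2}k_0u_0^{-1}x^{-1})}{1-qx^{-2}}\bigl(f(qx^{-1})-f(x)\bigr)$, and $Y=T_1T_0$. Let $\epsilon(m)=1$ for $m\ge0$, $\epsilon(m)=-1$ for $m<0$, $\gamma_m=(k_0k_1)^{\epsilon(m)}q^m$. Order the monomials by $1\prec x^{-1}\prec x\prec x^{-2}\prec x^2\prec\cdots$. $P_m$ ($m\in\mathbb Z$) is the unique Laurent polynomial of the form $x^m+$ lower order terms w.r.t. $\preceq$ with $YP_m=\gamma_mP_m$. The symmetric Askey-Wilson polynomial $P_m^+$ ($m\in\mathbb Z_+$) is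 the unique element of $\mathrm{span}\{P_m,P_{-m}\}$ of the form $x^m+$ lower order terms with $T_1P_m^+=k_1P_m^+$; the anti-symmetric Askey-Wilson polynomial $P_m^-$ ($m\in\mathbb N$) is the unique element of $\mathrm{span}\{P_m,P_{-m}\}$ of the form $x^m+$ lower order terms with $T_1P_m^-=-k_1^{-1}P_m^-$. A prime, $P_m^{\pm\,\prime}$, denotes the polynomial obtained by the same construction with $k_0,k_1,u_0,u_1,q,q^{1/2}$ all replaced by their inverses. $(y;q)_\infty=\prod_{j\ge0}(1-yq^j)$ and $(y_1,\dots,y_r;q)_\infty=\prod_i(y_i;q)_\infty$. The bilinear form on $\mathcal A$ is $$\langle f,g\rangle=\frac1{2\pi i}\int_{C}f(x)g(x^{-1})\Delta(x)\frac{dx}{x},\qquad \Delta(x)=\frac{(x^2,qx^{-2};q)_\infty}{(ax,bx,cx,dx,qax^{-1},qbx^{-1},cx^{-1},dx^{-1};q)_\infty},$$ where $C$ is a counterclockwise continuous rectifiable Jordan curve such that $aq^k,bq^k,cq^k,dq^k$ ($k\in\mathbb Z_+$) lie in its interior and $a^{-1}q^{-k},b^{-1}q^{-k},c^{-1}q^{-k},d^{-1}q^{-k}$ ($k\in\mathbb Z_+$) lie in its exterior. *)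

(* Defs.v *)
From HB Require Import structures.
From mathcomp Require Import all_boot all_order all_algebra.
From mathcomp Require Import all_classical all_reals all_analysis.
From mathcomp.real_closed Require Import complex.
From mathcomp Require Import freeg ring.

Set Implicit Arguments.
Unset Strict Implicit.
Unset Printing Implicit Defensive.

Import Order.TTheory GRing.Theory Num.Theory numFieldNormedType.Exports.

Local Open Scope classical_set_scope.
Local Open Scope complex_scope.
Local Open Scope ring_scope.

(* Laurent polynomials are the finitely supported formal combinations of the
   exponents [n : int]; only their vector space structure and their values
   at nonzero points are needed. *)
Definition laurent (F : fieldType) := {freeg int / F}.

Definition lev (F : fieldType) (f : laurent F) (x : F) : F :=
  fglift (fun n : int => x ^ n : F^o) f.

(* [qh] is the fixed square root of q. *)
Record params (F : fieldType) :=
  Params { qh : F; k0 : F; k1 : F; u0 : F; u1 : F }.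

Section Algebra.
Variable F : fieldType.
Implicit Types (t : params F) (f g : laurent F) (m n : int) (x : F).

Definition qq t : F := qh t ^+ 2.

Definition inv_params t : params F :=
  Params (qh t)^-1 (k0 t)^-1 (k1 t)^-1 (u0 t)^-1 (u1 t)^-1.

Definition pa t : F := k1 t * u1 t.
Definition pb t : F := - (k1 t * (u1 t)^-1).
Definition pc t : F := qh t * k0 t * u0 t.
Definition pd t : F := - (qh t * k0 t * (u0 t)^-1).

Definition T1_formula t f (x : F) : F :=
  k1 t * lev f x
  + (k1 t)^-1 * ((1 - k1 t * u1 t * x) * (1 + k1 t * (u1 t)^-1 * x)
                 / (1 - x ^+ 2)) * (lev f x^-1 - lev f x).

Definition T0_formula t f (x : F) : F :=
  k0 t * lev f x
  + (k0 t)^-1 * ((1 - qh t * k0 t * u0 t * x^-1)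
                 * (1 + qh t * k0 t * (u0 t)^-1 * x^-1)
                 / (1 - qq t * x ^- 2)) * (lev f (qq t * x^-1) - lev f x).

(* The formulas have removable singularities where the denominator vanishes,
   so the image is the Laurent polynomial taking the prescribed values at all
   other nonzero points; [T1E] and [T0E] below show that it exists. *)
Definition T1 t f : laurent F :=
  xget 0 [set g : laurent F |
    forall x, x != 0 -> x ^+ 2 != 1 -> lev g x = T1_formula t f x].

Definition T0 t f : laurent F :=
  xget 0 [set g : laurent F |
    forall x, x != 0 -> x ^+ 2 != qq t -> lev g x = T0_formula t f x].

Definition Yop t f : laurent F := T1 t (T0 t f).

Definition gamma_ev t m : F :=
  (k0 t * k1 t) ^ (if 0 <= m then 1 else -1 : int) * qq t ^ m.

(* Position of x^m in the list 1, x^-1, x, x^-2, x^2, etc. *)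
Definition mono_rank m : nat :=
  if 0 < m then `|m|%N.*2 else `|m|%N.*2.-1.

Definition monic_at m f : Prop :=
  coeff m f = 1 /\
  forall n, coeff n f != 0 -> n = m \/ (mono_rank n < mono_rank m)%N.

Definition is_P t m : laurent F -> Prop :=
  unique (fun f => monic_at m f /\ Yop t f = gamma_ev t m *: f).

Definition in_span2 (v w f : laurent F) : Prop :=
  exists c d : F, f = c *: v + d *: w.

Definition is_Pplus t (P : int -> laurent F) (m : nat) : laurent F -> Prop :=
  unique (fun f => [/\ in_span2 (P m%:Z) (P (- m%:Z)) f, monic_at m%:Z f
                     & T1 t f = k1 t *: f]).

Definition is_Pminus t (P : int -> laurent F) (m : nat) : laurent F -> Prop :=
  unique (fun f => [/\ in_span2 (P m%:Z) (P (- m%:Z)) f, monic_at m%:Z f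
                     & T1 t f = - (k1 t)^-1 *: f]).

(* P, Pp, Pm are the families of non-symmetric, symmetric and anti-symmetric
   Askey-Wilson polynomials; the value [Pm 0] is irrelevant. *)
Definition AW_families t (P : int -> laurent F) (Pp Pm : nat -> laurent F) :=
  [/\ forall m : int, is_P t m (P m),
      forall m : nat, is_Pplus t P m (Pp m)
    & forall m : nat, (0 < m)%N -> is_Pminus t P m (Pm m)].

Definition AW_sym_family (Pp Pm : nat -> laurent F) (i : nat + nat) :=
  match i with inl m => Pp m | inr n => Pm n.+1 end.

(* The finitely supported coefficient family [c] ranges over the free module
   on the index type. *)
Definition is_basis (I : choiceType) (b : I -> laurent F) : Prop :=
  forall f, exists! c : {freeg I / F}, f = fglift b c.

Definition nondegenerate_bilinear (B : laurent F -> laurent F -> F) : Prop :=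
  [/\ forall g, scalar (B^~ g), forall f, scalar (B f),
      forall f, (forall g, B f g = 0) -> f = 0
    & forall g, (forall f, B f g = 0) -> g = 0].

Lemma levB f g x : lev (f - g) x = lev f x - lev g x.
Proof. exact: (@lift_is_additive F int F^o (fun n : int => x ^ n) f g). Qed.

Lemma lev0 x : lev 0 x = 0.
Proof. by rewrite -(subrr 0) levB subrr. Qed.

Lemma levD f g x : lev (f + g) x = lev f x + lev g x.
Proof. by rewrite -{1}[g]opprK levB -[- g]add0r levB lev0 sub0r opprK. Qed.

Lemma levU (c : F) n x : lev << c *g n >> x = c * x ^ n.
Proof. exact: (@liftU F F^o int (fun m : int => x ^ m) c n). Qed.

Definition laurent_off (r : F) (G : F -> F) : Prop :=
  exists g, forall x, x != 0 -> x ^+ 2 != r -> lev g x = G x.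

Lemma laurent_off_ext r G H :
  (forall x, x != 0 -> x ^+ 2 != r -> G x = H x) ->
  laurent_off r G -> laurent_off r H.
Proof. by move=> GH [g gE]; exists g => x x0 xr; rewrite gE // GH. Qed.

Lemma laurent_offD r G H :
  laurent_off r G -> laurent_off r H -> laurent_off r (fun x => G x + H x).
Proof.
by move=> [g gE] [h hE]; exists (g + h) => x x0 xr; rewrite levD gE ?hE.
Qed.

Lemma laurent_off_lev r f : laurent_off r (lev f).
Proof. by exists f. Qed.

Lemma laurent_off_mono r (c : F) n G :
  laurent_off r G -> laurent_off r (fun x => c * x ^ n * G x).
Proof.
case=> g; elim/freeg_ind_dom0: g G => [|a k g _ _ IH] G gE.
  by exists 0 => x x0 xr; rewrite -gE // !lev0 mulr0.
have [h hE] := IH (lev g) (fun _ _ _ => erefl).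
exists (<< c * a *g n + k >> + h) => x x0 xr.
by rewrite levD levU hE // -gE // levD levU expfzDr // mulrDr mulrACA.
Qed.

Lemma laurent_offZ r (c : F) G :
  laurent_off r G -> laurent_off r (fun x => c * G x).
Proof.
move=> /(laurent_off_mono c 0); apply: laurent_off_ext => x _ _.
by rewrite expr0z mulr1.
Qed.

Let div_den r x : x != 0 -> x ^+ 2 != r -> 1 - r * x ^- 2 != 0.
Proof.
move=> x0; apply: contra; rewrite subr_eq0 => /eqP e.
by rewrite -[r](mulfVK (expf_neq0 2 x0)) -e mul1r.
Qed.

Lemma laurent_off_reflect_mono (r : F) n : r != 0 ->
  laurent_off r (fun x : F => ((r * x^-1) ^ n - x ^ n) / (1 - r * x ^- 2)).
Proof.
move=> r0.
have pos (k : nat) :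
  laurent_off r (fun x : F => ((r * x^-1) ^ k - x ^ k) / (1 - r * x ^- 2)).
  elim/ltn_ind: k => -[|[|k]] IH.
  - apply: (laurent_off_ext _ (laurent_off_lev r 0)) => x _ _.
    by rewrite lev0 !expr0z subrr mul0r.
  - apply: (laurent_off_ext _ (laurent_off_lev r << -1 *g 1 >>)) => x x0 xr.
    rewrite levU !expr1z; apply: (canRL (mulfK (div_den x0 xr))); field.
    exact: x0.
  - have h1 := IH k.+1 (ltnSn _); have h0 := IH k (leqW (ltnSn _)).
    have := laurent_offD (laurent_offD (laurent_off_mono 1 1 h1)
      (laurent_off_mono r (-1) h1)) (laurent_offZ (- r) h0).
    apply: laurent_off_ext => x x0 xr.
    rewrite !mulrA -!mulrDl; congr (_ / _).
    rewrite expr1z exprN1 mul1r -!exprnP !exprS.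
    set y := r * x^-1; have -> : r = x * y by rewrite /y mulrCA divff ?mulr1.
    by field.
case: n => k; first exact: pos.
have := laurent_offZ (- r ^- k.+1) (pos k.+1).
apply: laurent_off_ext => x x0 xr.
rewrite mulrA; congr (_ / _); rewrite NegzE -!exprnN -!exprnP exprMn exprVn.
by field; rewrite !expf_neq0.
Qed.

Lemma laurent_off_reflect r f : r != 0 ->
  laurent_off r (fun x => (lev f (r * x^-1) - lev f x) / (1 - r * x ^- 2)).
Proof.
move=> r0; elim/freeg_ind_dom0: f => [|a k f _ _ IH].
  apply: (laurent_off_ext _ (laurent_off_lev r 0)) => x _ _.
  by rewrite !lev0 subrr mul0r.
apply: laurent_off_ext
  (laurent_offD (laurent_offZ a (laurent_off_reflect_mono k r0)) IH) => x _ _.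
by rewrite !levD !levU mulrA -mulrDl mulrBr opprD addrACA.
Qed.

Lemma T0E t f : qh t != 0 ->
  forall x, x != 0 -> x ^+ 2 != qq t -> lev (T0 t f) x = T0_formula t f x.
Proof.
move=> q0; rewrite /T0; case: xgetP => [g _ //|ex].
have r0 : qq t != 0 by rewrite expf_neq0.
have h := laurent_off_reflect f r0.
have h' := laurent_offD (laurent_offD h
  (laurent_off_mono (- (qh t * k0 t * u0 t) + qh t * k0 t * (u0 t)^-1) (-1) h))
  (laurent_off_mono (- (qh t * k0 t * u0 t) * (qh t * k0 t * (u0 t)^-1)) (-2) h).
have [g gE] := laurent_offD (laurent_offZ (k0 t) (laurent_off_lev (qq t) f))
  (laurent_offZ (k0 t)^-1 h').
exfalso; apply: (ex g) => x x0 xr; rewrite gE // /T0_formula.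
congr (_ + _); rewrite -[RHS]mulrA; congr (_ * _); rewrite exprN1.
rewrite -[(-2 : int)]/(- (2%:Z)) -exprnN.
set D := (1 - _)^-1; set E := lev _ _ - _.
set A := qh t * k0 t * u0 t; set B := qh t * k0 t * _.
by field.
Qed.

Lemma T1E t f :
  forall x, x != 0 -> x ^+ 2 != 1 -> lev (T1 t f) x = T1_formula t f x.
Proof.
rewrite /T1; case: xgetP => [g _ //|ex].
have h := laurent_off_reflect f (oner_neq0 F).
have h' := laurent_offD (laurent_offD (laurent_off_mono (-1) (-2) h)
  (laurent_off_mono (k1 t * u1 t - k1 t * (u1 t)^-1) (-1) h))
  (laurent_offZ (k1 t * u1 t * (k1 t * (u1 t)^-1)) h).
have [g gE] := laurent_offD (laurent_offZ (k1 t) (laurent_off_lev 1 f))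
  (laurent_offZ (k1 t)^-1 h').
exfalso; apply: (ex g) => x x0 xr; rewrite gE // /T1_formula.
congr (_ + _); rewrite -[RHS]mulrA; congr (_ * _); rewrite exprN1 !mul1r.
rewrite -[(-2 : int)]/(- (2%:Z)) -exprnN.
have d1 : 1 - x ^+ 2 != 0 by rewrite subr_eq0 eq_sym.
have d2 := div_den x0 xr; rewrite mul1r in d2.
have -> : 1 - x ^- 2 = - (1 - x ^+ 2) * x ^- 2 by field.
set E := lev _ _ - _; set A := k1 t * u1 t; set B := k1 t * _.
by field; rewrite oppr_eq0 x0 d1.
Qed.
End Algebra.

Section Contour.
Variable R : realType.
Local Notation C := R[i].
Implicit Types (g : R -> C) (w : C).

Definition rectifiable g : Prop :=
  exists M : R, forall s : seq R, itv_partition 0 1 s ->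
    \sum_(j < size s) `|g (nth 0 (0 :: s) j.+1) - g (nth 0 (0 :: s) j)|
      <= M%:C.

(* A closed Jordan curve parametrized by [0,1]. *)
Definition jordan_curve g : Prop :=
  [/\ {within `[0, 1], continuous (g : R -> C^o)}, g 0 = g 1
    & {in `[0, 1[ &, injective g}].

Definition trace_of g : set C := g @` `[0, 1].

Definition component_at g w : set C^o :=
  connected_component (~` (trace_of g : set C^o)) w.

Definition in_interior g w : Prop :=
  ~ trace_of g w /\ bounded_set (component_at g w).

Definition in_exterior g w : Prop :=
  ~ trace_of g w /\ ~ bounded_set (component_at g w).

(* The integral of [G] along a rectifiable curve [g] is a Riemann-Stieltjes
   integral: the limit of the sums of G (g (xi_j)) (g (s_(j+1)) - g (s_j))
   over tagged partitions of [0,1], as the mesh tends to 0. *)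
Definition is_contour_integral g (G : C -> C) (I : C) : Prop :=
  forall e : R, 0 < e -> exists2 d : R, 0 < d &
    forall (s : seq R) (xi : nat -> R), itv_partition 0 1 s ->
    (forall j, (j < size s)%N ->
       nth 0 (0 :: s) j <= xi j <= nth 0 (0 :: s) j.+1 /\
       nth 0 (0 :: s) j.+1 - nth 0 (0 :: s) j < d) ->
    `|\sum_(j < size s) G (g (xi j))
        * (g (nth 0 (0 :: s) j.+1) - g (nth 0 (0 :: s) j)) - I| < e%:C.

(* Meaningful only when the integral exists, otherwise 0. *)
Definition contour_integral g (G : C -> C) : C :=
  xget 0 [set I | is_contour_integral g G I].

Definition twopii : C := (2 * pi : R)%:C * 'i%C.

(* Winding number 1 about every point of the interior. *)
Definition counterclockwise g : Prop :=
  forall w, in_interior g w -> contour_integral g (fun z => (z - w)^-1) = twopii.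

Definition qpoch (y q : C) : C :=
  lim ((fun n : nat => (\prod_(j < n) (1 - y * q ^+ j) : C^o)) @ \oo).

Definition qpochs (ys : seq C) (q : C) : C := \prod_(y <- ys) qpoch y q.

Definition Delta (t : params C) (x : C) : C :=
  let: (a, b, c, d, q) := (pa t, pb t, pc t, pd t, qq t) in
  qpochs [:: x ^+ 2; q * x ^- 2] q
  / qpochs [:: a * x; b * x; c * x; d * x;
               q * a * x^-1; q * b * x^-1; c * x^-1; d * x^-1] q.

Definition integrand (t : params C) (f h : laurent C) (x : C) : C :=
  lev f x * lev h x^-1 * Delta t x * x^-1.

Definition aw_form (t : params C) g (f h : laurent C) : C :=
  twopii^-1 * contour_integral g (integrand t f h).

Definition abcd (t : params C) : seq C := [:: pa t; pb t; pc t; pd t].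

(* [0] may not lie on the curve: the integrand is only defined on C^*. *)
Definition admissible_contour (t : params C) g : Prop :=
  [/\ jordan_curve g, rectifiable g, counterclockwise g, ~ trace_of g 0
    & forall e, e \in abcd t -> forall k : nat,
        in_interior g (e * qq t ^+ k) /\
        in_exterior g (e^-1 * (qq t)^-1 ^+ k)].

Definition admissible_params (t : params C) : Prop :=
  [/\ 0 < `|qq t| < 1,
      [/\ k0 t != 0, k1 t != 0, u0 t != 0 & u1 t != 0],
      forall e, e \in [:: k0 t; k1 t; u1 t] -> forall j : int,
        e ^+ 2 != qq t ^ j /\ e ^+ 2 != - qq t ^ j
    & forall e f, e \in abcd t -> f \in abcd t -> forall j : int,
        e * f != qq t ^ j].

End Contour.

(* Main.v *)
(* On the contour, the integrand is a uniform limit of rational functions, obtained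
   by truncating the infinite products; their poles are 0, finitely many points
   e q^k inside and finitely many points e^-1 q^-k outside, with e in {a, b, c, d}.
   By partial fractions the integral of F(x) dx/x for such an F is unchanged when
   x is replaced by r/x, as soon as this substitution exchanges inner and outer
   poles; no deformation of the contour is needed. For r = 1 and r = q this gives
   <T_i f, T_i' h> = <f, h>, hence the same for Y, so eigenvectors with eigenvalues
   x and y are orthogonal unless xy = 1. The gamma_m are pairwise distinct because
   P_m would not be unique otherwise.

   Nondegeneracy: if f is orthogonal to everything, let F_n be the product of f with
   the truncated numerator of Delta. Testing against the truncated denominator
   times the conjugate of F_n, dilated by s, shows that sum_k |F_n[k]|^2 s^k tends
   to 0 for every s > 0. Hence F_n tends to 0 pointwise off 0, so f vanishes
   wherever the numerator of Delta does not, and f = 0.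

   The two families span A by triangularity, and a spanning family that is
   bi-orthogonal to another one for a nondegenerate form is a basis. *)
Require Import Defs.
From HB Require Import structures.
From mathcomp Require Import all_boot all_order all_algebra.
From mathcomp Require Import all_classical all_reals all_analysis.
From mathcomp.real_closed Require Import complex.
From mathcomp Require Import freeg ring lra zify.

Set Implicit Arguments.
Unset Strict Implicit.
Unset Printing Implicit Defensive.

Import Order.TTheory GRing.Theory Num.Theory numFieldNormedType.Exports.

Local Open Scope classical_set_scope.
Local Open Scope complex_scope.
Local Open Scope ring_scope.

(** * Moduli and uniform limits *)

(** Winding numbers are the only topological input. Integer powers of x - p other than the simple
    pole have primitives and integrate to 0, so a rational function sees the curve only through the
    winding numbers of its poles, here 0 or 1; the point 0 is enclosed because the points a q^k
    accumulate there. Under x -> r / x the form dx / (x - p) becomes, after reversal of orientation,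
    dx / x - dx / (x - r / p): a simple pole is compatible with the substitution when the winding
    numbers of p and r / p add up to that of 0.

    Delta itself is not invariant under the two substitutions. With phi the rational coefficient in
    T_i, stripped of its constant, the weight Delta phi is invariant, and (T_i f)(x) (T_i' h)(1/x) -
    f(x) h(1/x) is phi times a Laurent polynomial that changes sign, so its integral vanishes.

    For nondegeneracy the obstacle is that conjugation does not preserve Laurent polynomials on a
    general curve. The reflection x -> s / conj(x) repairs this, and the freedom in s gives control
    at every radius, whatever the shape of the curve. *)

Section Modulus.
Variable R : realType.
Local Notation C := R[i].
Implicit Types (x y z : C) (r : R).

(** The norm of [R[i]] takes its values in [R[i]], where the order is partial. A real-valued modulus
    makes the estimates accessible to [lra]. *)
Definition cabs z : R := ComplexField.Normc.normc z.

Lemma normCE z : `|z| = (cabs z)%:C. Proof. by case: z. Qed.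

Lemma cabs_ltE z r : (`|z| < r%:C) = (cabs z < r).
Proof. by rewrite normCE ltcR. Qed.

Lemma cabs_leE z r : (`|z| <= r%:C) = (cabs z <= r).
Proof. by rewrite normCE lecR. Qed.

Lemma cabs_ge0 z : 0 <= cabs z.
Proof. by rewrite -lecR -normCE normr_ge0. Qed.

Lemma cabsM x y : cabs (x * y) = cabs x * cabs y.
Proof. by apply: complexI; rewrite rmorphM /= -!normCE normrM. Qed.

Lemma cabsD x y : cabs (x + y) <= cabs x + cabs y.
Proof. by rewrite -lecR rmorphD /= -!normCE ler_normD. Qed.

Lemma cabsN x : cabs (- x) = cabs x.
Proof. by apply: complexI; rewrite -!normCE normrN. Qed.

Lemma cabsB x y : cabs (x - y) = cabs (y - x).
Proof. by rewrite -cabsN opprB. Qed.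

Lemma cabs_real r : cabs r%:C = `|r|.
Proof. by rewrite /cabs /= expr0n /= addr0 sqrtr_sqr. Qed.

Lemma cabs0 : cabs 0 = 0.
Proof. by rewrite -[0]/(0%:C) cabs_real normr0. Qed.

Lemma cabs1 : cabs 1 = 1.
Proof. by rewrite -[1]/(1%:C) cabs_real normr1. Qed.

Lemma cabs_eq0 z : (cabs z == 0) = (z == 0).
Proof. by rewrite -[z == 0]normr_eq0 normCE -(inj_eq (@complexI R)). Qed.

Lemma cabs_gt0 z : (0 < cabs z) = (z != 0).
Proof. by rewrite lt_def cabs_ge0 andbT cabs_eq0. Qed.

Lemma cabsV z : cabs z^-1 = (cabs z)^-1.
Proof. by apply: complexI; rewrite fmorphV /= -!normCE normfV. Qed.

Lemma cabsX z n : cabs (z ^+ n) = cabs z ^+ n.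
Proof. by elim: n => [|n IH]; rewrite ?cabs1 // !exprS cabsM IH. Qed.

Lemma cabsXz z (n : int) : cabs (z ^ n) = cabs z ^ n.
Proof. by case: n => n; rewrite ?NegzE -?exprnN ?cabsV cabsX. Qed.

Lemma cabs_conj z : cabs (z^*)%C = cabs z.
Proof. by case: z => a b; rewrite /cabs /= sqrrN. Qed.

Lemma cabs_subD x y z : cabs (x - z) <= cabs (x - y) + cabs (y - z).
Proof. by have := cabsD (x - y) (y - z); rewrite addrA subrK. Qed.

Lemma cabs_lower x y : cabs x - cabs y <= cabs (x - y).
Proof. by have := cabsD (x - y) y; rewrite subrK lerBlDr. Qed.

Lemma cabs_sum (I : Type) (s : seq I) (P : pred I) (F : I -> C) :
  cabs (\sum_(i <- s | P i) F i) <= \sum_(i <- s | P i) cabs (F i).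
Proof.
elim/big_rec2: _ => [|i y1 y2 _ h]; first by rewrite cabs0.
by rewrite (le_trans (cabsD _ _)) // lerD2l.
Qed.

Lemma cabs_prod (I : Type) (s : seq I) (P : pred I) (F : I -> C) :
  cabs (\prod_(i <- s | P i) F i) = \prod_(i <- s | P i) cabs (F i).
Proof.
elim/big_rec2: _ => [|i y1 y2 _ h]; first by rewrite cabs1.
by rewrite cabsM h.
Qed.

Lemma cabs_Re z : `|complex.Re z| <= cabs z.
Proof. by rewrite -lecR -normCE; exact: normc_ge_Re. Qed.

Lemma cabs_Im z : `|complex.Im z| <= cabs z.
Proof.
have := cabs_Re (z * 'i%C); rewrite ReiNIm normrN cabsM => /le_trans; apply.
by rewrite /cabs /= expr0n /= expr1n add0r sqrtr1 mulr1.
Qed.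

Lemma cabs_ReIm z : cabs z <= `|complex.Re z| + `|complex.Im z|.
Proof.
rewrite {1}[z]complexE (le_trans (cabsD _ _)) // cabs_real cabsM cabs_real.
by rewrite /cabs /= expr0n /= expr1n add0r sqrtr1 mul1r.
Qed.

Lemma ltcP (e : C) : 0 < e -> exists2 r, 0 < r & e = r%:C.
Proof.
by case: e => a b; rewrite ltcE /= => /andP[/eqP -> a0]; exists a.
Qed.

End Modulus.

Arguments cabs : simpl never.

Section Limits.
Variable R : realType.
Local Notation C := R[i].
Implicit Types (u v : nat -> C) (l m : C) (K : set C) (f h : nat -> C -> C).

Definition cvgC u l := forall e : R, 0 < e ->
  exists N, forall n, (N <= n)%N -> cabs (u n - l) < e.

Lemma cvgC_unique u l m : cvgC u l -> cvgC u m -> l = m.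
Proof.
move=> ul um; apply/eqP; rewrite -subr_eq0 -cabs_eq0; apply/negPn/negP => h.
have h0 : 0 < cabs (l - m) / 2 by rewrite divr_gt0 // lt_def h cabs_ge0.
have [N hN] := ul _ h0; have [N' hN'] := um _ h0.
have := cabs_subD l (u (maxn N N')) m; rewrite leNgt cabsB => /negP; apply.
rewrite [ltRHS]splitr ltrD //; first by apply/hN/leq_maxl.
by apply/hN'/leq_maxr.
Qed.

Lemma cvgC_cst l : cvgC (fun=> l) l.
Proof. by move=> e e0; exists 0%N => n _; rewrite subrr cabs0. Qed.

Lemma cvgC_lim u l : cvgC u l -> lim ((u : nat -> C^o) @ \oo) = l.
Proof.
move=> ul; apply: cvg_lim; first exact: norm_hausdorff.
apply/cvgrPdist_lt => e /ltcP[r r0 ->]; have [N hN] := ul r r0.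
by exists N => // n /= Nn; rewrite cabs_ltE cabsB hN.
Qed.

(** Completeness of [R] is applied to the real and the imaginary part separately; both are
    1-Lipschitz for [cabs]. *)
Lemma cvgC_cauchy u :
  (forall e : R, 0 < e -> exists N, forall n k, (N <= n)%N -> (N <= k)%N ->
    cabs (u n - u k) < e) -> exists l, cvgC u l.
Proof.
move=> uC.
have key (p : C -> R) : (forall x y, p (x - y) = p x - p y) ->
    (forall z, `|p z| <= cabs z) ->
    exists l : R, forall e, 0 < e -> exists N, forall n, (N <= n)%N ->
      `|p (u n) - l| < e.
  move=> pB ple.
  have /cauchy_cvg/cvg_ex[l /cvgrPdist_lt ul] : cauchy ((p \o u) @ \oo).
    apply: cauchy_exP => e e0; have [N hN] := uC e e0.
    exists (p (u N)); exists N => // n /= Nn.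
    by rewrite /ball /= -pB (le_lt_trans (ple _)) // hN.
  exists l => e e0; have [N _ hN] := ul e e0; exists N => n Nn.
  by rewrite distrC; exact: hN.
have [a ha] := key (@complex.Re R) (raddfB _) (@cabs_Re R).
have [b hb] := key (@complex.Im R) (raddfB _) (@cabs_Im R).
exists (a +i* b) => e e0; have e20 : 0 < e / 2 by rewrite divr_gt0.
have [N hN] := ha _ e20; have [N' hN'] := hb _ e20.
exists (maxn N N') => n; rewrite geq_max => /andP[/hN h /hN' h'].
rewrite (le_lt_trans (cabs_ReIm _)) // [ltRHS]splitr.
by case: (u n) h h' => x y /= h h'; rewrite ltrD.
Qed.

Lemma cvgC_sub_le u l (b : R) :
  cvgC u l -> (exists N, forall n, (N <= n)%N -> cabs (u n) <= b) -> cabs l <= b.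
Proof.
move=> ul [N hN]; rewrite leNgt; apply/negP => bl.
have e0 : 0 < cabs l - b by rewrite subr_gt0.
have [N' hN'] := ul _ e0; have := hN' _ (leq_maxr N N').
have := hN _ (leq_maxl N N'); set x := u _ => h1.
have := cabs_lower l x; rewrite cabsB; lra.
Qed.

(** The bound is uniform in the index as well as on the set, which makes uniform convergence stable
    under products. *)
Definition ubnd K f := exists B : R, forall n x, K x -> cabs (f n x) <= B.

Definition ucv K f (F : C -> C) := forall e : R, 0 < e ->
  exists N, forall n, (N <= n)%N -> forall x, K x -> cabs (f n x - F x) < e.

Lemma ucv_ext K f F h H : (forall n x, K x -> f n x = h n x) ->
  (forall x, K x -> F x = H x) -> ucv K f F -> ucv K h H.
Proof.
move=> fh FH fF e e0; have [N hN] := fF e e0.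
by exists N => n Nn x Kx; rewrite -fh // -FH // hN.
Qed.

Lemma ucv_bnd K f F : ubnd K f -> ucv K f F ->
  exists2 B : R, 0 < B & (forall n x, K x -> cabs (f n x) <= B) /\
                   (forall x, K x -> cabs (F x) <= B).
Proof.
move=> [B hB] fF; exists (`|B| + 1); first by rewrite ltr_wpDl.
have hB' n x : K x -> cabs (f n x) <= `|B| + 1.
  by move=> Kx; rewrite (le_trans (hB n x Kx)) // ler_wpDr // ler_norm.
split => // x Kx; apply: (@cvgC_sub_le (f^~ x)); last by exists 0%N => n _; exact: hB'.
by move=> e e0; have [N hN] := fF e e0; exists N => n Nn; exact: hN.
Qed.

Lemma ucv_cst K F : ucv K (fun=> F) F.
Proof. by move=> e e0; exists 0%N => n _ x _; rewrite subrr cabs0. Qed.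

Lemma ubnd_cst K (F : C -> C) (B : R) :
  (forall x, K x -> cabs (F x) <= B) -> ubnd K (fun=> F).
Proof. by move=> h; exists B => n x; exact: h. Qed.

Lemma ubndM K f h : ubnd K f -> ubnd K h -> ubnd K (fun n x => f n x * h n x).
Proof.
move=> [B hB] [B' hB']; exists (B * B') => n x Kx.
by rewrite cabsM ler_pM ?cabs_ge0 ?hB ?hB'.
Qed.

Lemma ucvM K f F h H : ubnd K f -> ubnd K h -> ucv K f F -> ucv K h H ->
  ucv K (fun n x => f n x * h n x) (fun x => F x * H x).
Proof.
move=> bf bh cf ch e e0.
have [A A0 [_ hA]] := ucv_bnd bf cf; have [B B0 [hB _]] := ucv_bnd bh ch.
have e1 : 0 < e / 2 / A by rewrite !divr_gt0.
have e2 : 0 < e / 2 / B by rewrite !divr_gt0.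
have [N hN] := cf _ e2; have [N' hN'] := ch _ e1.
exists (maxn N N') => n; rewrite geq_max => /andP[Nn N'n] x Kx.
have -> : f n x * h n x - F x * H x
    = (f n x - F x) * h n x + F x * (h n x - H x) by ring.
rewrite (le_lt_trans (cabsD _ _)) // !cabsM [e]splitr ltr_leD //.
  apply: (@le_lt_trans _ _ (cabs (f n x - F x) * B)).
    by rewrite ler_wpM2l ?cabs_ge0 ?hB.
  by rewrite -ltr_pdivlMr // hN.
apply: (@le_trans _ _ (A * cabs (h n x - H x))).
  by rewrite ler_wpM2r ?cabs_ge0 ?hA.
by rewrite mulrC -ler_pdivlMr // ltW // hN'.
Qed.

Lemma ucvV K f F (d : R) : 0 < d -> (forall n x, K x -> d <= cabs (f n x)) ->
  ucv K f F ->
  [/\ ubnd K (fun n x => (f n x)^-1), (forall x, K x -> d / 2 <= cabs (F x)) &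
      ucv K (fun n x => (f n x)^-1) (fun x => (F x)^-1)].
Proof.
move=> d0 hd cf.
have hF x : K x -> d / 2 <= cabs (F x).
  move=> Kx; have d20 : 0 < d / 2 by rewrite divr_gt0.
  have [N hN] := cf _ d20; have := hN _ (leqnn N) x Kx; have := hd N x Kx.
  have := cabs_lower (f N x) (F x); lra.
split=> //.
  exists d^-1 => n x Kx; rewrite cabsV lef_pV2 ?posrE ?hd //.
  exact: lt_le_trans (hd n x Kx).
move=> e e0; have e1 : 0 < e * (d * (d / 2)) by rewrite !mulr_gt0 ?invr_gt0.
have [N hN] := cf _ e1; exists N => n Nn x Kx.
have f0 : 0 < cabs (f n x) := lt_le_trans d0 (hd n x Kx).
have F0 : 0 < cabs (F x) by apply: lt_le_trans (hF x Kx); rewrite divr_gt0.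
have -> : (f n x)^-1 - (F x)^-1 = (F x - f n x) / (f n x * F x).
  by field; rewrite -!cabs_gt0 f0 F0.
rewrite !cabsM cabsV cabsM ltr_pdivrMr ?mulr_gt0 // cabsB.
apply: (lt_le_trans (hN n Nn x Kx)); rewrite ler_pM2l //.
by rewrite ler_pM ?hd ?hF // ltW // divr_gt0.
Qed.

End Limits.

(** * Contour integrals *)

Section Curve.
Variables (R : realType) (g : R -> R[i]).
Local Notation C := R[i].
Local Notation K := (trace_of g).
Hypothesis g_cont : {within `[0, 1], continuous (g : R -> C^o)}.
Hypothesis g_rect : rectifiable g.
Hypothesis g_closed : g 0 = g 1.
Implicit Types (G H : C -> C) (I J p x y z : C).

Lemma curve_near t : t \in `[0, 1] -> forall e : R, 0 < e ->
  exists2 d : R, 0 < d & forall s, s \in `[0, 1] -> `|t - s| < d ->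
    cabs (g t - g s) < e.
Proof.
move=> t01 e e0; have t01' : (`[0, 1]%classic : set R) t by [].
have /subspace_continuousP/(_ _ t01')/cvgrPdist_lt := g_cont.
have e0' : 0 < e%:C by rewrite ltcR.
move=> /(_ _ e0')[d /= d0 hd]; exists d => // s s01 ts.
by rewrite -cabs_ltE; apply: hd.
Qed.

(** Heine-Cantor on [0,1], from the form of compactness in which a property that holds near each
    point for all small d holds everywhere for some d. *)
Lemma curve_unif_cont (e : R) : 0 < e -> exists2 d : R, 0 < d &
  forall s t, s \in `[0, 1] -> t \in `[0, 1] -> `|s - t| < d ->
    cabs (g s - g t) < e.
Proof.
move=> e0.
have /compact_near_coveringP cov := @segment_compact R 0 1.
pose P (d s : R) := forall t, s \in `[0, 1] -> t \in `[0, 1] -> `|s - t| < d ->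
    cabs (g s - g t) < e.
have [d /= d0 hd] : \forall d \near (0 : R)^'+, `[0, 1]%classic `<=` P d.
  apply: cov => t0 /= t01; have e20 : 0 < e / 2 by rewrite divr_gt0.
  have [d d0 hd] := curve_near t01 e20; have d20 : 0 < d / 2 by rewrite divr_gt0.
  exists (ball t0 (d / 2), [set r | r < d / 2]).
    split; first exact: nbhsx_ballx.
    exists (d / 2) => //= r /=; rewrite sub0r normrN => h r0.
    by rewrite (le_lt_trans (ler_norm r)).
  move=> [s r] /= []; rewrite /ball /= => st0 rd t s01 t'01 st.
  rewrite (le_lt_trans (cabs_subD _ (g t0) _)) // [ltRHS]splitr ltrD //.
    by rewrite cabsB hd // (lt_trans st0) // ltr_pdivrMr // mulr2n mulrDr mulr1 ltrDl.
  rewrite hd // (_ : t0 - t = (t0 - s) + (s - t)); last by ring.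
  by rewrite (le_lt_trans (ler_normD _ _)) // [ltRHS]splitr ltrD // (lt_trans st).
exists (d / 2); first by rewrite divr_gt0.
move=> s t s01 t01 st; apply: (hd (d / 2)) => //=; last by rewrite divr_gt0.
by rewrite sub0r normrN gtr0_norm ?divr_gt0 // ltr_pdivrMr // mulr2n mulrDr mulr1 ltrDl.
Qed.

Lemma cabs_curve_cont p :
  {within `[0, 1], continuous (fun t : R => cabs (g t - p))}.
Proof.
apply/subspace_continuousP => t t01; apply/cvgrPdist_lt => e e0.
have [d d0 hd] := curve_near t01 e0; exists d => //= s ts s01.
have h : `|cabs (g t - p) - cabs (g s - p)| <= cabs (g t - g s).
  have := cabs_lower (g t - p) (g s - p); have := cabs_lower (g s - p) (g t - p).
  have -> : g t - p - (g s - p) = g t - g s by ring.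
  have -> : g s - p - (g t - p) = - (g t - g s) by ring.
  by rewrite cabsN => h1 h2; rewrite ler_norml; apply/andP; split; lra.
exact: le_lt_trans h (hd s s01 ts).
Qed.

Lemma trace_far p : ~ K p ->
  exists2 d : R, 0 < d & forall x, K x -> d <= cabs (x - p).
Proof.
move=> Kp; have [c c01 hc] := EVT_min ler01 (cabs_curve_cont (p := p)).
exists (cabs (g c - p)); last by move=> _ [t t01 <-]; exact: hc.
by rewrite cabs_gt0 subr_eq0; apply/eqP => gp; apply: Kp; exists c.
Qed.

Lemma trace_bnd : exists2 B : R, 0 < B & forall x, K x -> cabs x <= B.
Proof.
have [c c01 hc] := EVT_max ler01 (cabs_curve_cont (p := 0)).
exists (cabs (g c - 0) + 1); first by rewrite ltr_wpDl ?cabs_ge0.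
by move=> _ [t t01 <-]; rewrite ler_wpDr // -[g t]subr0 hc.
Qed.

Definition RSsum G (s : seq R) (xi : nat -> R) : C :=
  \sum_(j < size s) G (g (xi j)) * (g (nth 0 (0 :: s) j.+1) - g (nth 0 (0 :: s) j)).

Definition tagged (d : R) (s : seq R) (xi : nat -> R) :=
  itv_partition 0 1 s /\ forall j, (j < size s)%N ->
    nth 0 (0 :: s) j <= xi j <= nth 0 (0 :: s) j.+1 /\
    nth 0 (0 :: s) j.+1 - nth 0 (0 :: s) j < d.

Local Notation ci := (is_contour_integral g).

Lemma ciE G I : ci G I <-> forall e : R, 0 < e -> exists2 d : R, 0 < d &
  forall s xi, tagged d s xi -> cabs (RSsum G s xi - I) < e.
Proof.
split=> h e e0; have [d d0 hd] := h e e0; exists d => // s xi.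
  by case=> ps hs; rewrite -cabs_ltE; apply: hd.
by move=> ps hs; rewrite cabs_ltE; apply: hd.
Qed.

Lemma tagged_le d d' s xi : d <= d' -> tagged d s xi -> tagged d' s xi.
Proof.
move=> dd' [ps hs]; split=> // j js; have [h h'] := hs j js; split=> //.
exact: lt_le_trans dd'.
Qed.

Lemma tagged_itv d s xi j : tagged d s xi -> (j <= size s)%N ->
  nth 0 (0 :: s) j \in `[0, 1].
Proof.
move=> [ps _] js; rewrite (set_nth_default 1) // in_itv /=.
by rewrite itv_partition_nth_ge // itv_partition_nth_le.
Qed.

Lemma tagged_xi d s xi j : tagged d s xi -> (j < size s)%N -> xi j \in `[0, 1].
Proof.
move=> ts js; have [_ /(_ j js)[/andP[h1 h2] _]] := ts.
have := tagged_itv ts (ltnW js); have := tagged_itv ts js.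
rewrite !in_itv /= => /andP[_ h] /andP[h' _].
by rewrite (le_trans h' h1) (le_trans h2 h).
Qed.

(** Arbitrarily fine tagged partitions keep the limit from being vacuous; the length estimate and
    the uniqueness of the integral rest on them. *)
Lemma tagged_exists (d : R) : 0 < d -> exists s xi, tagged d s xi.
Proof.
move=> d0; have [n hn] : exists n : nat, n.+1%:R^-1 < d.
  have [n _ /(_ n (leqnn n)) /= h] := near_infty_natSinv_lt (PosNum d0).
  by exists n.
set m := n.+1 in hn; have m0 : (0 : R) < m%:R by rewrite ltr0n.
pose s := [seq k.+1%:R / m%:R : R | k <- iota 0 m].
have ss : size s = m by rewrite size_map size_iota.
have nthE j : (j <= m)%N -> nth 0 (0 :: s) j = j%:R / m%:R.
  case: j => [|j] jm /=; first by rewrite mul0r.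
  by rewrite (nth_map 0%N) ?size_iota // nth_iota.
exists s, (nth 0 (0 :: s)); split.
  split.
    apply/(pathP 0) => i; rewrite ss => im.
    rewrite nthE; last exact: ltnW.
    have := nthE i.+1 im => /= ->.
    by rewrite ltr_pM2r ?invr_gt0 // ltr_nat.
  rewrite -nth_last ss /= -[nth _ s n]/(nth 0 (0 :: s) m).
  by rewrite nthE // divff // gt_eqF.
move=> j; rewrite ss => jm; rewrite !nthE ?(ltnW jm) //.
rewrite lexx ler_pM2r ?invr_gt0 // ler_nat leqnSn; split=> //.
by rewrite -mulrBl -natrB // subSnn mul1r.
Qed.

Lemma total_variation : exists2 M : R, 0 < M & forall d s xi, tagged d s xi ->
  \sum_(j < size s) cabs (g (nth 0 (0 :: s) j.+1) - g (nth 0 (0 :: s) j)) <= M.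
Proof.
have [M hM] := g_rect; exists (`|M| + 1); first by rewrite ltr_wpDl.
move=> d s xi [ps _]; rewrite (@le_trans _ _ M) //; last first.
  by rewrite ler_wpDr // ler_norm.
rewrite -lecR rmorph_sum /=; apply: le_trans (hM s ps).
by under eq_bigr do rewrite -normCE.
Qed.

Lemma RSsum_bnd : exists2 M : R, 0 < M & forall d s xi, tagged d s xi ->
  forall G (c : R), (forall x, K x -> cabs (G x) <= c) ->
  cabs (RSsum G s xi) <= c * M.
Proof.
have [M M0 hM] := total_variation; exists M => // d s xi ts G c hc.
have c0 : 0 <= c.
  apply: (le_trans (cabs_ge0 (G (g 0)))); apply: hc; exists 0 => //=.
  by rewrite in_itv /= lexx ler01.
apply: (le_trans (cabs_sum _ _ _)).
apply: (@le_trans _ _ (\sum_(j < size s)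
   c * cabs (g (nth 0 (0 :: s) j.+1) - g (nth 0 (0 :: s) j)))).
  apply: ler_sum => j _; rewrite cabsM ler_wpM2r ?cabs_ge0 // hc //.
  by exists (xi j) => //; apply: (tagged_xi ts).
by rewrite -mulr_sumr ler_wpM2l // (hM _ _ _ ts).
Qed.

Lemma RSsum_lin (a : C) G H s xi :
  RSsum (fun x => a * G x + H x) s xi = a * RSsum G s xi + RSsum H s xi.
Proof.
rewrite /RSsum mulr_sumr -big_split /=.
by apply: eq_bigr => j _; rewrite mulrDl mulrA.
Qed.

Lemma ci_ext G H I : (forall x, K x -> G x = H x) -> ci G I -> ci H I.
Proof.
move=> GH /ciE h; apply/ciE => e e0; have [d d0 hd] := h e e0; exists d => //.
move=> s xi ts; rewrite (_ : RSsum H s xi = RSsum G s xi) ?hd //.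
apply: eq_bigr => j _; rewrite GH //; exists (xi j) => //.
exact: (tagged_xi ts).
Qed.

Lemma ci_lin (a : C) G H I J : ci G I -> ci H J ->
  ci (fun x => a * G x + H x) (a * I + J).
Proof.
move=> /ciE hG /ciE hH; apply/ciE => e e0.
have e1 : 0 < e / 2 / (cabs a + 1).
  by rewrite !divr_gt0 // ltr_wpDl ?cabs_ge0.
have e2 : 0 < e / 2 by rewrite divr_gt0.
have [d d0 hd] := hG _ e1; have [d' d'0 hd'] := hH _ e2.
exists (Num.min d d'); first by rewrite lt_min d0.
move=> s xi ts; rewrite RSsum_lin.
have -> : a * RSsum G s xi + RSsum H s xi - (a * I + J)
   = a * (RSsum G s xi - I) + (RSsum H s xi - J) by ring.
rewrite (le_lt_trans (cabsD _ _)) // [e]splitr ler_ltD //; last first.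
  by apply/hd'/(tagged_le _ ts); rewrite ge_min lexx orbT.
have h : cabs (RSsum G s xi - I) < e / 2 / (cabs a + 1).
  by apply/hd/(tagged_le _ ts); rewrite ge_min lexx.
have a1 : 0 < cabs a + 1 by rewrite ltr_wpDl ?cabs_ge0.
rewrite cabsM; apply: (@le_trans _ _ ((cabs a + 1) * cabs (RSsum G s xi - I))).
  by rewrite ler_wpM2r ?cabs_ge0 // lerDl.
by rewrite mulrC -ler_pdivlMr // ltW.
Qed.

Lemma ci0 : ci (fun=> 0) 0.
Proof.
apply/ciE => e e0; exists 1 => // s xi _.
by rewrite /RSsum big1 ?subr0 ?cabs0 // => j _; rewrite mul0r.
Qed.

Lemma ciZ (a : C) G I : ci G I -> ci (fun x => a * G x) (a * I).
Proof.
move=> /(ci_lin a)/(_ ci0); rewrite addr0; apply: ci_ext => x _.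
by rewrite addr0.
Qed.

Lemma ciD G H I J : ci G I -> ci H J -> ci (fun x => G x + H x) (I + J).
Proof.
move=> /(ci_lin 1) hG /hG; rewrite mul1r; apply: ci_ext => x _.
by rewrite mul1r.
Qed.

Lemma ci_sum (T : Type) (r : seq T) (F : T -> C -> C) (I : T -> C) :
  (forall i, ci (F i) (I i)) ->
  ci (fun x => \sum_(i <- r) F i x) (\sum_(i <- r) I i).
Proof.
move=> h; elim: r => [|i r IH].
  by rewrite big_nil; apply: ci_ext ci0 => x _; rewrite big_nil.
rewrite big_cons; apply: ci_ext (ciD (h i) IH) => x _.
by rewrite big_cons.
Qed.

Lemma ci_bnd : exists2 M : R, 0 < M & forall G I (c : R),
  (forall x, K x -> cabs (G x) <= c) -> ci G I -> cabs I <= c * M.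
Proof.
have [M M0 hM] := RSsum_bnd; exists M => // G I c hc /ciE h.
rewrite leNgt; apply/negP => lt.
have e0 : 0 < cabs I - c * M by rewrite subr_gt0.
have [d d0 hd] := h _ e0; have [s [xi ts]] := tagged_exists d0.
have := hM _ _ _ ts G c hc; have := hd _ _ ts.
have := cabs_lower I (RSsum G s xi); rewrite cabsB; lra.
Qed.

Lemma ci_unique G I J : ci G I -> ci G J -> I = J.
Proof.
move=> hI hJ; have [M M0 hM] := ci_bnd.
have /hM : ci (fun x => -1 * G x + G x) (-1 * I + J) by apply: ci_lin.
move=> /(_ 0); rewrite mul0r => h; have : cabs (-1 * I + J) <= 0.
  by apply: h => x _; rewrite mulN1r addNr cabs0.
rewrite le_eqVlt ltNge cabs_ge0 orbF cabs_eq0 mulN1r addrC subr_eq0.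
by move=> /eqP.
Qed.

(** Existence of the limit integral is part of the conclusion: the length estimate makes the
    integrals a Cauchy sequence, and a three-epsilon comparison of Riemann sums shows that its limit
    is the integral of [H]. *)
Lemma ci_ucv (G : nat -> C -> C) (I : nat -> C) H :
  (forall n, ci (G n) (I n)) -> ucv K G H -> exists2 J, ci H J & cvgC I J.
Proof.
move=> hG GH; have [M M0 hM] := ci_bnd.
have small (e : R) : 0 < e -> exists N, forall n, (N <= n)%N -> forall x, K x ->
    cabs (G n x - H x) <= e / M.
  move=> e0; have eM : 0 < e / M by rewrite divr_gt0.
  by have [N hN] := GH _ eM; exists N => n Nn x Kx; apply/ltW/hN.
have [J IJ] : exists J, cvgC I J.
  apply: cvgC_cauchy => e e0; have e4 : 0 < e / 4 by rewrite divr_gt0.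
  have [N hN] := small _ e4; exists N => n m Nn Nm.
  have /hM : ci (fun x => -1 * G m x + G n x) (-1 * I m + I n) by apply: ci_lin.
  move=> /(_ (e / 2 / M)) h; rewrite addrC mulN1r in h.
  apply: (@le_lt_trans _ _ (e / 2 / M * M)); last first.
    by rewrite divfK ?gt_eqF // ltr_pdivrMr // mulr2n mulrDr mulr1 ltrDl.
  apply: h => x Kx; have -> : -1 * G m x + G n x = (G n x - H x) - (G m x - H x) by ring.
  rewrite (le_trans (cabsD _ _)) // cabsN.
  apply: le_trans (lerD (hN n Nn x Kx) (hN m Nm x Kx)) _.
  by rewrite -mulrDl ler_wpM2r ?invr_ge0 ?(ltW M0) //; lra.
exists J => //; apply/ciE => e e0; have [M' M'0 hM'] := RSsum_bnd.
have e3 : 0 < e / 3 by rewrite divr_gt0.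
have eM : 0 < e / 3 / M' by rewrite divr_gt0.
have [N hN] := GH _ eM; have [N' hN'] := IJ _ e3.
set n := maxn N N'; have /ciE/(_ _ e3)[d d0 hd] := hG n.
exists d => // s xi ts.
have := hd _ _ ts; have := hN' n (leq_maxr _ _).
have : cabs (RSsum H s xi - RSsum (G n) s xi) <= e / 3.
  have -> : RSsum H s xi - RSsum (G n) s xi
     = RSsum (fun x => -1 * G n x + H x) s xi by rewrite RSsum_lin; ring.
  rewrite -[leRHS](divfK (lt0r_neq0 M'0)); apply: (hM' _ _ _ ts) => x Kx.
  by rewrite mulN1r addrC cabsB; apply/ltW/hN => //; exact: leq_maxl.
set a := RSsum H s xi; set b := RSsum (G n) s xi => h1 h2 h3.
have := cabs_subD a b J; have := cabs_subD b (I n) J; lra.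
Qed.

(* Two-point differentiability along the trace: it is stable under products, and
   it turns the fundamental theorem of calculus into a telescoping sum. *)
Definition sdiff (F F' : C -> C) := exists2 B : R, 0 < B &
  forall x y z, K x -> K y -> K z ->
  [/\ cabs (F x) <= B, cabs (F' x) <= B, cabs (F x - F y) <= B * cabs (x - y) &
  cabs (F x - F y - F' z * (x - y))
    <= B * (cabs (x - z) + cabs (y - z)) * cabs (x - y)].

Lemma ci_sdiff F F' : sdiff F F' -> ci F' 0.
Proof.
move=> [B B0 hB]; apply/ciE => e e0; have [M M0 hM] := total_variation.
(* Both endpoints of a subarc will be this close to the tag, so a term errs by at most e / (2 M)
   times its chord, and the whole sum by at most e / 2. *)
have e1 : 0 < e / (4 * B * M) by rewrite divr_gt0 ?mulr_gt0.
have [d d0 hd] := curve_unif_cont e1; exists d => // s xi ts.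
have -> : 0 = \sum_(j < size s)
    (F (g (nth 0 (0 :: s) j.+1)) - F (g (nth 0 (0 :: s) j))).
  rewrite -(big_mkord xpredT (fun j => F (g (nth 0 (0 :: s) j.+1))
      - F (g (nth 0 (0 :: s) j)))) telescope_sumr // nth0 /=.
  have [[_ /eqP h] _] := ts.
  have -> : nth 0 (0 :: s) (size s) = 1.
    by rewrite -h; case: (s) => // u r; rewrite -nth_last.
  by rewrite -g_closed subrr.
rewrite cabsB /RSsum -sumrB.
apply: (@le_lt_trans _ _ (\sum_(j < size s) e / (2 * M) *
   cabs (g (nth 0 (0 :: s) j.+1) - g (nth 0 (0 :: s) j)))).
  apply: (le_trans (cabs_sum _ _ _)); apply: ler_sum => j _.
  have js := ltn_ord j; have n1 := tagged_itv ts (ltnW js).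
  have n2 := tagged_itv ts js; have x1 := tagged_xi ts js.
  have [_ /(_ _ js)[/andP[h1 h2] h3]] := ts.
  have Kg t : t \in `[0, 1] -> K (g t) by exists t.
  have [_ _ _] := hB _ _ _ (Kg _ n2) (Kg _ n1) (Kg _ x1) => /le_trans; apply.
  rewrite ler_wpM2r ?cabs_ge0 // -ler_pdivlMl //.
  have := hd _ _ n2 x1; have := hd _ _ n1 x1.
  rewrite ltr_distl ltr_distl => /(_ _)/ltW A /(_ _)/ltW A'.
  have -> : B^-1 * (e / (2 * M)) = e / (4 * B * M) + e / (4 * B * M).
    by field; rewrite !gt_eqF.
  by apply: lerD; [apply: A' | apply: A]; lra.
rewrite -mulr_sumr; apply: (@le_lt_trans _ _ (e / (2 * M) * M)).
  by rewrite ler_wpM2l ?(hM _ _ _ ts) // divr_ge0 ?(ltW e0) // mulr_ge0 // ltW.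
have -> : e / (2 * M) * M = e / 2 by field; rewrite gt_eqF.
lra.
Qed.

Lemma sdiff_id : sdiff id (fun=> 1).
Proof.
have [B B0 hB] := trace_bnd; exists (B + 1); first by rewrite addr_gt0.
move=> x y z Kx Ky Kz /=; rewrite mul1r subrr cabs0 cabs1; split.
- by rewrite ler_wpDr // hB.
- by rewrite ler_wpDl // ltW.
- by rewrite ler_peMl ?cabs_ge0 // ler_wpDl // ltW.
- by rewrite !mulr_ge0 ?addr_ge0 ?cabs_ge0 // ltW.
Qed.

Lemma sdiffM F F' H H' : sdiff F F' -> sdiff H H' ->
  sdiff (fun x => F x * H x) (fun x => F' x * H x + F x * H' x).
Proof.
move=> [A A0 hA] [B B0 hB]; exists (4 * A * B); first by rewrite !mulr_gt0.
have AB0 : 0 < A * B by rewrite mulr_gt0.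
move=> x y z Kx Ky Kz.
have [a1 a2 a3 a4] := hA x y z Kx Ky Kz; have [b1 b2 b3 b4] := hB x y z Kx Ky Kz.
have [_ _ b5 _] := hB x z z Kx Kz Kz; have [a5 _ a6 _] := hA y z z Ky Kz Kz.
have [_ a7 _ _] := hA z z z Kz Kz Kz; have [_ b7 _ _] := hB z z z Kz Kz Kz.
have M1 (u v : C) (a b : R) : cabs u <= a -> cabs v <= b -> cabs (u * v) <= a * b.
  by move=> h1 h2; rewrite cabsM ler_pM ?cabs_ge0.
split.
- by rewrite (le_trans (M1 _ _ _ _ a1 b1)) //; lra.
- rewrite (le_trans (cabsD _ _)) //.
  by have := M1 _ _ _ _ a2 b1; have := M1 _ _ _ _ a1 b2; lra.
- have -> : F x * H x - F y * H y = (F x - F y) * H x + F y * (H x - H y) by ring.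
  rewrite (le_trans (cabsD _ _)) //.
  have := M1 _ _ _ _ a3 b1; have := M1 _ _ _ _ a5 b3.
  have : 0 <= A * B * cabs (x - y) by rewrite mulr_ge0 ?cabs_ge0 // ltW.
  set u := cabs (x - y); lra.
(* Leibniz rule frozen at z: the first-order errors of F and of H, plus the cost of moving H from x
   to z and F from y to z. *)
- have -> : F x * H x - F y * H y - (F' z * H z + F z * H' z) * (x - y)
    = ((F x - F y - F' z * (x - y)) * H x + F' z * (H x - H z) * (x - y))
    + (F y * (H x - H y - H' z * (x - y)) + (F y - F z) * H' z * (x - y)) by ring.
  rewrite (le_trans (cabsD _ _)) //.
  have := cabsD ((F x - F y - F' z * (x - y)) * H x) (F' z * (H x - H z) * (x - y)).
  have := cabsD (F y * (H x - H y - H' z * (x - y))) ((F y - F z) * H' z * (x - y)).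
  have := M1 _ _ _ _ a4 b1; have := M1 _ _ _ _ a5 b4.
  have := M1 _ _ _ _ (M1 _ _ _ _ a7 b5) (lexx (cabs (x - y))).
  have := M1 _ _ _ _ (M1 _ _ _ _ a6 b7) (lexx (cabs (x - y))).
  set u := cabs (x - y); set v := cabs (x - z); set w := cabs (y - z).
  have u0 : 0 <= u := cabs_ge0 _; have v0 : 0 <= v := cabs_ge0 _.
  have w0 : 0 <= w := cabs_ge0 _.
  have := mulr_ge0 (mulr_ge0 (ltW AB0) u0) v0.
  have := mulr_ge0 (mulr_ge0 (ltW AB0) u0) w0.
  lra.
Qed.

Lemma sdiff_ext F F' H H' : (forall x, F x = H x) -> (forall x, F' x = H' x) ->
  sdiff F F' -> sdiff H H'.
Proof.
move=> FH F'H' [B B0 hB]; exists B => // x y z Kx Ky Kz.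
by have := hB x y z Kx Ky Kz; rewrite !FH !F'H'.
Qed.

Lemma sdiffX F F' n : sdiff F F' ->
  sdiff (fun x => F x ^+ n.+1) (fun x => n.+1%:R * F x ^+ n * F' x).
Proof.
move=> hF; elim: n => [|n IH].
  by apply: sdiff_ext hF => x; rewrite ?expr0 ?expr1 ?mulr1 ?mul1r.
apply: sdiff_ext (sdiffM hF IH) => x; first by rewrite [RHS]exprS.
rewrite [F x ^+ n.+1]exprS -[n.+2%:R]natr1; ring.
Qed.

(** With b the inverse of the distance from p to the curve, b bounds the function, b^2 its
    derivative and Lipschitz constant, and b^3 the second-order error; their sum serves for all
    four. *)
Lemma sdiffV p : ~ K p -> sdiff (fun x => (x - p)^-1) (fun x => - (x - p)^-1 ^+ 2).
Proof.
move=> Kp; have [d d0 hd] := trace_far Kp.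
pose b := d^-1; have b0 : 0 < b by rewrite invr_gt0.
have hb x : K x -> cabs (x - p)^-1 <= b.
  move=> Kx; rewrite cabsV lef_pV2 ?posrE ?hd //.
  exact: lt_le_trans (hd _ Kx).
have nz x : K x -> x - p != 0.
  by move=> Kx; rewrite -cabs_gt0; exact: lt_le_trans (hd _ Kx).
have M1 (u v : C) (a c : R) : cabs u <= a -> cabs v <= c -> cabs (u * v) <= a * c.
  by move=> h1 h2; rewrite cabsM ler_pM ?cabs_ge0.
have b2 : 0 < b * b by rewrite mulr_gt0.
have b3 : 0 < b * b * b by rewrite mulr_gt0.
exists (b + b * b + b * b * b); first by rewrite !addr_gt0.
move=> x y z Kx Ky Kz.
have hx := hb _ Kx; have hy := hb _ Ky; have hz := hb _ Kz.
have u0 := cabs_ge0 (x - y); have v0 := cabs_ge0 (x - z).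
have w0 := cabs_ge0 (y - z).
split.
- lra.
- rewrite cabsN expr2; have := M1 _ _ _ _ hx hx; lra.
- have -> : (x - p)^-1 - (y - p)^-1 = - ((x - p)^-1 * (y - p)^-1 * (x - y)).
    by field; rewrite !nz.
  rewrite cabsN; have := M1 _ _ _ _ (M1 _ _ _ _ hx hy) (lexx (cabs (x - y))).
  have := mulr_ge0 (ltW b0) u0; have := mulr_ge0 (ltW b3) u0.
  lra.
- have -> : (x - p)^-1 - (y - p)^-1 - - (z - p)^-1 ^+ 2 * (x - y)
    = ((z - p)^-1 * (z - p)^-1 * (x - p)^-1 * (x - z) * (x - y))
      + ((x - p)^-1 * (z - p)^-1 * (y - p)^-1 * (y - z) * (x - y)).
    by field; rewrite !nz.
  rewrite (le_trans (cabsD _ _)) //.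
  have := M1 _ _ _ _ (M1 _ _ _ _ (M1 _ _ _ _ (M1 _ _ _ _ hz hz) hx)
     (lexx (cabs (x - z)))) (lexx (cabs (x - y))).
  have := M1 _ _ _ _ (M1 _ _ _ _ (M1 _ _ _ _ (M1 _ _ _ _ hx hz) hy)
     (lexx (cabs (y - z)))) (lexx (cabs (x - y))).
  have := mulr_ge0 (mulr_ge0 (ltW b0) v0) u0.
  have := mulr_ge0 (mulr_ge0 (ltW b0) w0) u0.
  have := mulr_ge0 (mulr_ge0 (ltW b2) v0) u0.
  have := mulr_ge0 (mulr_ge0 (ltW b2) w0) u0.
  lra.
Qed.

Lemma ci_monomial n : ci (fun x => x ^+ n) 0.
Proof.
have := ciZ (n.+1%:R^-1) (ci_sdiff (sdiffX n sdiff_id)); rewrite mulr0.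
by apply: ci_ext => x _; rewrite mulr1 mulrA mulVf ?mul1r // pnatr_eq0.
Qed.

(** The order is at least two, so there is a primitive of the form (x - p)^-(n+1); only simple poles
    can contribute. *)
Lemma ci_pole p n : ~ K p -> ci (fun x => (x - p)^-1 ^+ n.+2) 0.
Proof.
move=> Kp; have := ciZ (- n.+1%:R^-1) (ci_sdiff (sdiffX n (sdiffV Kp))).
rewrite mulr0; apply: ci_ext => x _.
by rewrite mulrN mulrNN !mulrA mulVf ?pnatr_eq0 // mul1r !exprSr.
Qed.

End Curve.

(** * Winding numbers *)

Lemma geo_small (R : realType) (A r e : R) : 0 <= r -> r < 1 -> 0 < e ->
  exists N, forall n, (N <= n)%N -> A * r ^+ n < e.
Proof.
move=> r0 r1 e0.
have A1 : 0 < `|A| + 1 by rewrite ltr_wpDl.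
have rn : `|r| < 1 by rewrite ger0_norm.
have eA : 0 < e / (`|A| + 1) by rewrite divr_gt0.
have [N _ hN] := proj1 (cvgrPdist_lt _ _) (cvg_expr rn) _ eA.
exists N => n Nn; have := hN n Nn; rewrite /= sub0r normrN ger0_norm ?exprn_ge0 //.
rewrite ltr_pdivlMr // mulrC => /le_lt_trans; apply.
by rewrite ler_wpM2r ?exprn_ge0 // ler_wpDr // ler_norm.
Qed.

Section Winding.
Variables (R : realType) (g : R -> R[i]).
Local Notation C := R[i].
Local Notation K := (trace_of g).
Local Notation ci := (is_contour_integral g).
Hypothesis g_cont : {within `[0, 1], continuous (g : R -> C^o)}.
Hypothesis g_rect : rectifiable g.
Hypothesis g_closed : g 0 = g 1.
Implicit Types (G H : C -> C) (I J p x y z : C).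

(* Geometric series: only the term with a simple pole contributes. *)
Lemma ci_winding_shift (d : R) p p' I : 0 < d -> ~ K p ->
  (forall x, K x -> d <= cabs (x - p)) -> cabs (p' - p) <= d / 2 ->
  ci (fun x => (x - p)^-1) I -> ci (fun x => (x - p')^-1) I.
Proof.
move=> d0 Kp hd pp hI.
pose G n x := \sum_(k < n.+1) (p' - p) ^+ k * (x - p)^-1 ^+ k.+1.
have hG n : ci (G n) I.
  elim: n => [|n IH].
    by apply: ci_ext hI => x _; rewrite /G big_ord1 expr0 mul1r expr1.
  have := ci_lin ((p' - p) ^+ n.+1) (ci_pole g_cont g_rect g_closed n Kp) IH.
  rewrite mulr0 add0r; apply: ci_ext => x _.
  by rewrite /G [RHS]big_ord_recr /= addrC.
have nz x : K x -> x - p != 0.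
  by move=> Kx; rewrite -cabs_gt0; exact: lt_le_trans (hd _ Kx).
have far x : K x -> d / 2 <= cabs (x - p').
  move=> Kx; have := cabs_subD x p' p; have := hd _ Kx; lra.
have nz' x : K x -> x - p' != 0.
  move=> Kx; rewrite -cabs_gt0; apply: lt_le_trans (far _ Kx).
  by rewrite divr_gt0.
have GE n x : K x ->
    (x - p')^-1 - G n x = ((p' - p) / (x - p)) ^+ n.+1 / (x - p').
  move=> Kx; rewrite /G; elim: n => [|n IH].
    by rewrite big_ord1 expr0 mul1r !expr1; field; rewrite nz ?nz'.
  rewrite big_ord_recr /= opprD addrA IH [in RHS]exprS !expr_div_n.
  rewrite exprVn !exprS; field.
  by rewrite nz' // nz // expf_neq0 ?nz.
have GU : ucv K G (fun x => (x - p')^-1).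
  move=> e e0.
  (* The remainder of the geometric series: 1 / |x - p'| is at most (d / 2)^-1, and the ratio |p' -
     p| / |x - p| is at most 1/2. *)
  have [N hN] := @geo_small R (d / 2)^-1 2^-1 e ltac:(lra) ltac:(lra) e0.
  exists N => n Nn x Kx; apply: le_lt_trans (hN n Nn).
  have := far _ Kx => fx; have dx := hd _ Kx.
  rewrite cabsB GE // cabsM cabsX cabsM !cabsV mulrC.
  have d20 : 0 < d / 2 by rewrite divr_gt0.
  rewrite ler_pM ?invr_ge0 ?cabs_ge0 ?exprn_ge0 ?mulr_ge0 ?invr_ge0 ?cabs_ge0 //.
    by rewrite lef_pV2 ?posrE // (lt_le_trans d20).
  rewrite (@le_trans _ _ (2^-1 ^+ n.+1)) //; last first.
    by rewrite exprS ler_piMl ?exprn_ge0 //; lra.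
  rewrite lerXn2r ?nnegrE ?mulr_ge0 ?invr_ge0 ?cabs_ge0 //.
  rewrite ler_pdivrMr ?(lt_le_trans d0) //; lra.
have [J hJ IJ] := ci_ucv g_rect hG GU.
by rewrite (cvgC_unique (@cvgC_cst _ I) IJ).
Qed.

(** Here |x / p| is at most 1/2 on the curve, so 1 / (x - p) is the uniform limit of its Taylor
    polynomials at 0, and each of these integrates to 0. *)
Lemma ci_winding_far p (B : R) : 0 < B -> (forall x, K x -> cabs x <= B) ->
  2 * B <= cabs p -> ci (fun x => (x - p)^-1) 0.
Proof.
move=> B0 hB Bp.
have p0 : p != 0 by rewrite -cabs_gt0; lra.
pose G n x := - \sum_(k < n) p^-1 ^+ k.+1 * x ^+ k.
have hG n : ci (G n) 0.
  have := ciZ (-1) (ci_sum (index_enum _)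
    (fun k : 'I_n => ciZ (p^-1 ^+ k.+1) (ci_monomial g_cont g_rect g_closed k))).
  rewrite [X in -1 * X]big1 ?mulr0; last by move=> k _; rewrite mulr0.
  by apply: ci_ext => x _; rewrite mulN1r.
have far x : K x -> B <= cabs (x - p).
  move=> Kx; have := cabs_lower p x; rewrite cabsB; have := hB _ Kx; lra.
have nz x : K x -> x - p != 0.
  by move=> Kx; rewrite -cabs_gt0; exact: lt_le_trans (far _ Kx).
have GE n x : K x -> (x - p)^-1 - G n x = (x / p) ^+ n / (x - p).
  move=> Kx; rewrite /G; elim: n => [|n IH].
    by rewrite big_ord0 oppr0 subr0 expr0 mul1r.
  rewrite big_ord_recr /= opprD opprD addrA IH opprK !expr_div_n.
  rewrite exprVn !exprS; field.
  by rewrite nz // p0 expf_neq0.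
have GU : ucv K G (fun x => (x - p)^-1).
  move=> e e0; have [N hN] := @geo_small R B^-1 2^-1 e ltac:(lra) ltac:(lra) e0.
  exists N => n Nn x Kx; apply: le_lt_trans (hN n Nn).
  have fx := far _ Kx; have bx := hB _ Kx.
  rewrite cabsB GE // cabsM cabsX cabsM !cabsV mulrC.
  rewrite ler_pM ?invr_ge0 ?cabs_ge0 ?exprn_ge0 ?mulr_ge0 ?invr_ge0 ?cabs_ge0 //.
    by rewrite lef_pV2 ?posrE // (lt_le_trans B0).
  rewrite lerXn2r ?nnegrE ?mulr_ge0 ?invr_ge0 ?cabs_ge0 //.
  by rewrite ler_pdivrMr ?cabs_gt0 //; lra.
have [J hJ IJ] := ci_ucv g_rect hG GU.
by rewrite (cvgC_unique (@cvgC_cst _ 0) IJ).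
Qed.

(** A quarter of the distance from p to the curve is small enough for the shift to be made in both
    directions: p' still keeps half of that distance. *)
Lemma ci_winding_near p : ~ K p -> exists2 r : R, 0 < r & forall p',
  cabs (p' - p) < r -> ~ K p' /\
  forall I, ci (fun x => (x - p)^-1) I <-> ci (fun x => (x - p')^-1) I.
Proof.
move=> Kp; have [d d0 hd] := trace_far g_cont Kp; exists (d / 4).
  by rewrite divr_gt0.
move=> p' pp.
have Kp' : ~ K p' by move=> Kp'; have := hd _ Kp'; lra.
split=> // I; split; first by apply: (ci_winding_shift d0) => //; lra.
have d20 : 0 < d / 2 by rewrite divr_gt0.
apply: (ci_winding_shift d20) => //; last by rewrite cabsB; lra.
move=> x Kx; have := cabs_subD x p' p; have := hd _ Kx; lra.
Qed.

(** Winding number 1 and winding number 0, as integrals. The topological interior and exterior serve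
    only to produce these values. *)
Definition encloses p := ~ K p /\ ci (fun x => (x - p)^-1) (twopii R).
Definition excludes p := ~ K p /\ ci (fun x => (x - p)^-1) 0.

(* The winding number is locally constant on the complement of the trace and
   vanishes far away, which an unbounded component reaches. *)
Lemma exterior_excludes p : in_exterior g p -> excludes p.
Proof.
move=> [Kp unb]; split=> //.
set A : set C^o := component_at g p.
have AK w : A w -> ~ K w by apply: connected_component_sub.
pose Z : set C^o := [set w | ~ K w /\ ci (fun x => (x - w)^-1) 0].
(* [Z'] includes points where the integral might not exist: local constancy is an equivalence for
   every value, so existence need not be known. *)
pose Z' : set C^o := [set w | ~ K w /\ ~ ci (fun x => (x - w)^-1) 0].
have nearE (w : C) : ~ K w -> \forall w' \near (w : C^o), ~ K w' /\
    forall I, ci (fun x => (x - w)^-1) I <-> ci (fun x => (x - w')^-1) I.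
  move=> /ci_winding_near[r r0 hr]; apply/nbhs_ballP.
  exists r%:C; first by rewrite /= ltcR.
  by move=> w'; rewrite /ball /= cabs_ltE cabsB => /hr.
have Zo : open Z.
  rewrite openE => w [Kw Iw]; apply: filterS (nearE _ Kw) => w' [Kw' hw'].
  by split=> //; apply/hw'.
have Z'o : open Z'.
  rewrite openE => w [Kw Iw]; apply: filterS (nearE _ Kw) => w' [Kw' hw'].
  by split=> // /hw'.
suff : (A `&` Z) p by case=> _ [].
have -> : A `&` Z = A; last exact: connected_component_refl.
  apply: (@component_connected _ (~` K : set C^o) (p : C^o)); last 2 first.
  - by exists Z.
  - exists (~` Z'); first exact: open_closedC.
    apply/seteqP; split=> w [Aw hw]; split=> //; first by case=> _; case: hw.
    by split; [exact: AK | apply: contrapT => h; apply: hw; split=> //; exact: AK].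
  have [B B0 hB] := trace_bnd g_cont.
  (* If the component missed [Z], it would lie in the disc of radius 2 B, because winding numbers
     vanish beyond it. *)
  apply: contrapT => /forallNP h; apply: unb.
  exists (2 * B)%:C; split; first by rewrite complex_real.
  move=> M hM w Aw; apply: le_trans (ltW hM).
  rewrite [leLHS](_ : _ = `|w : C|) // cabs_leE leNgt.
  apply/negP => /ltW Bw; apply: (h w); split=> //; split; first exact: AK.
  exact: ci_winding_far Bw.
Qed.

Lemma twopii_neq0 : twopii R != 0.
Proof.
apply: mulf_neq0; last by rewrite eq_complex /= oner_eq0 andbF.
by rewrite -cabs_gt0 cabs_real gtr0_norm mulr_gt0 // pi_gt0.
Qed.

Lemma contour_integralE G I : ci G I -> contour_integral g G = I.
Proof.
move=> GI; rewrite /contour_integral; case: xgetP => [J _ GJ|/(_ I) //].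
exact: (ci_unique g_rect GJ GI).
Qed.

Hypothesis g_ccw : counterclockwise g.

(* [contour_integral] is 0 when the integral does not exist, so the nonzero value
   2 pi i also gives existence. *)
Lemma interior_encloses p : in_interior g p -> encloses p.
Proof.
move=> ip; have [Kp _] := ip; split=> //; have := g_ccw ip.
rewrite /contour_integral; case: xgetP => [J _ GJ <- //|_ /eqP].
by rewrite eq_sym (negPf twopii_neq0).
Qed.

(** The winding number is constant near 0, and enclosed points come arbitrarily close to 0. *)
Lemma zero_encloses : ~ K 0 ->
  (forall r : R, 0 < r -> exists2 p, encloses p & cabs p < r) -> encloses 0.
Proof.
move=> K0 h; have [r r0 hr] := ci_winding_near K0.
have [p [_ Ip] pr] := h r r0; split=> //.
by have [|_ ->] := hr p; rewrite ?subr0.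
Qed.

End Winding.

(** * Rational functions under x -> r / x *)

Section Rational.
Variables (R : realType) (g : R -> R[i]).
Local Notation C := R[i].
Local Notation K := (trace_of g).
Local Notation ci := (is_contour_integral g).
Hypothesis g_cont : {within `[0, 1], continuous (g : R -> C^o)}.
Hypothesis g_rect : rectifiable g.
Hypothesis g_closed : g 0 = g 1.
Hypothesis g_zero : encloses g 0.
Variable r : C.
Hypothesis r_neq0 : r != 0.
Implicit Types (F G H : C -> C) (I J p x y z : C) (P Q : {poly C}) (s : seq C).

(* The pole 0 is always admissible: it is exchanged with infinity. *)
Definition swapped p := p = 0 \/
  p != 0 /\ (encloses g p /\ excludes g (r / p) \/ excludes g p /\ encloses g (r / p)).

(* The right-hand integrand is the pull-back of F dx by x -> r / x, up to the sign
   that the reversal of orientation compensates. *)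
Definition ci_swap F I :=
  ci F I /\ ci (fun x => F (r / x) * (r / x ^+ 2)) I.

(** The curve together with its image under x -> r / x: these are the points where an integrand or
    its pull-back gets evaluated. *)
Definition swap_dom : set C := [set x | K x \/ K (r / x)].

Lemma swap_domP x : K x -> swap_dom x /\ swap_dom (r / x).
Proof.
move=> Kx; split; first by left.
by right; rewrite invf_div mulrCA divff ?mulr1.
Qed.

Lemma swap_dom_neq0 x : swap_dom x -> x != 0.
Proof.
have [K0 _] := g_zero => -[Kx|Kx]; apply/eqP => x0; apply: K0.
  by rewrite -x0.
by move: Kx; rewrite x0 invr0 mulr0.
Qed.

Lemma swap_dom_pole x p : swap_dom x -> swapped p -> x - p != 0.
Proof.
move=> Dx; case=> [->|[p0 hp]]; first by rewrite subr0 swap_dom_neq0.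
have [Kp Krp] : ~ K p /\ ~ K (r / p) by case: hp => -[[h _] [h' _]].
by apply/eqP => /subr0_eq xp; case: Dx => Dx; [apply: Kp|apply: Krp]; rewrite -xp.
Qed.

Lemma ci_swap_ext F G I :
  (forall x, swap_dom x -> F x = G x) -> ci_swap F I -> ci_swap G I.
Proof.
move=> FG [h h']; split.
  by apply: ci_ext h => x /swap_domP[/FG].
by apply: ci_ext h' => x /swap_domP[_ /FG ->].
Qed.

Lemma ci_swap_lin (a : C) F G I J :
  ci_swap F I -> ci_swap G J -> ci_swap (fun x => a * F x + G x) (a * I + J).
Proof.
move=> [h1 h2] [h3 h4]; split; first exact: ci_lin.
by apply: ci_ext (ci_lin a h2 h4) => x _; ring.
Qed.

Lemma ci_swap0 : ci_swap (fun=> 0) 0.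
Proof.
split; first exact: ci0.
by apply: ci_ext (@ci0 _ g) => x _; rewrite mul0r.
Qed.

Lemma ci_swap_monomial n : ci_swap (fun x => x ^+ n) 0.
Proof.
split; first exact: ci_monomial.
have [K0 _] := g_zero.
have := ciZ (r ^+ n.+1) (ci_pole g_cont g_rect g_closed n K0); rewrite mulr0.
apply: ci_ext => x Kx; rewrite subr0 expr_div_n exprVn !exprS; field.
have x0 : x != 0 by apply: swap_dom_neq0; left.
by rewrite x0 expf_neq0.
Qed.

(** The pull-back of 1 / (x - p) is 1 / x - 1 / (x - r / p). Its integral is that of 1 / (x - p)
    because the winding numbers of p and r / p add up to 1, that of 0; this is the origin of
    [swapped]. For p = 0 the pull-back is 1 / x again. *)
Lemma ci_swap_simple_pole p : swapped p ->
  exists I, ci_swap (fun x => (x - p)^-1) I.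
Proof.
have [K0 I0] := g_zero.
have nz x : K x -> x != 0 by move=> Kx; apply: swap_dom_neq0; left.
case=> [->|[p0 hp]].
  exists (twopii R); split=> //; apply: ci_ext I0 => x Kx.
  by rewrite !subr0; field; rewrite nz.
have Krp : ~ K (r / p) by case: hp => -[[h _] [h' _]].
have sub J : ci (fun x => (x - r / p)^-1) J ->
    ci (fun x => (r / x - p)^-1 * (r / x ^+ 2)) (-1 * J + twopii R).
  move=> hJ; apply: ci_ext (ci_lin (-1) hJ I0) => x Kx.
  have x0 := nz x Kx; have xrp : x - r / p != 0.
    by rewrite subr_eq0; apply/eqP => xp; apply: Krp; rewrite -xp.
  have e : r / x - p = - p * (x - r / p) / x by field; rewrite x0 p0.
  have pxr : x * p - r != 0.
    by rewrite (_ : x * p - r = p * (x - r / p)) ?mulf_neq0 //; field.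
  rewrite e subr0; field.
  by rewrite x0 p0 pxr.
case: hp => -[[_ h1] [_ h2]].
  exists (twopii R); split=> //.
  by have := sub _ h2; rewrite mulr0 add0r.
exists 0; split=> //.
by have := sub _ h2; rewrite mulN1r addNr.
Qed.

(** Both integrals vanish since both integrands have primitives: up to a constant, the pull-back is
    the derivative of (x / (x - r / p))^(n+1), or the monomial x^n when p = 0. *)
Lemma ci_swap_multiple_pole p n : swapped p ->
  ci_swap (fun x => (x - p)^-1 ^+ n.+2) 0.
Proof.
have [K0 I0] := g_zero.
have nz x : K x -> x != 0 by move=> Kx; apply: swap_dom_neq0; left.
case=> [->|[p0 hp]].
  split; first exact: ci_pole.
  have := ciZ (r ^- n.+1) (ci_monomial g_cont g_rect g_closed n); rewrite mulr0.
  apply: ci_ext => x Kx; rewrite subr0 invf_div expr_div_n !exprS; field.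
  by rewrite nz // r_neq0 expf_neq0.
have [Kp Krp] : ~ K p /\ ~ K (r / p) by case: hp => -[[h _] [h' _]].
split; first exact: ci_pole.
have := ci_sdiff g_cont g_rect g_closed
  (sdiffX n (sdiffM (sdiff_id g_cont) (sdiffV g_cont Krp))).
move=> /(ciZ (- (n.+1%:R * (r / p))^-1 * (- p) ^- n.+2 * r)); rewrite mulr0.
apply: ci_ext => x Kx; have x0 := nz x Kx.
have xrp : x - r / p != 0.
  by rewrite subr_eq0; apply/eqP => xp; apply: Krp; rewrite -xp.
have -> : r / x - p = - p * (x - r / p) / x by field; rewrite x0 p0.
have n0 : n.+1%:R != 0 :> C by rewrite pnatr_eq0.
move: (n.+1%:R : C) n0 => m n0; set y := x - r / p in xrp *.
have -> : 1 * y^-1 + id x * - y^-1 ^+ 2 = - (r / p) / y ^+ 2.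
  have -> : id x = y + r / p by rewrite /y /= subrK.
  by rewrite exprVn; field; rewrite xrp p0.
rewrite /= invf_div !expr_div_n exprMn !exprS; field.
by rewrite x0 p0 r_neq0 n0 xrp !expf_neq0 // oppr_eq0.
Qed.

Definition poles s x := \prod_(p <- s) (x - p).

Lemma poles_neq0 s x : (forall p, p \in s -> swapped p) -> swap_dom x ->
  poles s x != 0.
Proof.
move=> hs Dx; rewrite prodf_seq_neq0; apply/allP => p ps /=.
by apply: swap_dom_pole => //; exact: hs.
Qed.

(* Partial fractions, by induction on the number of poles. *)
Lemma ci_swap_rational s P : (forall p, p \in s -> swapped p) ->
  exists I, ci_swap (fun x => P.[x] / poles s x) I.
Proof.
have [n] := ubnP (size s); elim: n => // n IH in s P *.
case: s => [_ _|p s]; last rewrite ltnS /= => sn hs.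
  suff h m : ci_swap (fun x => \sum_(i < m) P`_i * x ^+ i) 0.
    exists 0; apply: ci_swap_ext (h (size P)) => x _.
    by rewrite /poles big_nil divr1 horner_coef.
  elim: m => [|m IHm].
    by apply: ci_swap_ext ci_swap0 => x _; rewrite big_ord0.
  have := ci_swap_lin P`_m (ci_swap_monomial m) IHm; rewrite mulr0 addr0.
  by apply: ci_swap_ext => x _; rewrite big_ord_recr /= addrC.
have sp : swapped p by apply: hs; rewrite mem_head.
have hs' q : q \in s -> swapped q by move=> qs; apply: hs; rewrite in_cons qs orbT.
(* Division by x - p splits off a quotient with one pole fewer and leaves a constant numerator. *)
have [Q PE] : exists Q, P = Q * ('X - p%:P) + P.[p]%:P.
  have /factor_theorem[Q QE] : root (P - P.[p]%:P) p.
    by rewrite /root !hornerE subrr.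
  by exists Q; rewrite -QE subrK.
suff [I hI] : exists I, ci_swap (fun x => 1 / poles (p :: s) x) I.
  have [J hJ] := IH s Q sn hs'; exists (P.[p] * I + J).
  apply: ci_swap_ext (ci_swap_lin P.[p] hI hJ) => x Dx.
  have -> : P.[x] = Q.[x] * (x - p) + P.[p] by rewrite {1}PE !hornerE.
  have -> : poles (p :: s) x = (x - p) * poles s x by rewrite /poles big_cons.
  field.
  by rewrite (poles_neq0 hs' Dx) (swap_dom_pole Dx sp).
have [/all_pred1P sE|/allPn[p' p's p'p]] := boolP (all (pred1 p) s).
  have e x : poles (p :: s) x = (x - p) ^+ (size s).+1.
    by rewrite /poles big_cons {1}sE big_nseq iter_mulr_1 exprS.
  case: (size s) e => [|m] e.
    have [I hI] := ci_swap_simple_pole sp; exists I.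
    by apply: ci_swap_ext hI => x _; rewrite e mul1r.
  exists 0; apply: ci_swap_ext (ci_swap_multiple_pole m sp) => x _.
  by rewrite e mul1r exprVn.
have sp' := hs' _ p's; have ps := perm_to_rem p's.
set s' := rem p' s in ps; have ss' : (size s).-1 = size s' by rewrite size_rem.
have s's q : q \in s' -> swapped q by move=> /mem_rem; exact: hs'.
have size_s : size s = (size s').+1 by rewrite (perm_size ps).
have sn' q : (size (q :: s') < n)%N by rewrite /= -size_s.
have hcons q : swapped q -> forall u, u \in q :: s' -> swapped u.
  by move=> sq u; rewrite in_cons => /orP[/eqP -> //|/s's].
have [I hI] := IH _ 1 (sn' p) (hcons p sp).
have [J hJ] := IH _ 1 (sn' p') (hcons p' sp').
(* Since 1 / ((x - p)(x - p')) = (1 / (x - p) - 1 / (x - p')) / (p - p'), two distinct poles can be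
   traded for two terms in each of which one of them is missing. *)
have := ci_swap_lin (p - p')^-1 hI (ci_swap_lin (- (p - p')^-1) hJ ci_swap0).
move=> hL; eexists; apply: ci_swap_ext hL => x Dx.
have one_x : (1 : {poly C}).[x] = 1 by rewrite hornerE.
have pcons q u : poles (q :: u) x = (x - q) * poles u x by rewrite /poles big_cons.
have -> : poles (p :: s) x = (x - p) * ((x - p') * poles s' x).
  by rewrite pcons; congr (_ * _); rewrite -pcons /poles (perm_big _ ps).
rewrite one_x !pcons; field.
have pp' : p - p' != 0 by rewrite subr_eq0 eq_sym; exact: p'p.
by rewrite ?(poles_neq0 s's Dx) ?(swap_dom_pole Dx sp') ?(swap_dom_pole Dx sp) ?pp'.
Qed.

Definition ratfun F := exists P s, (forall p, p \in s -> swapped p) /\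
  forall x, swap_dom x -> F x = P.[x] / poles s x.

Lemma rational_ext F G :
  (forall x, swap_dom x -> F x = G x) -> ratfun F -> ratfun G.
Proof. by move=> FG [P [s [hs FE]]]; exists P, s; split=> // x Dx; rewrite -FG ?FE. Qed.

Lemma rationalM F G : ratfun F -> ratfun G -> ratfun (fun x => F x * G x).
Proof.
move=> [P [s [hs FE]]] [Q [s' [hs' GE]]]; exists (P * Q), (s ++ s'); split.
  by move=> p; rewrite mem_cat => /orP[/hs|/hs'].
by move=> x Dx; rewrite FE // GE // hornerM /poles big_cat /= invfM mulrACA.
Qed.

Lemma rationalD F G : ratfun F -> ratfun G -> ratfun (fun x => F x + G x).
Proof.
move=> [P [s [hs FE]]] [Q [s' [hs' GE]]].
pose pp s := \prod_(p <- s) ('X - p%:P : {poly C}).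
have ppE u x : (pp u).[x] = poles u x.
  by rewrite /pp horner_prod; apply: eq_bigr => p _; rewrite !hornerE.
exists (P * pp s' + Q * pp s), (s ++ s'); split.
  by move=> p; rewrite mem_cat => /orP[/hs|/hs'].
move=> x Dx; rewrite FE // GE // !hornerE !ppE.
have -> : poles (s ++ s') x = poles s x * poles s' x by rewrite /poles big_cat.
by field; rewrite (poles_neq0 hs Dx) (poles_neq0 hs' Dx).
Qed.

Lemma rational_poly P : ratfun (horner P).
Proof. by exists P, [::]; split=> // x _; rewrite /poles big_nil divr1. Qed.

Lemma rational_cst c : ratfun (fun=> c).
Proof. by apply: rational_ext (rational_poly c%:P) => x _; rewrite hornerC. Qed.

Lemma rational_id : ratfun id.
Proof. by apply: rational_ext (rational_poly 'X) => x _; rewrite hornerX. Qed.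

Lemma rational_pole p : swapped p -> ratfun (fun x => (x - p)^-1).
Proof.
move=> sp; exists 1, [:: p]; split; first by move=> q; rewrite inE => /eqP ->.
by move=> x _; rewrite /poles big_seq1 hornerE mul1r.
Qed.

Lemma rational_inv : ratfun (fun x => x^-1).
Proof.
have s0 : swapped 0 by left.
by apply: rational_ext (rational_pole s0) => x _; rewrite subr0.
Qed.

Lemma rationalX F n : ratfun F -> ratfun (fun x => F x ^+ n).
Proof.
move=> hF; elim: n => [|n IH].
  by apply: rational_ext (rational_cst 1) => x _; rewrite expr0.
by apply: rational_ext (rationalM hF IH) => x _; rewrite exprS.
Qed.

Lemma rational_prod (T : eqType) (u : seq T) (F : T -> C -> C) :
  (forall i, i \in u -> ratfun (F i)) -> ratfun (fun x => \prod_(i <- u) F i x).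
Proof.
elim: u => [_|i u IH h].
  by apply: rational_ext (rational_cst 1) => x _; rewrite big_nil.
have hi : ratfun (F i) by apply: h; rewrite mem_head.
have hu : ratfun (fun x => \prod_(i <- u) F i x).
  by apply: IH => j ju; apply: h; rewrite in_cons ju orbT.
by apply: rational_ext (rationalM hi hu) => x _; rewrite big_cons.
Qed.

Lemma rational_lev (f : laurent C) : ratfun (lev f).
Proof.
elim/freeg_ind_dom0: f => [|a n f _ _ IH].
  by apply: rational_ext (rational_cst 0) => x _; rewrite lev0.
have hX : ratfun (fun x => x ^ n).
  case: n => n; first exact: (rationalX n rational_id).
  apply: rational_ext (rationalX n.+1 rational_inv) => x _.
  by rewrite NegzE -exprnN exprVn.
apply: rational_ext (rationalD (rationalM (rational_cst a) hX) IH) => x _.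
by rewrite levD levU.
Qed.

Lemma rational_ci_swap F : ratfun F -> exists I, ci_swap F I.
Proof.
move=> [P [s [hs FE]]]; have [I hI] := ci_swap_rational P hs; exists I.
by apply: ci_swap_ext hI => x Dx; rewrite FE.
Qed.

Lemma ci_swap_ucv (G : nat -> C -> C) H : (forall n, ratfun (G n)) ->
  ucv swap_dom G H -> exists I, ci_swap H I.
Proof.
move=> hG GH; have /choice[I hI] n := rational_ci_swap (hG n).
have [K0 _] := g_zero; have [d d0 hd] := trace_far g_cont K0.
have GK : ucv K G H.
  move=> e e0; have [N hN] := GH e e0; exists N => n Nn x /swap_domP[Dx _].
  exact: hN.
have GK' : ucv K (fun n x => G n (r / x) * (r / x ^+ 2))
                 (fun x => H (r / x) * (r / x ^+ 2)).
  move=> e e0; have r0 : 0 < cabs r by rewrite cabs_gt0.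
  (* Compensates the factor r / x^2 of the pull-back, which is bounded by |r| / d^2 because the
     curve stays at distance d from 0. *)
  have e1 : 0 < e * (d ^+ 2 / cabs r) by rewrite mulr_gt0 // divr_gt0 // exprn_gt0.
  have [N hN] := GH _ e1; exists N => n Nn x Kx.
  have [_ Drx] := swap_domP Kx; have := hN n Nn _ Drx.
  rewrite -mulrBl [cabs (_ * (r / _))]cabsM cabsM cabsV cabsX => h.
  have := hd x Kx; rewrite subr0 => dx; have x0 := lt_le_trans d0 dx.
  have x20 : 0 < cabs x ^+ 2 by rewrite exprn_gt0.
  rewrite mulrA ltr_pdivrMr // -ltr_pdivlMr //; apply: (lt_le_trans h).
  rewrite mulrA ler_pM2r ?invr_gt0 // ler_pM2l //.
  by rewrite lerXn2r // nnegrE ltW.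
have [J hJ IJ] := ci_ucv g_rect (fun n => proj1 (hI n)) GK.
have [J' hJ' IJ'] := ci_ucv g_rect (fun n => proj2 (hI n)) GK'.
by exists J; split=> //; rewrite (cvgC_unique IJ IJ').
Qed.

End Rational.

(** * Infinite q-products *)

Section QPochhammer.
Variables (R : realType) (q : R[i]).
Local Notation C := R[i].
Local Notation rho := (cabs q).
Hypothesis q_lt1 : cabs q < 1.
Implicit Types (x y z : C) (E : set C) (f h : C -> C) (n j : nat).

Definition qp n y : C := \prod_(j < n) (1 - y * q ^+ j).

Let rho0 : 0 <= rho. Proof. exact: cabs_ge0. Qed.
Let rho1 : 0 < 1 - rho. Proof. by rewrite subr_gt0. Qed.

Lemma qpS n y : qp n.+1 y = qp n y * (1 - y * q ^+ n).
Proof. by rewrite /qp big_ord_recr. Qed.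

Lemma geo_partial_le n : \sum_(j < n) rho ^+ j <= (1 - rho)^-1.
Proof.
rewrite -[leRHS]mul1r ler_pdivlMr // mulrC -opprB mulNr -subrX1 opprB.
by rewrite gerBl exprn_ge0.
Qed.

(** Each factor is at most 1 + B |q|^j <= exp(B |q|^j), and the exponents sum to at most B / (1 -
    |q|). *)
Lemma qp_bnd (B : R) : 0 <= B -> exists2 A : R, 0 < A &
  forall n y, cabs y <= B -> cabs (qp n y) <= A.
Proof.
move=> B0; exists (expR (B / (1 - rho))); first exact: expR_gt0.
move=> n y yB; rewrite cabs_prod.
apply: (@le_trans _ _ (\prod_(j < n) expR (B * rho ^+ j))).
  apply: ler_prod => j _; rewrite cabs_ge0 /=; apply: le_trans (expR_ge1Dx _).
  rewrite (le_trans (cabsD _ _)) // cabs1 lerD2l cabsN cabsM cabsX.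
  by rewrite ler_wpM2r ?exprn_ge0.
rewrite -expR_sum ler_expR -mulr_sumr ler_wpM2l //; exact: geo_partial_le.
Qed.

Lemma qp_tail (B : R) : 0 <= B -> exists2 A : R, 0 < A &
  forall n k y, cabs y <= B -> cabs (qp n y - qp (n + k) y) <= A * rho ^+ n.
Proof.
move=> B0; have [A A0 hA] := qp_bnd B0.
exists (A * (B + 1) / (1 - rho)).
  by rewrite divr_gt0 // mulr_gt0 // ltr_wpDl.
move=> n k y yB.
have c0 : 0 <= A * (B + 1) / (1 - rho).
  by apply: divr_ge0; [apply: mulr_ge0; lra|exact: ltW].
(* The factor 1 - |q|^k records the exact partial sum of the geometric series of increments, so that
   the induction on k closes. *)
suff h : cabs (qp n y - qp (n + k) y)
    <= A * (B + 1) / (1 - rho) * rho ^+ n * (1 - rho ^+ k).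
  apply: le_trans h _; rewrite ler_piMr //; last by rewrite gerBl exprn_ge0.
  by apply: mulr_ge0 => //; exact: exprn_ge0.
elim: k => [|k IH]; first by rewrite addn0 expr0 !subrr cabs0 mulr0.
rewrite addnS qpS; set u := qp _ _ in IH *; set v := qp (n + k) y in IH *.
have -> : u - v * (1 - y * q ^+ (n + k)) = (u - v) + v * (y * q ^+ (n + k)) by ring.
apply: le_trans (cabsD _ _) _.
have -> : A * (B + 1) / (1 - rho) * rho ^+ n * (1 - rho ^+ k.+1)
  = A * (B + 1) / (1 - rho) * rho ^+ n * (1 - rho ^+ k)
    + A * ((B + 1) * rho ^+ (n + k)).
  by rewrite exprS exprD; field; rewrite gt_eqF.
rewrite lerD // !cabsM cabsX ler_pM ?mulr_ge0 ?exprn_ge0 ?cabs_ge0 //.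
  exact: hA.
by rewrite ler_wpM2r ?exprn_ge0 // (le_trans yB) // lerDl.
Qed.

Lemma qpoch_cvg y : cvgC (qp^~ y) (qpoch y q).
Proof.
suff [l hl] : exists l, cvgC (qp^~ y) l by rewrite /qpoch (cvgC_lim hl).
apply: cvgC_cauchy => e e0; have [A A0 hA] := qp_tail (cabs_ge0 y).
have [N hN] := geo_small A rho0 q_lt1 e0; exists N => n m Nn Nm.
wlog nm : n m Nn Nm / (n <= m)%N.
  move=> h; case: (leqP n m) => [nm|/ltnW mn]; first exact: h.
  by rewrite cabsB; exact: h.
rewrite -(subnKC nm).
exact: le_lt_trans (hA n _ y (lexx _)) (hN n Nn).
Qed.

Lemma qp_qpoch (B : R) : 0 <= B -> exists2 A : R, 0 < A &
  forall n y, cabs y <= B -> cabs (qp n y - qpoch y q) <= A * rho ^+ n.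
Proof.
move=> B0; have [A A0 hA] := qp_tail B0; exists A => // n y yB.
apply: (@cvgC_sub_le _ (fun m => qp n y - qp m y)).
  move=> e e0; have [N hN] := qpoch_cvg y e0; exists N => m Nm.
  have -> : qp n y - qp m y - (qp n y - qpoch y q) = - (qp m y - qpoch y q) by ring.
  by rewrite cabsN hN.
by exists n => m nm; rewrite -(subnKC nm) hA.
Qed.

Definition ucvb E (F : nat -> C -> C) f := ubnd E F /\ ucv E F f.

Lemma qp_ucvb E f (B : R) : (forall x, E x -> cabs (f x) <= B) ->
  ucvb E (fun n x => qp n (f x)) (fun x => qpoch (f x) q).
Proof.
move=> hf; have hf' x : E x -> cabs (f x) <= `|B|.
  by move=> /hf/le_trans; apply; rewrite ler_norm.
split.
  have [A A0 hA] := qp_bnd (normr_ge0 B).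
  by exists A => n x Ex; apply/hA/hf'.
have [A A0 hA] := qp_qpoch (normr_ge0 B) => e e0.
have [N hN] := geo_small A rho0 q_lt1 e0; exists N => n Nn x Ex.
by apply: le_lt_trans (hA n _ (hf' x Ex)) (hN n Nn).
Qed.

(** Beyond an index J with B |q|^J < (1 - |q|) / 2 the remaining factors multiply to at least 1/2 in
    modulus; the finitely many shorter products have a common lower bound by the second
    hypothesis. *)
Lemma qp_lower E f (B : R) : (forall x, E x -> cabs (f x) <= B) ->
  (forall j, exists2 d : R, 0 < d & forall x, E x -> d <= cabs (1 - f x * q ^+ j)) ->
  exists2 d : R, 0 < d & forall n x, E x -> d <= cabs (qp n (f x)).
Proof.
move=> hf hd; wlog B0 : B hf / 0 <= B.
  by apply; [move=> x /hf/le_trans; apply; exact: ler_norm|exact: normr_ge0].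
have first_n n : exists2 d : R, 0 < d &
    forall m x, (m <= n)%N -> E x -> d <= cabs (qp m (f x)).
  elim: n => [|n [d d0 IH]].
    exists 1 => // m x; rewrite leqn0 => /eqP -> _.
    by rewrite /qp big_ord0 cabs1.
  have [d' d'0 hd'] := hd n; exists (Num.min d (d * d')).
    by rewrite lt_min d0 mulr_gt0.
  move=> m x; rewrite leq_eqVlt => /orP[/eqP ->|mn] Ex.
    rewrite ge_min qpS cabsM; apply/orP; right.
    by rewrite ler_pM ?(ltW d0) ?(ltW d'0) ?IH ?hd'.
  by rewrite ge_min IH.
have e0 : 0 < (1 - rho) / 2 by rewrite divr_gt0.
have [J hJ] := geo_small B rho0 q_lt1 e0.
have [d d0 h] := first_n J; exists (d / 2); first by rewrite divr_gt0.
pose c := B * rho ^+ J / (1 - rho).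
have c0 : 0 <= c.
  by apply: divr_ge0; [apply: mulr_ge0; rewrite ?exprn_ge0|exact: ltW].
have c1 : c <= 2^-1.
  by rewrite ler_pdivrMr //; have := hJ J (leqnn J); lra.
move=> n x Ex; have [nJ|/ltnW Jn] := leqP n J.
  apply: le_trans (h n x nJ Ex); lra.
rewrite -(subnKC Jn); set k := (n - J)%N.
have hx := h J x (leqnn J) Ex.
(* The inequality prod (1 - t_j) >= 1 - sum t_j, with the sum of the t_j bounded by a geometric
   series in closed form. *)
suff hk : cabs (qp J (f x)) * (1 - c * (1 - rho ^+ k)) <= cabs (qp (J + k) (f x)).
  apply: le_trans hk; have rk : 0 <= rho ^+ k by rewrite exprn_ge0.
  have hc : 2^-1 <= 1 - c * (1 - rho ^+ k).
    have : 0 <= c * rho ^+ k by rewrite mulr_ge0.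
    lra.
  by rewrite ler_pM // ?(ltW d0) //; lra.
elim: (k) => [|m IH]; first by rewrite expr0 subrr mulr0 subr0 mulr1 addn0.
rewrite addnS qpS cabsM.
set t := cabs (f x) * rho ^+ (J + m).
have t0 : 0 <= t by rewrite mulr_ge0 ?exprn_ge0 ?cabs_ge0.
have tle : t <= c * (1 - rho) * rho ^+ m.
  rewrite /c divfK ?gt_eqF // /t exprD mulrA.
  by rewrite ler_wpM2r ?exprn_ge0 // ler_wpM2r ?exprn_ge0 ?hf.
have low : 1 - t <= cabs (1 - f x * q ^+ (J + m)).
  by have := cabs_lower 1 (f x * q ^+ (J + m)); rewrite cabs1 cabsM cabsX.
have rm1 : rho ^+ m <= 1 by rewrite exprn_ile1 // ltW.
have rm0 : 0 <= rho ^+ m by rewrite exprn_ge0.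
have a0 : 0 <= c * (1 - rho ^+ m) by rewrite mulr_ge0 // subr_ge0.
set Q := cabs (qp J (f x)) in IH *; set W := cabs (qp (J + m) (f x)) in IH *.
have Q0 : 0 <= Q by exact: cabs_ge0.
have W0 : 0 <= W by exact: cabs_ge0.
have tle1 : t <= 1.
  have h1 : (1 - rho) * rho ^+ m <= 1.
    by apply: mulr_ile1 => //; [exact: ltW|rewrite gerBl].
  have h2 : c * ((1 - rho) * rho ^+ m) <= c by rewrite ler_piMr.
  by rewrite mulrA in h2; lra.
apply: (@le_trans _ _ (W * (1 - t))); last by rewrite ler_wpM2l.
apply: (@le_trans _ _ (Q * (1 - c * (1 - rho ^+ m)) * (1 - t))); last first.
  by rewrite ler_wpM2r // subr_ge0.
rewrite -mulrA ler_wpM2l // exprS.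
have : 0 <= c * (1 - rho ^+ m) * t by rewrite mulr_ge0.
lra.
Qed.

(** The uniform lower bound for the partial products, on the singleton of y, survives in the
    limit. *)
Lemma qpoch_neq0 y : (forall j, y * q ^+ j != 1) -> qpoch y q != 0.
Proof.
move=> h; have h1 x : [set y] x -> cabs x <= cabs y by move=> ->.
have h2 j : exists2 d : R, 0 < d & forall x, [set y] x -> d <= cabs (1 - x * q ^+ j).
  exists (cabs (1 - y * q ^+ j)); last by move=> x ->.
  by rewrite cabs_gt0 subr_eq0 eq_sym.
have [d d0 hd] := qp_lower h1 h2.
have [_ hF _] := ucvV d0 hd (proj2 (qp_ucvb h1)).
rewrite -cabs_gt0; apply: lt_le_trans (hF y erefl).
by rewrite divr_gt0.
Qed.

Lemma qp_factor n y : qpoch y q = qp n y * qpoch (y * q ^+ n) q.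
Proof.
apply: (@cvgC_unique _ (fun m => qp (n + m) y)).
  move=> e e0; have [N hN] := qpoch_cvg y e0; exists N => m Nm.
  by apply: hN; rewrite (leq_trans Nm) // leq_addl.
have qpD m : qp (n + m) y = qp n y * qp m (y * q ^+ n).
  rewrite /qp big_split_ord /=; congr (_ * _).
  by apply: eq_bigr => j _; rewrite exprD mulrA.
move=> e e0; have A0 : 0 < cabs (qp n y) + 1 by rewrite ltr_wpDl ?cabs_ge0.
have e1 : 0 < e / (cabs (qp n y) + 1) by rewrite divr_gt0.
have [N hN] := qpoch_cvg (y * q ^+ n) e1; exists N => m /hN h.
rewrite qpD -mulrBr cabsM; move: h; rewrite ltr_pdivlMr // mulrC.
by apply: le_lt_trans; rewrite ler_wpM2r ?cabs_ge0 // lerDl.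
Qed.

Lemma ucvbM E F f H h : ucvb E F f -> ucvb E H h ->
  ucvb E (fun n x => F n x * H n x) (fun x => f x * h x).
Proof. by move=> [b1 c1] [b2 c2]; split; [exact: ubndM|exact: ucvM]. Qed.

Lemma ucvb_cst E f (B : R) : (forall x, E x -> cabs (f x) <= B) ->
  ucvb E (fun=> f) f.
Proof. by move=> hf; split; [exact: ubnd_cst hf|exact: ucv_cst]. Qed.

Lemma ucvb_prod E (T : eqType) (s : seq T) (F : T -> nat -> C -> C) (f : T -> C -> C) :
  (forall i, i \in s -> ucvb E (F i) (f i)) ->
  ucvb E (fun n x => \prod_(i <- s) F i n x) (fun x => \prod_(i <- s) f i x).
Proof.
elim: s => [_|i s IH hs].
  have [b c] : ucvb E (fun=> fun=> 1) (fun=> 1).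
    by apply: (@ucvb_cst _ _ 1) => x _; rewrite cabs1.
  split; first by have [B hB] := b; exists B => n x Ex; rewrite big_nil (hB n x).
  by apply: ucv_ext c => *; rewrite big_nil.
have hi := hs i (mem_head _ _).
have hs' (k : T) : k \in s -> ucvb E (F k) (f k).
  by move=> ks; apply: hs; rewrite in_cons ks orbT.
have [b c] := ucvbM hi (IH hs').
split; first by have [B hB] := b; exists B => n x Ex; rewrite big_cons (hB n x).
by apply: ucv_ext c => *; rewrite big_cons.
Qed.

Section Weight.
Variables (al be : C) (A B : seq C).

(** Common shape of [Delta], [W1] and [W0]. The possible poles off 0 are a^-1 q^-j for a in [A] and
    b q^j for b in [B]; the two lists are to account for the outer and the inner poles. *)
Definition weight x : C :=
  qpoch (al * x ^+ 2) q * qpoch (be * x ^- 2) q *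
  (\prod_(a <- A) (qpoch (a * x) q)^-1 * \prod_(b <- B) (qpoch (b * x^-1) q)^-1).

Definition weight_num n x : C := qp n (al * x ^+ 2) * qp n (be * x ^- 2).
Definition weight_den n x : C :=
  \prod_(a <- A) qp n (a * x) * \prod_(b <- B) qp n (b * x^-1).

Variables (E : set C) (r0 r1 : R).
Hypotheses (r0_gt0 : 0 < r0)
  (E_annulus : forall x, E x -> r0 <= cabs x <= r1).

Let xV x : E x -> cabs x^-1 <= r0^-1.
Proof.
move=> /E_annulus/andP[h _]; rewrite cabsV lef_pV2 ?posrE //.
exact: lt_le_trans h.
Qed.

Let x1 x : E x -> cabs x <= r1. Proof. by move=> /E_annulus/andP[]. Qed.

Let x_neq0 x : E x -> x != 0.
Proof.
by move=> /E_annulus/andP[h _]; rewrite -cabs_gt0; exact: lt_le_trans h.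
Qed.

Lemma weight_num_ucvb :
  ucvb E weight_num (fun x => qpoch (al * x ^+ 2) q * qpoch (be * x ^- 2) q).
Proof.
apply: ucvbM.
  apply: (@qp_ucvb _ _ (cabs al * r1 ^+ 2)) => x Ex.
  rewrite cabsM cabsX ler_wpM2l ?cabs_ge0 // lerXn2r ?nnegrE ?cabs_ge0 ?x1 //.
  exact: le_trans (cabs_ge0 x) (x1 Ex).
apply: (@qp_ucvb _ _ (cabs be * r0^-1 ^+ 2)) => x Ex.
rewrite -exprVn cabsM cabsX ler_wpM2l ?cabs_ge0 //.
by rewrite lerXn2r ?nnegrE ?cabs_ge0 ?xV // invr_ge0 ltW.
Qed.

Lemma weight_den_ucvb : ucvb E weight_den
  (fun x => \prod_(a <- A) qpoch (a * x) q * \prod_(b <- B) qpoch (b * x^-1) q).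
Proof.
apply: ucvbM; apply: ucvb_prod => c _.
  apply: (@qp_ucvb _ _ (cabs c * r1)) => x Ex.
  by rewrite cabsM ler_wpM2l ?cabs_ge0 ?x1.
apply: (@qp_ucvb _ _ (cabs c * r0^-1)) => x Ex.
by rewrite cabsM ler_wpM2l ?cabs_ge0 ?xV.
Qed.

Hypothesis q_neq0 : q != 0.
Hypothesis A_far : forall a j, a \in A -> a != 0 /\
  exists2 d : R, 0 < d & forall x, E x -> d <= cabs (x - a^-1 * q^-1 ^+ j).
Hypothesis B_far : forall b j, b \in B ->
  exists2 d : R, 0 < d & forall x, E x -> d <= cabs (x - b * q ^+ j).

Let A_lower a : a \in A -> exists2 d : R, 0 < d &
  forall n x, E x -> d <= cabs (qp n (a * x)).
Proof.
move=> aA; apply: (@qp_lower _ _ (cabs a * r1)) => [x Ex|j].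
  by rewrite cabsM ler_wpM2l ?cabs_ge0 ?x1.
have [a0 [d d0 hd]] := A_far j aA.
have c0 : 0 < cabs (a * q ^+ j) by rewrite cabs_gt0 mulf_neq0 ?expf_neq0.
exists (cabs (a * q ^+ j) * d); first by rewrite mulr_gt0.
move=> x Ex; have -> : 1 - a * x * q ^+ j = - (a * q ^+ j * (x - a^-1 * q^-1 ^+ j)).
  by rewrite exprVn; field; rewrite expf_neq0 ?a0.
by rewrite cabsN [leRHS]cabsM ler_pM2l ?hd.
Qed.

Let B_lower b : b \in B -> exists2 d : R, 0 < d &
  forall n x, E x -> d <= cabs (qp n (b * x^-1)).
Proof.
move=> bB; apply: (@qp_lower _ _ (cabs b * r0^-1)) => [x Ex|j].
  by rewrite cabsM ler_wpM2l ?cabs_ge0 ?xV.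
have [d d0 hd] := B_far j bB.
have [[x Ex]|/forallNP noE] := pselect (exists x, E x); last first.
  by exists 1 => // x Ex; case: (noE x).
have r10 : 0 < r1 by apply: lt_le_trans (x1 Ex); rewrite cabs_gt0 x_neq0.
exists (d / r1); first by rewrite divr_gt0.
move=> x' Ex'; have -> : 1 - b * x'^-1 * q ^+ j = (x' - b * q ^+ j) / x'.
  by field; rewrite x_neq0.
have x'0 : 0 < cabs x' by rewrite cabs_gt0 x_neq0.
by rewrite cabsM cabsV ler_pM ?hd ?invr_ge0 ?(ltW d0) ?(ltW r10) // lef_pV2 ?posrE ?x1.
Qed.

Lemma weight_ucvb : ucvb E (fun n x => weight_num n x *
    (\prod_(a <- A) (qp n (a * x))^-1 * \prod_(b <- B) (qp n (b * x^-1))^-1)) weight.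
Proof.
apply: ucvbM; first exact: weight_num_ucvb.
apply: ucvbM; apply: ucvb_prod => c cs.
  have [d d0 hd] := A_lower cs.
  have hB x : E x -> cabs (c * x) <= cabs c * r1.
    by move=> Ex; rewrite cabsM ler_wpM2l ?cabs_ge0 ?x1.
  by have [h1 _ h2] := ucvV d0 hd (proj2 (qp_ucvb hB)).
have [d d0 hd] := B_lower cs.
have hB x : E x -> cabs (c * x^-1) <= cabs c * r0^-1.
  by move=> Ex; rewrite cabsM ler_wpM2l ?cabs_ge0 ?xV.
by have [h1 _ h2] := ucvV d0 hd (proj2 (qp_ucvb hB)).
Qed.

Lemma qpoch_den_neq0 x : E x -> (forall a, a \in A -> qpoch (a * x) q != 0) /\
  (forall b, b \in B -> qpoch (b * x^-1) q != 0).
Proof.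
move=> Ex; split=> c cs; apply: qpoch_neq0 => j.
  have [c0 [d d0 hd]] := A_far j cs; apply/eqP => h.
  have := hd x Ex; suff -> : x = c^-1 * q^-1 ^+ j.
    by rewrite subrr cabs0 leNgt d0.
  have cq0 : c * q ^+ j != 0 by rewrite mulf_neq0 ?expf_neq0.
  by apply: (mulfI cq0); rewrite exprVn -invfM divff // -h; ring.
have [d d0 hd] := B_far j cs; apply/eqP => h.
have := hd x Ex; suff -> : x = c * q ^+ j by rewrite subrr cabs0 leNgt d0.
have x0 := x_neq0 Ex; rewrite -[LHS]mul1r -h; field.
by rewrite x0.
Qed.

End Weight.

End QPochhammer.

(** * Integrals of the weights *)

Section LaurentFunctions.
Variable F : fieldType.
Implicit Types (f h : laurent F) (G H : F -> F) (r : F).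

(** For r = 0 no nonzero point is excluded, so [laurent_off 0] says that a function is a Laurent
    polynomial on all of C^*. *)
Lemma laurent_off0P G : laurent_off 0 G ->
  exists f, forall x, x != 0 -> lev f x = G x.
Proof. by case=> f fE; exists f => x x0; rewrite fE ?expf_neq0. Qed.

Lemma laurent_offM r G H :
  laurent_off r G -> laurent_off r H -> laurent_off r (fun x => G x * H x).
Proof.
move=> [f fE] hH; suff : laurent_off r (fun x => lev f x * H x).
  by apply: laurent_off_ext => x x0 xr; rewrite fE.
elim/freeg_ind_dom0: f {fE} => [|a n f _ _ IH].
  apply: (laurent_off_ext _ (laurent_off_lev r 0)) => x _ _.
  by rewrite lev0 mul0r.
apply: laurent_off_ext (laurent_offD (laurent_off_mono a n hH) IH) => x _ _.
by rewrite levD levU mulrDl.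
Qed.

Lemma laurent_off_subst (s r : F) f : s != 0 ->
  laurent_off r (fun x => lev f (s / x)).
Proof.
move=> s0; elim/freeg_ind_dom0: f => [|a n f _ _ IH].
  by apply: (laurent_off_ext _ (laurent_off_lev r 0)) => x _ _; rewrite !lev0.
apply: laurent_off_ext
  (laurent_offD (laurent_off_lev r << a * s ^ n *g - n >>) IH) => x x0 _.
rewrite !levD !levU expfzMl; congr (_ + _).
by rewrite -mulrA exprz_inv.
Qed.

Lemma laurent_off_cst r (c : F) : laurent_off r (fun=> c).
Proof.
apply: (laurent_off_ext _ (laurent_off_lev r << c *g 0 >>)) => x _ _.
by rewrite levU expr0z mulr1.
Qed.

Lemma laurent_offB r G H :
  laurent_off r G -> laurent_off r H -> laurent_off r (fun x => G x - H x).
Proof.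
move=> hG hH; apply: laurent_off_ext (laurent_offD hG (laurent_offZ (-1) hH)).
by move=> x _ _; rewrite mulN1r.
Qed.

End LaurentFunctions.

Section WeightIntegral.
Variables (R : realType) (g : R -> R[i]).
Local Notation C := R[i].
Local Notation K := (trace_of g).
Local Notation ci := (is_contour_integral g).
Hypothesis g_cont : {within `[0, 1], continuous (g : R -> C^o)}.
Hypothesis g_rect : rectifiable g.
Hypothesis g_closed : g 0 = g 1.
Hypothesis g_zero : encloses g 0.
Variable r : C.
Hypothesis r_neq0 : r != 0.
Local Notation D := (swap_dom g r).
Local Notation swp := (swapped g r).

Lemma swap_annulus : exists2 r0 : R, 0 < r0 & exists r1 : R,
  forall x, D x -> r0 <= cabs x <= r1.
Proof.
have [K0 _] := g_zero.
have [d d0 hd] := trace_far g_cont K0; have [B B0 hB] := trace_bnd g_cont.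
have r0 : 0 < cabs r by rewrite cabs_gt0.
exists (Num.min d (cabs r / B)); first by rewrite lt_min d0 divr_gt0.
exists (Num.max B (cabs r / d)) => x; rewrite ge_min le_max => -[Kx|Kx].
  by have := hd _ Kx; rewrite subr0 => ->; rewrite hB.
have x0 : x != 0 by apply: (swap_dom_neq0 g_zero (r := r)); right.
have x0' : 0 < cabs x by rewrite cabs_gt0.
have := hd _ Kx; rewrite subr0 cabsM cabsV => h; have := hB _ Kx.
rewrite cabsM cabsV => h'.
have -> : cabs r / B <= cabs x by rewrite ler_pdivrMr // mulrC -ler_pdivrMr.
have -> : cabs x <= cabs r / d by rewrite ler_pdivlMr // mulrC -ler_pdivlMr.
by rewrite !orbT.
Qed.

Lemma swapped_far p : swp p ->
  exists2 d : R, 0 < d & forall x, D x -> d <= cabs (x - p).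
Proof.
have [r0 r0_gt0 [r1 hr]] := swap_annulus.
case=> [->|[p0 hp]].
  by exists r0 => // x /hr/andP[h _]; rewrite subr0.
have [Kp Krp] : ~ K p /\ ~ K (r / p) by case: hp => -[[h _] [h' _]].
have [d d0 hd] := trace_far g_cont Kp; have [d' d'0 hd'] := trace_far g_cont Krp.
have p0' : 0 < cabs p by rewrite cabs_gt0.
have [B B0 hB] := trace_bnd g_cont.
exists (Num.min d (d' * cabs p / B)); first by rewrite lt_min d0 divr_gt0 ?mulr_gt0.
move=> x Dx; have x0 := swap_dom_neq0 g_zero Dx.
rewrite ge_min; case: Dx => Kx; first by rewrite hd.
(* When r / x is on the curve, the distance from x to p is a rescaled distance from the curve to r /
   p. *)
have -> : x - p = - (p * (r / x - r / p)) / (r / x).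
  by field; rewrite p0 x0 r_neq0.
have rx0 : 0 < cabs (r / x) by rewrite cabs_gt0 mulf_neq0 ?invr_eq0.
apply/orP; right; rewrite cabsM cabsN cabsM cabsV [d' * _]mulrC.
by rewrite ler_pM ?mulr_ge0 ?invr_ge0 ?cabs_ge0 ?(ltW d'0) ?(ltW B0) ?ler_pM2l
  ?hd' ?lef_pV2 ?posrE ?hB.
Qed.

Lemma lev_bnd (h : laurent C) (r0 r1 : R) : 0 < r0 -> exists B : R,
  forall x, r0 <= cabs x <= r1 -> cabs (lev h x) <= B.
Proof.
move=> r0_gt0; elim/freeg_ind_dom0: h => [|a n h _ _ [B IH]].
  by exists 0 => x _; rewrite lev0 cabs0.
exists (cabs a * (r1 ^+ `|n|%N + r0^-1 ^+ `|n|%N) + B) => x hx.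
have /andP[h0 h1] := hx; have x0 := lt_le_trans r0_gt0 h0.
rewrite levD levU (le_trans (cabsD _ _)) // lerD ?IH // cabsM cabsXz.
rewrite ler_wpM2l ?cabs_ge0 //.
have r10 : 0 <= r1 by rewrite (le_trans _ h1) ?cabs_ge0.
case: n => n /=.
  rewrite -exprnP ler_wpDr ?exprn_ge0 ?invr_ge0 ?(ltW r0_gt0) //.
  by rewrite lerXn2r ?nnegrE ?cabs_ge0.
rewrite NegzE -exprnN -exprVn ler_wpDl ?exprn_ge0 //.
by rewrite lerXn2r ?nnegrE ?invr_ge0 ?cabs_ge0 ?(ltW r0_gt0) // lef_pV2 ?posrE.
Qed.

Variable q : C.
Hypothesis q_neq0 : q != 0.
Hypothesis q_lt1 : cabs q < 1.
Variables (al be : C) (A B : seq C).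
Hypothesis A_swap : forall a j, a \in A -> a != 0 /\ swp (a^-1 * q^-1 ^+ j).
Hypothesis B_swap : forall b j, b \in B -> swp (b * q ^+ j).

Let rational_qp n (f : C -> C) : ratfun g r f -> ratfun g r (fun x => qp q n (f x)).
Proof.
move=> hf; apply: rational_prod => // j _.
have hj := rationalM hf (rational_cst g r (- q ^+ j)).
apply: rational_ext (rationalD g_zero (rational_cst g r 1) hj) => x _.
by rewrite mulrN.
Qed.

(** The truncations also have a pole at 0, of growing order, from [h] and from the factors in 1 /
    x^2; it is harmless because 0 is always swapped. *)
Lemma weight_ci_swap (h : laurent C) : exists I,
  ci_swap g r (fun x => lev h x * weight q al be A B x * x^-1) I.
Proof.
pose G n x := lev h x * (weight_num q al be n x *
    (\prod_(a <- A) (qp q n (a * x))^-1 * \prod_(b <- B) (qp q n (b * x^-1))^-1))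
    * x^-1.
have rid := rational_id g r; have rinv := rational_inv g r.
have rcst := rational_cst g r.
apply: (ci_swap_ucv g_cont g_rect g_closed g_zero r_neq0 (G := G)).
  move=> n; apply: rationalM => //; apply: rationalM; first exact: rational_lev.
  apply: rationalM.
    apply: rationalM; apply: rational_qp.
      exact: rationalM (rcst al) (rationalX 2 rid).
    apply: rational_ext (rationalM (rcst be) (rationalX 2 rinv)) => x _.
    by rewrite exprVn.
  apply: rationalM; apply: rational_prod => // c cs.
    apply: (@rational_ext _ _ _ (fun x => \prod_(j < n)
       (- (c * q ^+ j)^-1 * (x - c^-1 * q^-1 ^+ j)^-1))).
      move=> x Dx; rewrite /qp -prodfV; apply: eq_bigr => j _.
      have [c0 sj] := A_swap j cs.
      have nz := swap_dom_pole g_zero Dx sj.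
      have e : 1 - c * x * q ^+ j = - (c * q ^+ j) * (x - c^-1 * q^-1 ^+ j).
        by rewrite exprVn; field; rewrite expf_neq0 ?c0.
      by rewrite e [RHS]invfM invrN.
    apply: rational_prod => // j _; apply: rationalM; first exact: rcst.
    by apply: rational_pole; have [] := A_swap j cs.
  apply: (@rational_ext _ _ _ (fun x => \prod_(j < n) (x * (x - c * q ^+ j)^-1))).
    move=> x Dx; rewrite /qp -prodfV; apply: eq_bigr => j _.
    have x0 := swap_dom_neq0 g_zero Dx.
    have nz := swap_dom_pole g_zero Dx (B_swap j cs).
    have -> : 1 - c * x^-1 * q ^+ j = (x - c * q ^+ j) / x by field.
    by rewrite invf_div.
  apply: rational_prod => // j _; apply: rationalM => //.
  by apply: rational_pole; exact: B_swap.
have [r0 r0_gt0 [r1 hr]] := swap_annulus.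
have A_far a j : a \in A -> a != 0 /\
    exists2 d : R, 0 < d & forall x, D x -> d <= cabs (x - a^-1 * q^-1 ^+ j).
  by move=> aA; have [a0 sa] := A_swap j aA; split=> //; exact: swapped_far.
have B_far b j : b \in B ->
    exists2 d : R, 0 < d & forall x, D x -> d <= cabs (x - b * q ^+ j).
  by move=> bB; apply: swapped_far; exact: B_swap.
have hw := weight_ucvb q_lt1 al be r0_gt0 hr q_neq0 A_far B_far.
have [Bh hBh] := lev_bnd h r1 r0_gt0.
have hh : ucvb D (fun=> lev h) (lev h).
  by apply: (@ucvb_cst _ _ _ Bh) => x /hr; exact: hBh.
have hi : ucvb D (fun=> (fun x => x^-1)) (fun x => x^-1).
  apply: (@ucvb_cst _ _ _ r0^-1) => x /hr/andP[h0 _].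
  by rewrite cabsV lef_pV2 ?posrE ?(lt_le_trans r0_gt0 h0).
by have [_] := ucvbM (ucvbM hh hw) hi.
Qed.

End WeightIntegral.

(** * Invariance of the form under T0 and T1 *)

Section Isometry.
Variables (R : realType) (g : R -> R[i]).
Local Notation C := R[i].
Local Notation K := (trace_of g).
Local Notation ci := (is_contour_integral g).
Hypothesis g_rect : rectifiable g.
Hypothesis K0 : ~ K 0.
Implicit Types (f h : laurent C).

(* With phi = num / den, s : x -> r / x and E as below, the integrand is E W / x, and
   E o s = - E because phi + phi o s = 1 + k^2. *)
Lemma ci_isometry (r k : C) (num den W D : C -> C) f h Tf Th
    (fx := fun x => lev f (r / x)) (hx := fun x => lev h (r / x)) :
  r != 0 -> k != 0 ->
  (forall x, x != 0 -> x ^+ 2 = r -> den x = 0) ->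
  (forall x, x != 0 -> x ^+ 2 != r -> den x != 0) ->
  (forall x, x != 0 -> x ^+ 2 != r ->
     lev Tf x = k * lev f x + k^-1 * (num x / den x) * (fx x - lev f x)) ->
  (forall x, x != 0 -> x ^+ 2 != r ->
     lev Th x = k^-1 * lev h x + k^-1 * (num x / den x) * (hx x - lev h x)) ->
  (forall x, x != 0 -> x ^+ 2 != r ->
     num x / den x + num (r / x) / den (r / x) = 1 + k ^+ 2) ->
  (forall x, K x -> num x != 0) ->
  (forall x, K x -> D x * num x = W x * den x) ->
  (forall x, x != 0 -> W (r / x) = W x) ->
  (forall e, exists I, ci_swap g r (fun x => lev e x * W x * x^-1) I) ->
  ci (fun x => (lev Tf x * lev Th x - lev f x * lev h x) * D x * x^-1) 0.
Proof.
move=> r0 k0 den0 den1 TfE ThE phi num0 DW Wr hW.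
have nz x : K x -> x != 0 by move=> Kx; apply/eqP => x0; apply: K0; rewrite -x0.
(* This is (Tf Th - f h) / phi. In the quadratic term one factor phi is absorbed into Tf - k f, so
   that E remains a Laurent polynomial. *)
pose E x := lev f x * (hx x - lev h x) + k ^- 2 * (fx x - lev f x) * lev h x
  + k^-1 * (lev Tf x - k * lev f x) * (hx x - lev h x).
have sq x : x != 0 -> x ^+ 2 = r -> r / x = x by move=> x0 <-; rewrite expr2 mulfK.
have sqK x : x != 0 -> x ^+ 2 = r -> E x = 0.
  by move=> x0 xr; rewrite /E /fx /hx sq // !subrr; ring.
have [e eE] : exists e, forall x, x != 0 -> lev e x = E x.
  apply: laurent_off0P; have hl := @laurent_off_lev C 0.
  have hf : laurent_off 0 fx by exact: laurent_off_subst.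
  have hh : laurent_off 0 hx by exact: laurent_off_subst.
  have dh := laurent_offB hh (hl h).
  have df := laurent_offZ (k ^- 2) (laurent_offB hf (hl f)).
  have dT := laurent_offZ k^-1 (laurent_offB (hl Tf) (laurent_offZ k (hl f))).
  exact: laurent_offD (laurent_offD (laurent_offM (hl f) dh)
    (laurent_offM df (hl h))) (laurent_offM dT dh).
have main x : x != 0 ->
    (lev Tf x * lev Th x - lev f x * lev h x) * den x = num x * E x.
  move=> x0; have [xr|xr] := eqVneq (x ^+ 2) r.
    by rewrite den0 // sqK // !mulr0.
  rewrite /E TfE // ThE //; field.
  by rewrite k0 den1.
have anti x : x != 0 -> E (r / x) = - E x.
  move=> x0; have [xr|xr] := eqVneq (x ^+ 2) r.
    by rewrite sq // sqK // oppr0.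
  have rx0 : r / x != 0 by rewrite mulf_neq0 ?invr_eq0.
  have rxx : r / (r / x) = x by field; rewrite x0 r0.
  have rxr : (r / x) ^+ 2 != r.
    apply: contra xr => /eqP h1; rewrite -{1}rxx expr_div_n h1 expr2 mulfK //.
  apply/eqP; rewrite -addr_eq0 /E TfE // TfE // /fx /hx rxx.
  have := phi x x0 xr; set p := num x / den x => p'E.
  have -> : num (r / x) / den (r / x) = 1 + k ^+ 2 - p by rewrite -p'E addrC addrA addNr add0r.
  move: (lev f x) (lev f (r / x)) (lev h x) (lev h (r / x)) => y1 y2 y3 y4.
  by apply/eqP; field.
have [I [hI hI']] := hW e.
(* The pull-back of E W / x is its negative, yet has the same integral: I = - I. *)
have I0 : I = 0.
  have : ci (fun x => lev e x * W x * x^-1) (- I).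
    have := ciZ (-1) hI'; rewrite mulN1r; apply: ci_ext => x Kx.
    have x0 := nz x Kx; have rx0 : r / x != 0 by rewrite mulf_neq0 ?invr_eq0.
    rewrite (eE _ rx0) (anti _ x0) (Wr _ x0) (eE _ x0); field.
    by rewrite x0 r0.
  move=> /(ci_unique g_rect hI)/eqP.
  by rewrite -addr_eq0 -mulr2n -mulr_natl mulf_eq0 pnatr_eq0 /= => /eqP.
rewrite I0 in hI; apply: ci_ext hI => x Kx; have x0 := nz x Kx.
(* One multiplies by num instead of dividing by den, since den may vanish on the curve where x^2 =
   r. *)
congr (_ * _); apply: (mulIf (num0 x Kx)).
rewrite -[RHS]mulrA DW // eE // mulrCA mulrA -[in RHS]mulrA.
by rewrite [X in W x * X]main //; ring.
Qed.

End Isometry.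

(** * The Askey-Wilson weight and its two symmetrizations *)

Section AskeyWilsonForm.
Variables (R : realType) (t : params R[i]) (g : R -> R[i]).
Local Notation C := R[i].
Local Notation K := (trace_of g).
Local Notation ci := (is_contour_integral g).
Hypothesis t_adm : admissible_params t.
Hypothesis g_adm : admissible_contour t g.
Local Notation q := (qq t).
Local Notation a := (pa t).
Local Notation b := (pb t).
Local Notation c := (pc t).
Local Notation d := (pd t).
Implicit Types (f h : laurent C).

Lemma q_neq0 : q != 0.
Proof. by have [/andP[]] := t_adm; rewrite normr_gt0. Qed.

Lemma qX_neq0 j : q ^+ j != 0.
Proof. exact: expf_neq0 _ q_neq0. Qed.

Lemma qh_neq0 : qh t != 0.
Proof. by have := q_neq0; rewrite /qq expf_eq0. Qed.

Lemma q_lt1 : cabs q < 1.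
Proof. by have [/andP[_]] := t_adm; rewrite -[1]/(1%:C) cabs_ltE. Qed.

Lemma params_neq0 : [/\ k0 t != 0, k1 t != 0, u0 t != 0 & u1 t != 0].
Proof. by have [] := t_adm. Qed.

Lemma curve_hyps : [/\ {within `[0, 1], continuous (g : R -> C^o)},
  rectifiable g, g 0 = g 1 & ~ K 0].
Proof. by have [[]] := g_adm. Qed.

Lemma abcd_neq0 e : e \in abcd t -> e != 0.
Proof.
have [k00 k10 u00 u10] := params_neq0; have qh0 := qh_neq0.
rewrite !inE => /or4P[] /eqP ->; by rewrite ?oppr_eq0 !mulf_neq0 ?invr_eq0.
Qed.

Lemma abcd_poles e j : e \in abcd t ->
  encloses g (e * q ^+ j) /\ excludes g (e^-1 * q^-1 ^+ j).
Proof.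
have [gc gr gcl _] := curve_hyps; have [_ _ ccw _ hp] := g_adm => he.
have [hi ho] := hp e he j; split; first exact: interior_encloses.
exact: exterior_excludes.
Qed.

Lemma a_abcd : a \in abcd t. Proof. by rewrite !inE eqxx. Qed.
Lemma b_abcd : b \in abcd t. Proof. by rewrite !inE eqxx !orbT. Qed.
Lemma c_abcd : c \in abcd t. Proof. by rewrite !inE eqxx !orbT. Qed.
Lemma d_abcd : d \in abcd t. Proof. by rewrite !inE eqxx !orbT. Qed.

(** The contour conditions do not mention the winding number of 0; it is obtained from the enclosed
    points a q^N, which tend to 0. *)
Lemma curve_zero : encloses g 0.
Proof.
have [gc gr gcl K0] := curve_hyps.
apply: zero_encloses => // r r0.
have [N hN] := geo_small (cabs a) (cabs_ge0 q) q_lt1 r0.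
exists (a * q ^+ N); first by have [] := abcd_poles N a_abcd.
by rewrite cabsM cabsX hN.
Qed.

Lemma swapped1_in e j : e \in abcd t -> swapped g 1 (e * q ^+ j).
Proof.
move=> he; have [h1 h2] := abcd_poles j he; right; split.
  exact: mulf_neq0 (abcd_neq0 he) (qX_neq0 j).
by left; split=> //; rewrite invfM mul1r -exprVn.
Qed.

Lemma swapped1_out e j : e \in abcd t -> swapped g 1 (e^-1 * q^-1 ^+ j).
Proof.
move=> he; have [h1 h2] := abcd_poles j he; right; split.
  by rewrite exprVn; apply: mulf_neq0; rewrite invr_eq0 ?qX_neq0 ?abcd_neq0.
by right; split=> //; rewrite invfM mul1r exprVn !invrK.
Qed.

(** For r = q the partner of e q^(j+1) is e^-1 q^-j, and e itself has no partner known to be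
    outside. The poles of [Delta] at c and d are removed by (1 - c/x)(1 - d/x), which is why [W0]
    has inner parameters q c and q d. *)
Lemma swappedq_in e j : e \in abcd t -> swapped g q (e * q ^+ j.+1).
Proof.
move=> he; have [h1 _] := abcd_poles j.+1 he; have [_ h2] := abcd_poles j he.
have e0 := abcd_neq0 he; have q0 := q_neq0; right; split.
  exact: mulf_neq0 e0 (qX_neq0 _).
left; split=> //; rewrite (_ : _ / _ = e^-1 * q^-1 ^+ j) //.
by rewrite exprVn exprS; field; rewrite e0 qX_neq0.
Qed.

Lemma swappedq_out e j : e \in abcd t -> swapped g q (e^-1 * q^-1 ^+ j).
Proof.
move=> he; have [h1 _] := abcd_poles j.+1 he; have [_ h2] := abcd_poles j he.
have e0 := abcd_neq0 he; have q0 := q_neq0; right; split.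
  by rewrite exprVn; apply: mulf_neq0; rewrite invr_eq0 ?qX_neq0.
right; split=> //; rewrite (_ : _ / _ = e * q ^+ j.+1) //.
by rewrite exprVn exprS; field; rewrite e0 qX_neq0.
Qed.

Lemma K_out e j x : e \in abcd t -> K x -> 1 - e * q ^+ j * x != 0.
Proof.
move=> he Kx; have [_ [h _]] := abcd_poles j he.
have e0 := abcd_neq0 he; have q0 := q_neq0.
apply/eqP => /subr0_eq hx; apply: h.
suff -> : e^-1 * q^-1 ^+ j = x by [].
by rewrite exprVn -[LHS]mulr1 {}hx; field; rewrite e0 qX_neq0.
Qed.

Lemma K_in e j x : e \in abcd t -> K x -> 1 - e * q ^+ j / x != 0.
Proof.
move=> he Kx; have [[h _] _] := abcd_poles j he; have [_ _ _ K0] := curve_hyps.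
have x0 : x != 0 by apply/eqP => x0; apply: K0; rewrite -x0.
apply/eqP => /subr0_eq hx; apply: h.
suff -> : e * q ^+ j = x by [].
by apply: (mulIf (invr_neq0 x0)); rewrite -hx divff.
Qed.

Lemma Delta_weight x :
  Delta t x = weight q 1 q [:: a; b; c; d] [:: q * a; q * b; c; d] x.
Proof.
rewrite /Delta /qpochs /weight !big_cons !big_nil !mulr1 mul1r !invfM.
by ring.
Qed.

Lemma qpoch_shift y : qpoch y q = (1 - y) * qpoch (y * q) q.
Proof.
have := qp_factor q_lt1 1 y; rewrite expr1 => ->.
by rewrite /qp big_ord1 expr0 mulr1.
Qed.

(** [W1] is Delta (1 - a x)(1 - b x) / (1 - x^2) and [W0] is Delta (1 - c/x)(1 - d/x) / (1 - q/x^2),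
    with the divisions carried out inside the q-products. They are invariant under x -> 1/x and x ->
    q/x respectively. *)
Definition W1 := weight q q q [:: q * a; q * b; c; d] [:: q * a; q * b; c; d].
Definition W0 :=
  weight q 1 (q ^+ 2) [:: a; b; c; d] [:: q * a; q * b; q * c; q * d].

Lemma Delta_W1 x : K x ->
  Delta t x * ((1 - a * x) * (1 - b * x)) = W1 x * (1 - x ^+ 2).
Proof.
move=> Kx; rewrite Delta_weight /W1 /weight !big_cons !big_nil !mulr1 mul1r.
rewrite (qpoch_shift (x ^+ 2)) (qpoch_shift (a * x)) (qpoch_shift (b * x)).
rewrite [x ^+ 2 * q]mulrC [a * x * q]mulrAC [b * x * q]mulrAC [a * q]mulrC [b * q]mulrC !invfM.
have := K_out 0 a_abcd Kx; have := K_out 0 b_abcd Kx; rewrite expr0 !mulr1.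
move=> b1 a1.
set A := (1 - a * x) in a1 *; set B := (1 - b * x) in b1 *.
set X := 1 - x ^+ 2.
have AV : A^-1 * A = 1 by rewrite mulVf.
have BV : B^-1 * B = 1 by rewrite mulVf.
move: (qpoch _ _) => Q1; move: (qpoch _ _) => Q2.
move: (qpoch _ _)^-1 => Q3; move: (qpoch _ _)^-1 => Q4; move: (qpoch _ _)^-1 => Q5.
move: (qpoch _ _)^-1 => Q6; move: (qpoch _ _)^-1 => Q7; move: (qpoch _ _)^-1 => Q8.
move: (qpoch _ _)^-1 => Q9; move: (qpoch _ _)^-1 => Q10.
rewrite -[RHS]mulr1 -[X in _ = _ * X]AV -[RHS]mulr1 -[X in _ = _ * X]BV; ring.
Qed.

Lemma Delta_W0 x : K x ->
  Delta t x * ((1 - c / x) * (1 - d / x)) = W0 x * (1 - q * x ^- 2).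
Proof.
move=> Kx; rewrite Delta_weight /W0 /weight !big_cons !big_nil !mulr1 mul1r.
rewrite (qpoch_shift (q * x ^- 2)) (qpoch_shift (c / x)) (qpoch_shift (d / x)).
rewrite [q * x ^- 2 * q]mulrAC [c / x * q]mulrAC [d / x * q]mulrAC [c * q]mulrC [d * q]mulrC.
rewrite -expr2 !invfM.
have := K_in 0 c_abcd Kx; have := K_in 0 d_abcd Kx; rewrite expr0 !mulr1.
move=> b1 a1.
set A := (1 - c / x) in a1 *; set B := (1 - d / x) in b1 *.
set X := 1 - q * x ^- 2.
have AV : A^-1 * A = 1 by rewrite mulVf.
have BV : B^-1 * B = 1 by rewrite mulVf.
move: (qpoch _ _) => Q1; move: (qpoch _ _) => Q2.
move: (qpoch _ _)^-1 => Q3; move: (qpoch _ _)^-1 => Q4; move: (qpoch _ _)^-1 => Q5.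
move: (qpoch _ _)^-1 => Q6; move: (qpoch _ _)^-1 => Q7; move: (qpoch _ _)^-1 => Q8.
move: (qpoch _ _)^-1 => Q9; move: (qpoch _ _)^-1 => Q10.
rewrite -[RHS]mulr1 -[X in _ = _ * X]AV -[RHS]mulr1 -[X in _ = _ * X]BV; ring.
Qed.

Lemma W1_inv x : x != 0 -> W1 (1 / x) = W1 x.
Proof.
move=> x0; rewrite /W1 /weight !mul1r exprVn !invrK.
by rewrite [qpoch (q / _) _ * _]mulrC [X in _ * X = _]mulrC.
Qed.

Lemma W0_inv x : x != 0 -> W0 (q / x) = W0 x.
Proof.
move=> x0; have q0 := q_neq0; rewrite /W0 /weight !big_cons !big_nil !mulr1 !mul1r.
have -> : (q / x) ^+ 2 = q ^+ 2 * x ^- 2 by rewrite expr_div_n.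
have -> : q ^+ 2 * (q ^+ 2 * x ^- 2)^-1 = x ^+ 2 by field; rewrite x0 q0.
have e1 e : e * (q / x) = q * e * x^-1 by ring.
have e2 e : q * e * (q / x)^-1 = e * x by field; rewrite x0 q0.
by rewrite !e1 !e2; ring.
Qed.

Lemma pole1_out e j : e \in abcd t ->
  e != 0 /\ swapped g 1 (e^-1 * q^-1 ^+ j).
Proof. by move=> he; split; [exact: abcd_neq0|exact: swapped1_out]. Qed.

Lemma pole1_shift_out e j : e \in [:: q * a; q * b; c; d] ->
  e != 0 /\ swapped g 1 (e^-1 * q^-1 ^+ j).
Proof.
have sh e' : e' \in abcd t -> q * e' != 0 /\ swapped g 1 ((q * e')^-1 * q^-1 ^+ j).
  move=> he; split; first exact: mulf_neq0 q_neq0 (abcd_neq0 he).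
  have := swapped1_out j.+1 he; suff -> : (q * e')^-1 * q^-1 ^+ j = e'^-1 * q^-1 ^+ j.+1 by [].
  by rewrite invfM exprS; ring.
rewrite !inE => /or4P[] /eqP ->.
- exact: sh a_abcd.
- exact: sh b_abcd.
- exact: pole1_out c_abcd.
- exact: pole1_out d_abcd.
Qed.

Lemma pole1_shift_in e j : e \in [:: q * a; q * b; c; d] -> swapped g 1 (e * q ^+ j).
Proof.
have sh e' : q * e' * q ^+ j = e' * q ^+ j.+1 by rewrite exprS; ring.
rewrite !inE => /or4P[] /eqP ->; rewrite ?sh; apply: swapped1_in.
- exact: a_abcd.
- exact: b_abcd.
- exact: c_abcd.
- exact: d_abcd.
Qed.

Lemma poleq_out e j : e \in abcd t ->
  e != 0 /\ swapped g q (e^-1 * q^-1 ^+ j).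
Proof. by move=> he; split; [exact: abcd_neq0|exact: swappedq_out]. Qed.

Lemma poleq_in e j : e \in [:: q * a; q * b; q * c; q * d] ->
  swapped g q (e * q ^+ j).
Proof.
have sh e' : q * e' * q ^+ j = e' * q ^+ j.+1 by rewrite exprS; ring.
rewrite !inE => /or4P[] /eqP ->; rewrite ?sh; apply: swappedq_in.
- exact: a_abcd.
- exact: b_abcd.
- exact: c_abcd.
- exact: d_abcd.
Qed.

Lemma Delta_ci h : exists I, ci (fun x => lev h x * Delta t x * x^-1) I.
Proof.
have [gc gr gcl K0] := curve_hyps.
have [I [hI _]] := weight_ci_swap gc gr gcl curve_zero (oner_neq0 _)
  q_neq0 q_lt1 1 q (fun e j => @pole1_out e j) (fun e j => @pole1_shift_in e j) h.
by exists I; apply: ci_ext hI => x _; rewrite Delta_weight.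
Qed.

Lemma lev_subst_inv h : exists h', forall x, x != 0 -> lev h' x = lev h x^-1.
Proof.
have [h' hE] := laurent_off0P (laurent_off_subst 0 h (oner_neq0 C)).
by exists h' => x x0; rewrite hE // mul1r.
Qed.

Lemma K_neq0 x : K x -> x != 0.
Proof.
by have [_ _ _ K0] := curve_hyps => Kx; apply/eqP => x0; apply: K0; rewrite -x0.
Qed.

(** The form evaluates its second argument at 1/x. Inverting the variable together with the
    parameters turns the dual operator into k1^-1 + k1^-1 phi (s - 1) with the same phi as for [T1],
    the shape required by [ci_isometry]. *)
Lemma isometry_T1 f h : ci (fun x => integrand t (T1 t f) (T1 (inv_params t) h) x
  - integrand t f h x) 0.
Proof.
have [gc gr gcl K0] := curve_hyps; have [k00 k10 u00 u10] := params_neq0.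
have [h' h'E] := lev_subst_inv h; have [Th ThE] := lev_subst_inv (T1 (inv_params t) h).
have iso := @ci_isometry R g gr K0 1 (k1 t) (fun x => (1 - a * x) * (1 - b * x))
  (fun x => 1 - x ^+ 2) W1 (Delta t) f h' (T1 t f) Th (oner_neq0 _) k10.
have den (x : C) : x ^+ 2 != 1 -> 1 - x ^+ 2 != 0 by rewrite subr_eq0 eq_sym.
have den' (x : C) : x ^+ 2 != 1 -> x ^+ 2 - 1 != 0 by rewrite subr_eq0.
have inv_sq (x : C) : x ^+ 2 != 1 -> x^-1 ^+ 2 != 1.
  by rewrite exprVn; apply: contra => /eqP/(canRL invrK) ->; rewrite invr1.
have aE x : 1 - a * x = 1 - k1 t * u1 t * x by [].
have bE x : 1 - b * x = 1 + k1 t * (u1 t)^-1 * x by rewrite /pb mulNr opprK.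
refine (ci_ext _ (iso _ _ _ _ _ _ _ _ _)).
- move=> x Kx; have x0 := K_neq0 Kx.
  by rewrite /integrand ThE // h'E // -!mulrBl.
- by move=> x _ ->; rewrite subrr.
- by move=> x _ /den.
- move=> x x0 x1; have := T1E t f x0 x1; move: (lev (T1 t f) x) => y ->.
  by rewrite /T1_formula aE bE div1r.
- move=> x x0 x1; rewrite ThE // T1E ?invr_eq0 ?inv_sq // /T1_formula aE bE /=.
  rewrite !h'E ?mul1r ?invr_eq0 // !invrK.
  by field; rewrite x0 k10 u10 den // den'.
- move=> x x0 x1; rewrite aE bE aE bE mul1r.
  by field; rewrite x0 u10 den // den'.
- move=> x Kx; have := K_out 0 a_abcd Kx; have := K_out 0 b_abcd Kx.
  by rewrite expr0 !mulr1 => *; exact: mulf_neq0.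
- exact: Delta_W1.
- exact: W1_inv.
- move=> e; exact: (weight_ci_swap gc gr gcl curve_zero (oner_neq0 _)
  q_neq0 q_lt1 q q (fun e j => @pole1_shift_out e j) (fun e j => @pole1_shift_in e j) e).
Qed.

Lemma isometry_T0 f h : ci (fun x => integrand t (T0 t f) (T0 (inv_params t) h) x
  - integrand t f h x) 0.
Proof.
have [gc gr gcl K0] := curve_hyps; have [k00 k10 u00 u10] := params_neq0.
have q0 := q_neq0; have qh0 := qh_neq0.
have [h' h'E] := lev_subst_inv h; have [Th ThE] := lev_subst_inv (T0 (inv_params t) h).
have iso := @ci_isometry R g gr K0 q (k0 t) (fun x => (1 - c / x) * (1 - d / x))
  (fun x => 1 - q * x ^- 2) W0 (Delta t) f h' (T0 t f) Th q_neq0 k00.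
have den (x : C) : x != 0 -> x ^+ 2 != q -> 1 - q * x ^- 2 != 0.
  move=> x0; apply: contra => /eqP/subr0_eq e.
  by rewrite -[x ^+ 2]mul1r e mulfVK // expf_neq0.
have den' (x : C) : x ^+ 2 != q -> x ^+ 2 - q != 0 by rewrite subr_eq0.
have den'' (x : C) : x ^+ 2 != q -> q - x ^+ 2 != 0 by rewrite subr_eq0 eq_sym.
have cE x : 1 - c / x = 1 - qh t * k0 t * u0 t * x^-1 by [].
have dE x : 1 - d / x = 1 + qh t * k0 t * (u0 t)^-1 * x^-1 by rewrite /pd mulNr opprK.
have qinv : qq (inv_params t) = q^-1 by rewrite /qq exprVn.
have inv_sq (x : C) : x != 0 -> x ^+ 2 != q -> x^-1 ^+ 2 != qq (inv_params t).
  move=> x0; rewrite qinv exprVn; apply: contra => /eqP/(canRL invrK) ->.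
  by rewrite invrK.
refine (ci_ext _ (iso _ _ _ _ _ _ _ _ _)).
- move=> x Kx; have x0 := K_neq0 Kx.
  by rewrite /integrand ThE // h'E // -!mulrBl.
- by move=> x x0 <-; rewrite divff ?subrr // expf_neq0.
- by move=> x; exact: den.
- move=> x x0 x1; have := T0E f qh0 x0 x1; move: (lev (T0 t f) x) => y ->.
  by rewrite /T0_formula cE dE.
- move=> x x0 x1; rewrite (ThE _ x0); have xi0 : x^-1 != 0 by rewrite invr_eq0.
  have qx0 : q / x != 0 by rewrite mulf_neq0.
  have qhi0 : qh (inv_params t) != 0 by rewrite invr_eq0.
  have := T0E h qhi0 xi0 (inv_sq x x0 x1).
  move: (lev (T0 (inv_params t) h) x^-1) => y ->.
  (* At 1/x the dual operator uses the value of h at x / q, the inverse of q / x; for [h'] this is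
     again the reflection x -> q / x. *)
  have e1 : q^-1 * x^-1^-1 = (q / x)^-1 by rewrite [RHS]invfM.
  rewrite /T0_formula qinv e1 -(h'E _ qx0) -(h'E _ x0) (cE x) (dE x).
  move: (lev h' x) (lev h' (q / x)) => y1 y2.
  have n1 := den' x x1; have n2 := den'' x x1; rewrite /qq in n1 n2 *.
  have -> : qh (inv_params t) = (qh t)^-1 by [].
  have -> : k0 (inv_params t) = (k0 t)^-1 by [].
  have -> : u0 (inv_params t) = (u0 t)^-1 by [].
  move: (k0 t) (u0 t) (qh t) k00 u00 qh0 n1 n2 => k u p kn un pn n1 n2.
  by field; rewrite x0 kn un pn n1 n2.
- move=> x x0 x1; rewrite (cE x) (dE x) (cE (q / x)) (dE (q / x)).
  have n1 := den' x x1; have n2 := den'' x x1; rewrite /qq in n1 n2 *.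
  move: (k0 t) (u0 t) (qh t) k00 u00 qh0 n1 n2 => k u p kn un pn n1 n2.
  by field; rewrite x0 un pn n1 n2.
- move=> x Kx; have := K_in 0 c_abcd Kx; have := K_in 0 d_abcd Kx.
  by rewrite expr0 !mulr1 => *; exact: mulf_neq0.
- exact: Delta_W0.
- exact: W0_inv.
- move=> e; exact: (weight_ci_swap gc gr gcl curve_zero q_neq0
  q_neq0 q_lt1 1 (q ^+ 2) (fun e j => @poleq_out e j) (fun e j => @poleq_in e j) e).
Qed.

End AskeyWilsonForm.

(** * Nondegeneracy *)

Section LaurentZeros.
Variable F : fieldType.
Implicit Types (f : laurent F) (x : F).

Lemma levE f x : lev f x = \sum_(k <- dom f) coeff k f * x ^ k.
Proof.
rewrite -{1}(freeg_sumE f).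
rewrite (big_morph (fun u => lev u x) (fun u v => @levD _ u v x) (@lev0 _ x)).
by apply: eq_bigr => k _; rewrite levU.
Qed.

(** Multiplication by x^m, with m at least every |k| in the support, gives a polynomial with
    infinitely many roots. The sum of the |k| is a convenient such m. *)
Lemma lev_zeros f (u : nat -> F) : injective u ->
  (forall n, u n != 0 /\ lev f (u n) = 0) -> f = 0.
Proof.
move=> u_inj hu; pose m := (\sum_(k <- dom f) `|k|)%N.
have mk k : k \in dom f -> exists n : nat, k + m%:Z = n%:Z.
  move=> kf; exists (absz (k + m%:Z)).
  have : (absz k <= m)%N by rewrite /m (big_rem _ kf) /= leq_addr.
  move: (m) => m'; lia.
pose P := \sum_(k <- dom f) coeff k f *: 'X^(absz (k + m%:Z)) : {poly F}.
have PE x : x != 0 -> P.[x] = x ^ m%:Z * lev f x.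
  move=> x0; rewrite /P horner_sum levE mulr_sumr !big_seq.
  apply: eq_bigr => k kf; have [n hn] := mk k kf.
  rewrite hornerZ hornerXn hn /= mulrCA; congr (_ * _).
  by rewrite -expfzDr // addrC hn.
have P0 : P = 0.
  apply/eqP; apply: contraT => Pn0.
  have := max_poly_roots Pn0 (rs := map u (iota 0 (size P))).
  rewrite map_inj_uniq // iota_uniq size_map size_iota ltnn => -> //.
  apply/allP => _ /mapP[n _ ->]; have [un0 fun0] := hu n.
  by rewrite /root PE // fun0 mulr0.
apply/eqP/freeg_eqP => k; rewrite coeff0.
have [kf|/coeff_outdom //] := boolP (k \in dom f).
have := congr1 (fun p : {poly F} => p`_(absz (k + m%:Z))) P0.
rewrite coef0 coef_sum (bigD1_seq k) ?uniq_dom //= coefZ coefXn eqxx mulr1.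
rewrite big_seq_cond big1 ?addr0 // => l /andP[lf lk].
rewrite coefZ coefXn; have [n hn] := mk k kf; have [n' hn'] := mk l lf.
rewrite hn hn' /=; case: eqP => [nn|]; last by rewrite mulr0.
by case/eqP: lk; apply: (addIr m%:Z); rewrite hn hn' nn.
Qed.

End LaurentZeros.

(** Each absolute value occurs at most twice, and the geometric series sums to 2. *)
Lemma sum_half_pow (R : realType) (s : seq int) : uniq s ->
  \sum_(k <- s) (2^-1 : R) ^+ `|k|%N <= 4.
Proof.
move=> us; pose N := (\sum_(k <- s) `|k|)%N.+1.
have kN k : k \in s -> (`|k| < N)%N.
  by move=> ks; rewrite ltnS (big_rem _ ks) /= leq_addr.
have split_abs k : k \in s -> (2^-1 : R) ^+ `|k|%N
    = \sum_(j < N) (if `|k|%N == j then 2^-1 ^+ j else 0).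
  move=> /kN ks; rewrite (bigD1 (Ordinal ks)) //= eqxx big1 ?addr0 // => j jk.
  by case: eqP => // e; case/eqP: jk; apply: val_inj.
rewrite big_seq (eq_bigr _ split_abs) -big_seq exchange_big /=.
apply: (@le_trans _ _ (\sum_(j < N) (2^-1 : R) ^+ j *+ 2)).
  apply: ler_sum => j _; rewrite -big_mkcond /= big_const_seq iter_addr addr0.
  rewrite -[leLHS]mulr_natr -[leRHS]mulr_natr ler_wpM2l ?exprn_ge0 ?invr_ge0 //.
  rewrite ler_nat -size_filter.
  apply: (@uniq_leq_size _ _ [:: j%:Z; - j%:Z]); first exact: filter_uniq.
  move=> k; rewrite mem_filter !inE => /andP[/eqP <- _].
  by case: k => k; rewrite ?NegzE ?eqxx ?orbT.
rewrite sumrMnl -[leLHS]mulr_natr.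
have h : (2^-1 : R) < 1 by lra.
have := subrX1 (2^-1 : R) N => e.
have p0 : 0 <= (2^-1 : R) ^+ N by rewrite exprn_ge0 ?invr_ge0.
set S := \sum_(_ < _) _ in e *. lra.
Qed.

Section Nondegenerate.
Variables (R : realType) (t : params R[i]) (g : R -> R[i]).
Local Notation C := R[i].
Local Notation K := (trace_of g).
Local Notation ci := (is_contour_integral g).
Hypothesis t_adm : admissible_params t.
Hypothesis g_adm : admissible_contour t g.
Local Notation q := (qq t).
Local Notation a := (pa t).
Local Notation b := (pb t).
Local Notation c := (pc t).
Local Notation d := (pd t).
Local Notation poles_out := [:: a; b; c; d].
Local Notation poles_in := [:: q * a; q * b; c; d].
Local Notation theta n := (weight_num q 1 q n).
Local Notation denom n := (weight_den q poles_out poles_in n).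
Implicit Types (f h : laurent C).

Lemma ci_monomialz (n : int) :
  ci (fun x => x ^ n) (if n == -1 then twopii R else 0).
Proof.
have [gc gr gcl K0] := curve_hyps g_adm.
case: n => n; first exact: ci_monomial.
have -> : (Negz n == -1) = (n == 0%N) by case: n.
have [_ h0] := curve_zero t_adm g_adm; case: n => [|n] /=.
  by apply: ci_ext h0 => x _; rewrite subr0 NegzE exprN1.
apply: ci_ext (ci_pole gc gr gcl n K0) => x _.
by rewrite subr0 NegzE -exprnN exprVn.
Qed.

(** For s > 0 the map x -> s / conj(x) is the reflection in the circle |x|^2 = s; composing it with
    conjugation gives a Laurent polynomial again. The first formula yields bounds on the curve, the
    second the coefficients. *)
Lemma conj_dilation f (s : R) : exists h, forall x, x != 0 ->
  lev h x = ((lev f (s%:C / (x^*)%C))^*)%C /\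
  lev h x = \sum_(k <- dom f) ((coeff k f)^*)%C * s%:C ^ k * x ^ (- k).
Proof.
pose h := \sum_(k <- dom f) << ((coeff k f)^*)%C * s%:C ^ k *g - k >> : laurent C.
have hE x : lev h x = \sum_(k <- dom f) ((coeff k f)^*)%C * s%:C ^ k * x ^ (- k).
  rewrite /h (big_morph (fun u => lev u x) (fun u v => @levD _ u v x) (@lev0 _ x)).
  by apply: eq_bigr => k _; rewrite levU.
exists h => x x0; split=> //; rewrite hE levE rmorph_sum /=.
apply: eq_bigr => k _; rewrite rmorphM -mulrA /=; congr (_ * _).
have conjX (y : C) : ((y ^ k)^*)%C = ((y^*)%C) ^ k.
  by case: (k) => n; rewrite ?NegzE -?exprnN ?conjc_inv rmorphXn.
have conjM (y z : C) : ((y * z)^*)%C = (y^*)%C * (z^*)%C by exact: rmorphM.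
by rewrite conjX conjM conjc_real conjc_inv conjcK expfzMl exprz_inv.
Qed.

Lemma K_annulus : exists2 r0 : R, 0 < r0 & exists r1 : R,
  forall x, K x -> r0 <= cabs x <= r1.
Proof.
have [gc gr gcl K0] := curve_hyps g_adm.
have [r0 r0_gt0 [r1 hr]] := swap_annulus gc (curve_zero t_adm g_adm) (oner_neq0 C).
by exists r0 => //; exists r1 => x Kx; apply: hr; left.
Qed.

Lemma laurent_off_qp (G : C -> C) n : laurent_off 0 G ->
  laurent_off 0 (fun x => qp q n (G x)).
Proof.
move=> hG; elim: n => [|n IH].
  apply: laurent_off_ext (laurent_off_cst 0 1) => x _ _.
  by rewrite /qp big_ord0.
have h1 := laurent_offB (laurent_off_cst 0 1) (laurent_offZ (q ^+ n) hG).
apply: laurent_off_ext (laurent_offM IH h1) => x _ _.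
by rewrite qpS [q ^+ n * _]mulrC.
Qed.

Lemma laurent_off_prod (s : seq C) (G : C -> C -> C) :
  (forall e, laurent_off 0 (G e)) -> laurent_off 0 (fun x => \prod_(e <- s) G e x).
Proof.
move=> hG; elim: s => [|e s IH].
  by apply: laurent_off_ext (laurent_off_cst 0 1) => x _ _; rewrite big_nil.
by apply: laurent_off_ext (laurent_offM (hG e) IH) => x _ _; rewrite big_cons.
Qed.

Let off_monomial (e : C) (n : int) : laurent_off 0 (fun x => e * x ^ n).
Proof.
apply: laurent_off_ext (laurent_off_mono e n (laurent_off_cst 0 1)) => x _ _.
by rewrite mulr1.
Qed.

Lemma laurent_off_theta n : laurent_off 0 (theta n).
Proof.
apply: laurent_offM; apply: laurent_off_qp; first exact: (off_monomial 1 2).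
exact: (off_monomial q (-2)).
Qed.

Lemma laurent_off_denom n : laurent_off 0 (denom n).
Proof.
apply: laurent_offM; apply: laurent_off_prod => e; apply: laurent_off_qp.
  exact: (off_monomial e 1).
exact: (off_monomial e (-1)).
Qed.

Definition weighted_norm f (s : R) : R :=
  \sum_(k <- dom f) cabs (coeff k f) ^+ 2 * s ^ k.

(* Parseval: the norm is the constant term of [f] times its dilated conjugate. *)
Lemma ci_weighted_norm f h (s : R) :
  (forall x, x != 0 ->
    lev h x = \sum_(k <- dom f) ((coeff k f)^*)%C * s%:C ^ k * x ^ (- k)) ->
  ci (fun x => lev f x * lev h x * x^-1) (twopii R * (weighted_norm f s)%:C).
Proof.
move=> hE.
pose T k l x : C := coeff k f * ((coeff l f)^*)%C * s%:C ^ l * x ^ (k - l - 1).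
pose I k l : C := coeff k f * ((coeff l f)^*)%C * s%:C ^ l *
   (if k - l - 1 == -1 then twopii R else 0).
have hT k l : ci (T k l) (I k l) by apply: ciZ; exact: ci_monomialz.
have := ci_sum (dom f) (fun k => ci_sum (dom f) (hT k)).
have -> : \sum_(k <- dom f) \sum_(l <- dom f) I k l
    = twopii R * (weighted_norm f s)%:C.
  rewrite /weighted_norm rmorph_sum /= mulr_sumr !big_seq.
  apply: eq_bigr => k kf; rewrite (bigD1_seq k) ?uniq_dom //= big1 ?addr0.
    rewrite /I subrr sub0r eqxx rmorphM rmorphXn /= -normCE sqr_normc.
    have -> : (s ^ k)%:C = s%:C ^ k.
      by case: (k) => n; rewrite ?NegzE -?exprnN ?fmorphV rmorphXn.
    by ring.
  move=> l lk; rewrite /I; case: eqP => [|_]; last by rewrite mulr0.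
  move=> e; case/eqP: lk; apply/esym/eqP; rewrite -subr_eq0.
  by rewrite -[k - l](subrK 1) e addNr.
apply: ci_ext => x Kx; have x0 := K_neq0 g_adm Kx.
rewrite levE hE // !mulr_suml; apply: eq_bigr => k _.
rewrite mulr_sumr mulr_suml; apply: eq_bigr => l _.
by rewrite /T expfzDr // expfzDr // exprN1; ring.
Qed.

Section Annihilated.
Variable f : laurent C.
Hypothesis f_orth : forall h, ci (fun x => lev f x * lev h x * Delta t x * x^-1) 0.

Let ft n : laurent C := projT1 (cid (laurent_off0P
  (laurent_offM (laurent_off_lev 0 f) (laurent_off_theta n)))).

Let ftE n x : x != 0 -> lev (ft n) x = lev f x * theta n x.
Proof. by rewrite /ft; case: cid => h hE /= /hE. Qed.

(* Test the orthogonality against the truncated denominator of Delta times the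
   dilated conjugate of [ft n]. *)
Lemma weighted_norm_cvg0 (s e : R) : 0 < s -> 0 < e ->
  exists N, forall n, (N <= n)%N -> weighted_norm (ft n) s < e.
Proof.
move=> s0 e0; have [gc gr gcl K0] := curve_hyps g_adm.
have q1 := q_lt1 t_adm; have [r0 r0_gt0 [r1 hr]] := K_annulus.
have q0 := q_neq0 t_adm.
have A_far e' j : e' \in poles_out -> e' != 0 /\
    exists2 d' : R, 0 < d' & forall x, K x -> d' <= cabs (x - e'^-1 * q^-1 ^+ j).
  move=> he; split; first exact: (abcd_neq0 t_adm).
  by have [_ [h _]] := abcd_poles g_adm j he; exact: trace_far.
have B_far e' j : e' \in poles_in ->
    exists2 d' : R, 0 < d' & forall x, K x -> d' <= cabs (x - e' * q ^+ j).
  move=> he; apply: (trace_far gc).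
  have [e0'|[_ [[[h _] _]|[[h _] _]]]] := pole1_shift_in t_adm g_adm j he => //.
  by rewrite e0'.
have hth := weight_num_ucvb q1 1 q r0_gt0 hr.
have hden := weight_den_ucvb q1 poles_out poles_in r0_gt0 hr.
have hw := weight_ucvb q1 1 q r0_gt0 hr q0 A_far B_far.
have nzden x Kx := @qpoch_den_neq0 _ _ q1 _ _ _ _ _ r0_gt0 hr q0 A_far B_far x Kx.
have [BD BD0 [_ hD]] := ucv_bnd (proj1 hw) (proj2 hw).
have hDelta : ucvb K (fun=> Delta t) (Delta t).
  by apply: (@ucvb_cst _ _ _ BD) => x Kx; rewrite Delta_weight; exact: hD.
have [_ hdD] := ucvbM hden hDelta.
pose th x := qpoch (1 * x ^+ 2) q * qpoch (q * x ^- 2) q.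
(* On the curve [denom n * Delta] and [theta n] both tend uniformly to the full numerator [th], so
   one may replace the other at small cost. *)
have small (e' : R) : 0 < e' -> exists N, forall n, (N <= n)%N -> forall x, K x ->
    cabs (denom n x * Delta t x - theta n x) <= e'.
  move=> e'0; have e2 : 0 < e' / 2 by rewrite divr_gt0.
  have [N hN] := hdD _ e2; have [N' hN'] := (proj2 hth) _ e2.
  exists (maxn N N') => n; rewrite geq_max => /andP[Nn N'n] x Kx.
  have := hN n Nn x Kx.
  have -> : \prod_(y <- poles_out) qpoch (y * x) q *
      \prod_(y <- poles_in) qpoch (y * x^-1) q * Delta t x = th x.
    have [nA nB] := nzden x Kx; rewrite Delta_weight /weight -/(th x).
    rewrite !prodfV; set u := \prod_(_ <- poles_out) _; set v := \prod_(_ <- poles_in) _.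
    have u0 : u != 0 by rewrite prodf_seq_neq0; apply/allP => e'' /nA.
    have v0 : v != 0 by rewrite prodf_seq_neq0; apply/allP => e'' /nB.
    by move: (th x) u v u0 v0 => y1 y2 y3 n2 n3; field; rewrite n2 n3.
  have := hN' n N'n x Kx; rewrite -/(th x).
  have := cabs_subD (denom n x * Delta t x) (th x) (theta n x).
  rewrite [cabs (th x - _)]cabsB; lra.
have [Bf hBf] := lev_bnd f r1 r0_gt0.
have r10 : 0 < r1.
  have Kg : K (g 0) by exists 0 => //=; rewrite in_itv /= lexx ler01.
  by have /andP[h1 h2] := hr _ Kg; exact: lt_le_trans r0_gt0 (le_trans h1 h2).
(* The points s / conj(x), for x on the curve, lie in the annulus from s / r1 to s / r0; there f and
   [theta n] are bounded uniformly in n, hence so are the test functions on the curve. *)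
have sr1 : 0 < s / r1 by rewrite divr_gt0.
have [Bs hBs] := lev_bnd f (s / r0) sr1.
have [[Bt hBt] _] := @weight_num_ucvb _ _ q1 1 q
  [set y | s / r1 <= cabs y <= s / r0] _ _ sr1 (fun y hy => hy).
have hstar n : exists h,
    ci (fun x => lev (ft n) x * lev h x * x^-1)
       (twopii R * (weighted_norm (ft n) s)%:C) /\
    forall x, K x -> cabs (lev h x) <= `|Bs| * `|Bt|.
  have [h hE] := conj_dilation (ft n) s; exists h; split.
    by apply: ci_weighted_norm => x x0; have [] := hE x x0.
  move=> x Kx; have x0 := K_neq0 g_adm Kx; have [-> _] := hE x x0.
  have cx0 : (x^*)%C != 0 by rewrite conjc_eq0.
  have y0 : s%:C / (x^*)%C != 0.
    apply: mulf_neq0; last by rewrite invr_eq0.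
    by rewrite -cabs_gt0 cabs_real normr_gt0 gt_eqF.
  have ys : s / r1 <= cabs (s%:C / (x^*)%C) <= s / r0.
    have /andP[h1 h2] := hr x Kx; have xp : 0 < cabs x by rewrite cabs_gt0.
    rewrite cabsM cabsV cabs_conj cabs_real gtr0_norm //.
    by rewrite !ler_pM2l // !lef_pV2 ?posrE // h1 h2.
  rewrite cabs_conj (ftE _ y0) cabsM ler_pM ?cabs_ge0 //.
    exact: le_trans (hBs _ ys) (ler_norm _).
  exact: le_trans (hBt n _ ys) (ler_norm _).
have [M M0 hM] := ci_bnd gr.
have tp0 : 0 < cabs (twopii R) by rewrite cabs_gt0 twopii_neq0.
pose B := (`|Bf| * (`|Bs| * `|Bt|) * r0^-1 + 1) * M.
have B0 : 0 < B.
  by rewrite mulr_gt0 // ltr_wpDl // !mulr_ge0 ?invr_ge0 ?(ltW r0_gt0).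
have e'0 : 0 < e * cabs (twopii R) / 2 / B by rewrite !divr_gt0 // mulr_gt0.
have [N hN] := small _ e'0; exists N => n Nn.
have [h [hI hb]] := hstar n.
have [hh hhE] := laurent_off0P (laurent_offM (laurent_off_denom n) (laurent_off_lev 0 h)).
(* Parseval minus the orthogonality relation: what remains under the integral contains the small
   factor [denom n * Delta - theta n]. *)
have := ci_lin (-1) (f_orth hh) hI; rewrite mulr0 add0r => hJ.
set e1 := e * _ / 2 / B in e'0 hN.
pose c1 := `|Bf| * (`|Bs| * `|Bt|) * e1 * r0^-1.
have := hM _ _ c1 _ hJ; rewrite cabsM cabs_real => hc.
have {}hc : cabs (twopii R) * `|weighted_norm (ft n) s| <= c1 * M.
  apply: hc => x Kx; have x0 := K_neq0 g_adm Kx.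
  have -> : -1 * (lev f x * lev hh x * Delta t x * x^-1) + lev (ft n) x * lev h x * x^-1
     = - (lev f x * lev h x * (denom n x * Delta t x - theta n x) * x^-1).
    by rewrite hhE // ftE //; ring.
  have /andP[h1 h2] := hr x Kx; have xp : 0 < cabs x by rewrite cabs_gt0.
  rewrite cabsN !cabsM /c1 !ler_pM ?mulr_ge0 ?cabs_ge0 //.
  - exact: le_trans (hBf _ (hr x Kx)) (ler_norm _).
  - exact: hb.
  - exact: hN.
  - by rewrite cabsV lef_pV2 ?posrE.
rewrite -(ltr_pM2l tp0); apply: (@le_lt_trans _ _ (c1 * M)).
  by apply: le_trans hc; rewrite ler_pM2l // ler_norm.
have -> : c1 * M = `|Bf| * (`|Bs| * `|Bt|) * r0^-1 * M * e1 by rewrite /c1; ring.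
apply: (@le_lt_trans _ _ (B * e1)).
  by rewrite ler_wpM2r ?(ltW e'0) // ler_wpM2r ?(ltW M0) // lerDl.
rewrite /e1 mulrC divfK ?gt_eqF //.
have : 0 < cabs (twopii R) * e by rewrite mulr_gt0.
lra.
Qed.

(** Write c_k for the coefficients of h. The norm at s = 4 |x|^2 gives |c_k| |x|^k 2^|k| <= e for k
    >= 0, and the one at s = |x|^2 / 4 the same for k < 0. Summing 2^-|k| over all k yields the
    factor 4. *)
Lemma lev_le_weighted_norm h (x : C) (e : R) : x != 0 -> 0 < e ->
  weighted_norm h (4 * cabs x ^+ 2) <= e ^+ 2 ->
  weighted_norm h (cabs x ^+ 2 / 4) <= e ^+ 2 -> cabs (lev h x) <= 4 * e.
Proof.
move=> x0 e0 h1 h2; have xp : 0 < cabs x by rewrite cabs_gt0.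
have term (s : R) k : 0 < s -> k \in dom h -> weighted_norm h s <= e ^+ 2 ->
    cabs (coeff k h) ^+ 2 * s ^ k <= e ^+ 2.
  move=> s0 kh; apply: le_trans; rewrite /weighted_norm (big_rem _ kh) /= lerDl.
  by apply: sumr_ge0 => l _; rewrite mulr_ge0 ?exprn_ge0 ?exprz_ge0 ?cabs_ge0 ?(ltW s0).
rewrite levE (le_trans (cabs_sum _ _ _)) //.
apply: (@le_trans _ _ (\sum_(k <- dom h) e * (2^-1) ^+ `|k|%N)); last first.
  by rewrite -mulr_sumr mulrC ler_wpM2r ?(ltW e0) // sum_half_pow // uniq_dom.
rewrite !big_seq; apply: ler_sum => k kh; rewrite cabsM cabsXz.
set c1 := cabs (coeff k h); set y := cabs x in xp h1 h2 *.
have y0 : y != 0 by rewrite gt_eqF.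
suff hA : c1 * y ^ k * 2 ^+ `|k|%N <= e.
  by rewrite exprVn ler_pdivlMr ?exprn_gt0.
have A0 : 0 <= c1 * y ^ k * 2 ^+ `|k|%N.
  by rewrite !mulr_ge0 ?cabs_ge0 ?exprn_ge0 // exprz_ge0 // ltW.
rewrite -(@ler_pXn2r _ 2) ?nnegrE ?(ltW e0) //.
case: k kh @c1 A0 => n kh c1 A0 /=.
  apply: le_trans (term _ _ _ kh h1); last by rewrite mulr_gt0 ?exprn_gt0.
  have -> : 4 * y ^+ 2 = (2 * y) ^+ 2 by ring.
  rewrite -/c1 -!exprnP -exprM mulnC exprM [(2 * y) ^+ n]exprMn.
  rewrite le_eqVlt; apply/orP; left.
  by apply/eqP; ring.
apply: le_trans (term _ _ _ kh h2); last by rewrite divr_gt0 ?exprn_gt0.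
have -> : y ^+ 2 / 4 = (2 / y) ^- 2 by field.
have -> : ((2 / y) ^- 2) ^ Negz n = (2 / y) ^+ 2 ^+ n.+1.
  by rewrite NegzE -exprnN exprVn invrK.
rewrite -/c1 NegzE -!exprnN -exprM mulnC exprM [(2 / y) ^+ n.+1]exprMn.
rewrite [y^-1 ^+ n.+1]exprVn le_eqVlt.
by apply/orP; left; apply/eqP; ring.
Qed.

Lemma annihilated_theta x : x != 0 ->
  lev f x * (qpoch (1 * x ^+ 2) q * qpoch (q * x ^- 2) q) = 0.
Proof.
move=> x0; have xp : 0 < cabs x by rewrite cabs_gt0.
have hx y : [set x] y -> cabs x <= cabs y <= cabs x by move=> ->; rewrite lexx.
have [_ hth] := weight_num_ucvb (q_lt1 t_adm) 1 q xp hx.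
apply: (@cvgC_unique _ (fun n => lev (ft n) x)).
  move=> e e0; have B0 : 0 < cabs (lev f x) + 1 by rewrite ltr_wpDl ?cabs_ge0.
  have e1 : 0 < e / (cabs (lev f x) + 1) by rewrite divr_gt0.
  have [N hN] := hth _ e1; exists N => n Nn; have := hN n Nn x erefl.
  rewrite ftE // -mulrBr cabsM ltr_pdivlMr // mulrC; apply: le_lt_trans.
  by rewrite ler_wpM2r ?cabs_ge0 // lerDl.
move=> e e0; have e8 : 0 < e / 8 by rewrite divr_gt0.
have e2 : 0 < (e / 8) ^+ 2 by rewrite exprn_gt0.
have s1 : 0 < 4 * cabs x ^+ 2 by rewrite mulr_gt0 ?exprn_gt0.
have s2 : 0 < cabs x ^+ 2 / 4 by rewrite divr_gt0 ?exprn_gt0.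
have [N hN] := weighted_norm_cvg0 s1 e2; have [N' hN'] := weighted_norm_cvg0 s2 e2.
exists (maxn N N') => n; rewrite geq_max => /andP[Nn N'n]; rewrite subr0.
apply: (@le_lt_trans _ _ (4 * (e / 8))); last by lra.
apply: lev_le_weighted_norm => //.
  exact/ltW/hN.
exact/ltW/hN'.
Qed.

(** For |q|^(1/2) < |x| < 1 both x^2 and q / x^2 have modulus below 1, so the numerator does not
    vanish. The reals 1 - (1 - |q|^(1/2)) / (n + 2) are infinitely many such points, and f vanishes
    at all of them. *)
Lemma annihilated_eq0 : f = 0.
Proof.
have q1 := q_lt1 t_adm; pose p := cabs (qh t).
have p0 : 0 <= p by exact: cabs_ge0.
have qE : cabs q = p ^+ 2 by rewrite /qq cabsX.
have p1 : p < 1 by rewrite -(@expr_lt1 _ 2) // -qE.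
pose x n : R := 1 - (1 - p) / n.+2%:R.
have xb n : p < x n < 1.
  have n0 : (0 : R) < n.+2%:R by rewrite ltr0n.
  have n1 : (1 : R) < n.+2%:R by rewrite ltr1n.
  have h1 : 0 < (1 - p) / n.+2%:R by rewrite divr_gt0 ?subr_gt0.
  have h2 : (1 - p) / n.+2%:R < 1 - p.
    by rewrite ltr_pdivrMr // ltr_pMr ?subr_gt0.
  rewrite /x; move: ((1 - p) / _) h1 h2 => y h1 h2; apply/andP; split; lra.
have x_inj : injective x.
  move=> n m /(congr1 (fun y => 1 - y)); rewrite /x !subKr.
  have p1' : 1 - p != 0 by rewrite gt_eqF ?subr_gt0.
  by move=> /(mulfI p1')/invr_inj/eqP; rewrite eqr_nat => /eqP[].
apply: (@lev_zeros _ f (fun n => (x n)%:C)) => [n m /complexI/x_inj //|n].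
have /andP[px x1] := xb n; have xp : 0 < x n := le_lt_trans p0 px.
have x0 : (x n)%:C != 0 by rewrite -cabs_gt0 cabs_real gtr0_norm.
split=> //; have /eqP := annihilated_theta x0; rewrite !mulf_eq0.
have cx : cabs (x n)%:C = x n by rewrite cabs_real gtr0_norm.
have small y : cabs y < 1 -> qpoch y q != 0.
  move=> y1; apply: qpoch_neq0 => // j; apply/eqP => yj.
  have : cabs (y * q ^+ j) < 1.
    rewrite cabsM cabsX; apply: le_lt_trans y1.
    by rewrite ler_piMr ?cabs_ge0 // exprn_ile1 ?cabs_ge0 // ltW.
  by rewrite yj cabs1 ltxx.
have /negPf -> : qpoch (1 * (x n)%:C ^+ 2) q != 0.
  by apply: small; rewrite mul1r cabsX cx expr_lt1 // ltW.
have /negPf -> : qpoch (q * (x n)%:C ^- 2) q != 0.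
  apply: small; rewrite cabsM cabsV cabsX cx qE ltr_pdivrMr ?exprn_gt0 // mul1r.
  by rewrite ltrXn2r // ?nnegrE ?(ltW xp).
by rewrite !orbF => /eqP.
Qed.

End Annihilated.
End Nondegenerate.

(** * Orthogonality and bases *)

Section FreeLift.
Variables (F : fieldType) (I : choiceType) (V : lmodType F) (b : I -> V).
Implicit Types (a : F) (c : {freeg I / F}).

Lemma fgliftB c d : fglift b (c - d) = fglift b c - fglift b d.
Proof. exact: (@lift_is_additive F I V b c d). Qed.

Lemma fglift0 : fglift b 0 = 0.
Proof. by rewrite -(subrr 0) fgliftB subrr. Qed.

Lemma fgliftD c d : fglift b (c + d) = fglift b c + fglift b d.
Proof. by rewrite -{1}[d]opprK fgliftB -[- d]add0r fgliftB fglift0 sub0r opprK. Qed.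

Lemma freegZU a k (x : I) : a *: << k *g x >> = << a * k *g x >> :> {freeg I / F}.
Proof. by apply/eqP/freeg_eqP => y; rewrite coeffZ !coeffU mulrA. Qed.

Lemma fgliftZ a c : fglift b (a *: c) = a *: fglift b c.
Proof.
elim/freeg_ind_dom0: c => [|k x c _ _ IH].
  by rewrite scaler0 fglift0 scaler0.
by rewrite scalerDr !fgliftD IH scalerDr freegZU !liftU scalerA.
Qed.

End FreeLift.

Section DualBases.
Variables (F : fieldType) (I : choiceType) (b b' : I -> laurent F).
Variable B : laurent F -> laurent F -> F.
Hypothesis B_nondeg : nondegenerate_bilinear B.
Hypothesis b_neq0 : forall i, b i != 0.
Hypothesis orth : forall i j, i != j -> B (b i) (b' j) = 0.
Hypothesis b_span : forall f, exists c : {freeg I / F}, f = fglift b c.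
Hypothesis b'_span : forall f, exists c : {freeg I / F}, f = fglift b' c.

Let BDl f h u : B (f + h) u = B f u + B h u.
Proof. by have [/(_ u 1 f h)] := B_nondeg; rewrite scale1r mul1r. Qed.

Let BDr f h u : B u (f + h) = B u f + B u h.
Proof. by have [_ /(_ u 1 f h)] := B_nondeg; rewrite scale1r mul1r. Qed.

Let B0l u : B 0 u = 0.
Proof. by apply: (addrI (B 0 u)); rewrite -BDl !addr0. Qed.

Let B0r u : B u 0 = 0.
Proof. by apply: (addrI (B u 0)); rewrite -BDr !addr0. Qed.

Let BZl a f u : B (a *: f) u = a * B f u.
Proof. by have [/(_ u a f 0)] := B_nondeg; rewrite !addr0 B0l addr0. Qed.

Let BZr a f u : B u (a *: f) = a * B u f.
Proof. by have [_ /(_ u a f 0)] := B_nondeg; rewrite !addr0 B0r addr0. Qed.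

Let Bl c j : B (fglift b c) (b' j) = coeff j c * B (b j) (b' j).
Proof.
elim/freeg_ind_dom0: c => [|k i c _ _ IH].
  by rewrite fglift0 B0l coeff0 mul0r.
rewrite fgliftD BDl IH liftU BZl coeffD coeffU mulrDl; congr (_ + _).
by have [->|ij] := eqVneq i j; rewrite ?mulr1 // orth // !mulr0 mul0r.
Qed.

Let Br c j : B (b j) (fglift b' c) = coeff j c * B (b j) (b' j).
Proof.
elim/freeg_ind_dom0: c => [|k i c _ _ IH].
  by rewrite fglift0 B0r coeff0 mul0r.
rewrite fgliftD BDr IH liftU BZr coeffD coeffU mulrDl; congr (_ + _).
have [->|ij] := eqVneq i j; rewrite ?mulr1 // orth 1?eq_sym //.
by rewrite !mulr0 mul0r.
Qed.

(* Otherwise b_i would be orthogonal to the whole space. *)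
Let diag_neq0 i : B (b i) (b' i) != 0.
Proof.
apply/eqP => h; have [_ _ /(_ (b i)) h0 _] := B_nondeg.
have /eqP := b_neq0 i; apply; apply: h0 => f.
by have [c ->] := b'_span f; rewrite Br h mulr0.
Qed.

(** Pairing an expansion with the dual vector of index j reads off its coefficient times a nonzero
    number, so coefficients are unique. *)
Lemma dual_bases : is_basis b /\ is_basis b'.
Proof.
split=> f.
  have [c cE] := b_span f; exists c; split=> // c' c'E.
  apply/eqP/freeg_eqP => j; apply: (mulIf (diag_neq0 j)).
  by rewrite -!Bl -cE -c'E.
have [c cE] := b'_span f; exists c; split=> // c' c'E.
apply/eqP/freeg_eqP => j; apply: (mulIf (diag_neq0 j)).
by rewrite -!Br -cE -c'E.
Qed.

End DualBases.

(** * Additivity of the operators, distinct eigenvalues, spanning families *)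

Section Operators.
Variable R : realType.
Local Notation C := R[i].
Implicit Types (f h : laurent C) (t : params C).

Lemma levZ (a : C) f x : lev (a *: f) x = a * lev f x.
Proof. exact: fgliftZ. Qed.

(** The images under [T0] and [T1] are prescribed only where x^2 <> r, so equality has to be
    testable there. At most one positive integer has square r; the larger ones are infinitely many
    test points. *)
Lemma lev_ext r f h :
  (forall x : C, x != 0 -> x ^+ 2 != r -> lev f x = lev h x) -> f = h.
Proof.
move=> fh; have [m hm] : exists m : nat, forall n, ((n + m).+1%:R : C) ^+ 2 != r.
  have [[k /eqP hk]|/forallNP no] := pselect (exists k : nat, (k.+1%:R : C) ^+ 2 == r).
    exists k.+1 => n; rewrite -hk -!natrX eqr_nat eqn_exp2r // eqSS.
    by rewrite addnS gtn_eqF // ltnS leq_addl.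
  by exists 0%N => n; apply/negP => hn; apply: (no (n + 0)%N).
apply: subr0_eq; apply: (@lev_zeros _ _ (fun n => (n + m).+1%:R)).
  move=> n n' /eqP; rewrite eqr_nat eqSS eqn_add2r => /eqP //.
move=> n; have x0 : (n + m).+1%:R != 0 :> C by rewrite pnatr_eq0.
by split=> //; rewrite levB fh ?subrr.
Qed.

(** [T1] is chosen through its values, so additivity is read off those values. *)
Lemma T1D t f h : T1 t (f + h) = T1 t f + T1 t h.
Proof.
apply: (@lev_ext 1) => x x0 x1; rewrite levD !T1E // /T1_formula !levD.
move: (_ / (1 - x ^+ 2)) => y; move: (k1 t) => k.
by rewrite mulrDr; ring.
Qed.

Lemma T0D t f h : qh t != 0 -> T0 t (f + h) = T0 t f + T0 t h.
Proof.
move=> q0; apply: (@lev_ext (qq t)) => x x0 x1.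
rewrite levD !T0E // /T0_formula !levD.
move: (_ / (1 - qq t * x ^- 2)) => y; move: (k0 t) => k.
by rewrite mulrDr; ring.
Qed.

Lemma mono_rank_inj : injective mono_rank.
Proof. by move=> m n; rewrite /mono_rank; do 2 case: ifP => ?; lia. Qed.

(* If gamma_i = gamma_j with i of lower rank than j, then P_j + P_i would be a second
   candidate for P_j. *)
Lemma gamma_distinct t (P : int -> laurent C) : qh t != 0 ->
  (forall m, is_P t m (P m)) -> forall i j, i != j ->
  gamma_ev t i != gamma_ev t j.
Proof.
move=> q0 hP i j; wlog ij : i j / (mono_rank i < mono_rank j)%N.
  move=> h ij; have : mono_rank i != mono_rank j.
    by apply: contra ij => /eqP/mono_rank_inj ->.
  rewrite neq_ltn => /orP[r_ij|r_ji]; first exact: h.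
  by rewrite eq_sym; apply: h => //; rewrite eq_sym.
move=> inj; apply/eqP => gij.
have [[[Pi1 Pin] Yi] _] := hP i; have [[[Pj1 Pjn] Yj] Pju] := hP j.
have cji : coeff j (P i) = 0.
  apply/eqP; apply: contraT => /Pin[ji|]; first by rewrite ji eqxx in inj.
  by rewrite ltnNge (ltnW ij).
have : P j = P j + P i.
  apply: Pju; split; last by rewrite /Yop T0D // T1D -!/(Yop t _) Yi Yj gij scalerDr.
  split; first by rewrite coeffD cji addr0.
  move=> n; rewrite coeffD => cn.
  have [Pjn0|/Pjn //] := eqVneq (coeff n (P j)) 0.
  rewrite Pjn0 add0r in cn; have [->|ni] := Pin n cn; first by right.
  by right; exact: ltn_trans ni ij.
move=> /eqP; rewrite -subr_eq0 opprD addrA subrr add0r oppr_eq0 => /eqP Pi0.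
by move: Pi1; rewrite Pi0 coeff0 => /eqP; rewrite eq_sym oner_eq0.
Qed.

Lemma gamma_inv t m : gamma_ev (inv_params t) m = (gamma_ev t m)^-1.
Proof.
have qinv : qq (inv_params t) = (qq t)^-1 by rewrite /qq exprVn.
by rewrite /gamma_ev qinv -invfM !exprz_inv invfM; case: ifP => _; rewrite !invr_expz.
Qed.

Section Span.
Variables (t : params C) (P : int -> laurent C) (Pp Pm : nat -> laurent C).
Hypothesis k1_sqr : k1 t != - (k1 t)^-1.
Hypothesis fam : AW_families t P Pp Pm.
Local Notation b := (AW_sym_family Pp Pm).

Let sp f := exists c : {freeg (nat + nat)%type / C}, f = fglift b c.

Let spD f h : sp f -> sp h -> sp (f + h).
Proof. by move=> [c ->] [c' ->]; exists (c + c'); rewrite fgliftD. Qed.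

Let spZ a f : sp f -> sp (a *: f).
Proof. by move=> [c ->]; exists (a *: c); rewrite fgliftZ. Qed.

Let spb i : sp (b i).
Proof. by exists << 1 *g i >>; rewrite liftU scale1r. Qed.

Let spB f h : sp f -> sp h -> sp (f - h).
Proof. by move=> hf hh; rewrite -scaleN1r; apply: spD => //; exact: spZ. Qed.

Let sp0 : sp 0.
Proof. by exists 0; rewrite fglift0. Qed.

Let sp_sum (T : Type) (s : seq T) (F : T -> laurent C) :
  (forall i, sp (F i)) -> sp (\sum_(i <- s) F i).
Proof. by move=> h; elim/big_ind: _ => //; exact: spD. Qed.

Let P_monic m : coeff m (P m) = 1.
Proof. by have [/(_ m)[[[]]]] := fam. Qed.

Lemma AW_sym_family_neq0 i : b i != 0.
Proof.
have nz m f : coeff m f = 1 -> f != 0.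
  by move=> h; apply/eqP => f0; move: h; rewrite f0 coeff0 => /eqP; rewrite eq_sym oner_eq0.
have [_ hp hm] := fam; case: i => n /=.
  by have [[_ [/nz]]] := hp n.
by have [[_ [/nz]]] := hm n.+1 isT.
Qed.

(** As P_(-n) has lower rank than x^n, both P_n^+ and P_n^- contain P_n with coefficient 1. Their
    [T1]-eigenvalues differ, so they are distinct and their difference is a nonzero multiple of
    P_(-n); P_n follows. *)
Let sp_P m : sp (P m).
Proof.
have [hP hp hm] := fam.
have pos (n : nat) : sp (P n.+1%:Z) /\ sp (P (- n.+1%:Z)).
  have c0 : coeff n.+1%:Z (P (- n.+1%:Z)) = 0.
    have [[[_ h] _] _] := hP (- n.+1%:Z).
    apply/eqP; apply: contraT => /h[//|]; rewrite /mono_rank /=; lia.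
  have [[[a1 [b1 p1]] [p2 _] p3] _] := hp n.+1.
  have [[[a2 [b2 m1]] [m2 _] m3] _] := hm n.+1 isT.
  have a1E : a1 = 1 by move: p2; rewrite p1 coeffD !coeffZ P_monic c0 mulr0 addr0 mulr1.
  have a2E : a2 = 1 by move: m2; rewrite m1 coeffD !coeffZ P_monic c0 mulr0 addr0 mulr1.
  have b12 : b1 - b2 != 0.
    rewrite subr_eq0; apply/eqP => b12; case/eqP: k1_sqr.
    have e : Pp n.+1 = Pm n.+1 by rewrite p1 m1 a1E a2E b12.
    have := congr1 (coeff n.+1%:Z) (etrans (esym p3) (etrans (congr1 (T1 t) e) m3)).
    by rewrite !coeffZ p2 m2 !mulr1.
  have sPn : sp (P (- n.+1%:Z)).
    have -> : P (- n.+1%:Z) = (b1 - b2)^-1 *: (Pp n.+1 - Pm n.+1).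
      rewrite p1 m1 a1E a2E opprD addrACA subrr add0r -scalerBl scalerA.
      by rewrite mulVf // scale1r.
    by apply: spZ; apply: spB; [exact: (spb (inl _))|exact: (spb (inr n))].
  split=> //.
  have -> : P n.+1%:Z = Pp n.+1 - b1 *: P (- n.+1%:Z).
    by rewrite p1 a1E scale1r addrK.
  by apply: spB; [exact: (spb (inl _))|exact: spZ].
(* For m = 0 the two spanning polynomials coincide, and monicity forces the symmetric polynomial to
   be [P 0]. *)
case: m => [[|n]|n]; last by rewrite NegzE; have [] := pos n.
  have [[[a1 [b1 p1]] [p2 _] _] _] := hp 0%N.
  rewrite oppr0 -scalerDl in p1.
  have e : a1 + b1 = 1 by move: p2; rewrite p1 coeffZ P_monic mulr1.
  by rewrite e scale1r in p1; rewrite -p1; exact: (spb (inl 0%N)).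
by have [] := pos n.
Qed.

Lemma AW_sym_family_span f : exists c : {freeg (nat + nat)%type / C}, f = fglift b c.
Proof.
have mono m : sp << 1 *g m >>.
  have [r] := ubnP (mono_rank m); elim: r => // r IH in m *; rewrite ltnS => mr.
  have [hP _ _] := fam; have [[[_ h] _] _] := hP m.
  have := freeg_sumE (P m); rewrite (bigD1_seq m) ?uniq_dom ?mem_dom ?P_monic ?oner_eq0 //=.
  move=> /(canRL (addrK _)) ->; apply: spB; first exact: sp_P.
  rewrite big_seq_cond; elim/big_ind: _ => [|u v|k /andP[]]; [exact: sp0|exact: spD|].
  rewrite mem_dom => /h[-> /eqP //|km _].
  have -> : << coeff k (P m) *g k >> = coeff k (P m) *: << 1 *g k >> :> laurent C.
    by rewrite freegZU mulr1.
  by apply/spZ/IH; exact: leq_trans km mr.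
rewrite -(freeg_sumE f); apply: sp_sum => k.
have -> : << coeff k f *g k >> = coeff k f *: << 1 *g k >> :> laurent C.
  by rewrite freegZU mulr1.
exact/spZ/mono.
Qed.

End Span.
End Operators.

(** * The bilinear form: invariance, nondegeneracy, orthogonality *)

Section Form.
Variables (R : realType) (t : params R[i]) (g : R -> R[i]).
Local Notation C := R[i].
Local Notation ci := (is_contour_integral g).
Hypothesis t_adm : admissible_params t.
Hypothesis g_adm : admissible_contour t g.
Implicit Types (f h u : laurent C).
Local Notation B := (aw_form t g).
Local Notation t' := (inv_params t).

Lemma integrand_ci f h : exists I, ci (integrand t f h) I.
Proof.
have [h' h'E] := lev_subst_inv h.
have [e eE] := laurent_off0P (laurent_offM (laurent_off_lev 0 f) (laurent_off_lev 0 h')).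
have [I hI] := Delta_ci t_adm g_adm e; exists I; apply: ci_ext hI => x Kx.
have x0 := K_neq0 g_adm Kx.
by rewrite eE // h'E.
Qed.

Lemma aw_formE f h I : ci (integrand t f h) I -> B f h = (twopii R)^-1 * I.
Proof.
have [_ gr _ _] := curve_hyps g_adm.
by move=> hI; rewrite /aw_form (contour_integralE gr hI).
Qed.

Lemma aw_form_eq0 f h : B f h = 0 -> ci (integrand t f h) 0.
Proof.
have [I hI] := integrand_ci f h; rewrite (aw_formE hI) => /eqP.
by rewrite mulf_eq0 invr_eq0 (negPf (twopii_neq0 R)) => /eqP <-.
Qed.

Lemma aw_form_linl u : scalar (B^~ u).
Proof.
move=> a f h; have [I hI] := integrand_ci f u; have [J hJ] := integrand_ci h u.
have hL : ci (integrand t (a *: f + h) u) (a * I + J).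
  apply: ci_ext (ci_lin a hI hJ) => x _.
  by rewrite /integrand levD levZ; ring.
by rewrite (aw_formE hI) (aw_formE hJ) (aw_formE hL); ring.
Qed.

Lemma aw_form_linr u : scalar (B u).
Proof.
move=> a f h; have [I hI] := integrand_ci u f; have [J hJ] := integrand_ci u h.
have hL : ci (integrand t u (a *: f + h)) (a * I + J).
  apply: ci_ext (ci_lin a hI hJ) => x _.
  by rewrite /integrand levD levZ; ring.
by rewrite (aw_formE hI) (aw_formE hJ) (aw_formE hL); ring.
Qed.

(** Replacing a Laurent polynomial by its value at 1/x brings the left and the right radical to the
    same shape, so one annihilation argument covers both. *)
Lemma aw_form_nondegenerate : nondegenerate_bilinear B.
Proof.
split; [exact: aw_form_linl|exact: aw_form_linr| |].
  move=> f hf; apply: (annihilated_eq0 t_adm g_adm) => h.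
  have [h' h'E] := lev_subst_inv h.
  apply: ci_ext (aw_form_eq0 (hf h')) => x Kx; have x0 := K_neq0 g_adm Kx.
  by rewrite /integrand h'E ?invr_eq0 // invrK.
move=> h hh; have [h' h'E] := lev_subst_inv h.
have h'0 : h' = 0.
  apply: (annihilated_eq0 t_adm g_adm) => f.
  apply: ci_ext (aw_form_eq0 (hh f)) => x Kx; have x0 := K_neq0 g_adm Kx.
  by rewrite /integrand h'E // [lev f x * _]mulrC.
apply: (@lev_ext _ 0) => x x0 _; rewrite lev0.
by have := h'E x^-1; rewrite invrK invr_eq0 h'0 lev0 => ->.
Qed.

Let form_sub (f h f' h' : laurent C) :
  ci (fun x => integrand t f' h' x - integrand t f h x) 0 -> B f' h' = B f h.
Proof.
have [_ gr _ _] := curve_hyps g_adm.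
have [I hI] := integrand_ci f h; have [J hJ] := integrand_ci f' h'.
move=> h0; rewrite (aw_formE hI) (aw_formE hJ); congr (_ * _).
apply/eqP; rewrite -subr_eq0; apply/eqP; apply: (ci_unique gr _ h0).
by rewrite addrC -mulN1r; apply: ci_ext (ci_lin (-1) hI hJ) => x _; ring.
Qed.

Lemma aw_form_T1 f h : B (T1 t f) (T1 t' h) = B f h.
Proof. by apply: form_sub; exact: isometry_T1. Qed.

Lemma aw_form_T0 f h : B (T0 t f) (T0 t' h) = B f h.
Proof. by apply: form_sub; exact: isometry_T0. Qed.

Lemma aw_form_Y f h : B (Yop t f) (Yop t' h) = B f h.
Proof. by rewrite /Yop aw_form_T1 aw_form_T0. Qed.

Lemma aw_form_scale a c f h : B (a *: f) (c *: h) = a * c * B f h.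
Proof.
have B0 u : B 0 u = 0.
  by have := aw_form_linl u (-1) 0 0; rewrite scaler0 addr0 mulN1r addNr.
have B0' u : B u 0 = 0.
  by have := aw_form_linr u (-1) 0 0; rewrite scaler0 addr0 mulN1r addNr.
have := aw_form_linl (c *: h) a f 0; rewrite !addr0 B0 addr0 => ->.
have := aw_form_linr f c h 0; rewrite !addr0 B0' addr0 => ->.
by rewrite mulrA.
Qed.

Lemma aw_form_eigen (x y : C) f h f' h' : B f' h' = B f h ->
  f' = x *: f -> h' = y *: h -> x * y != 1 -> B f h = 0.
Proof.
move=> e fE hE xy; move: e; rewrite fE hE aw_form_scale => /eqP.
rewrite -subr_eq0 -{2}[B f h]mul1r -mulrBl mulf_eq0 subr_eq0 (negPf xy) /=.
by move/eqP.
Qed.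

Lemma aw_form_span2 u v u' v' f h : in_span2 u v f -> in_span2 u' v' h ->
  B u u' = 0 -> B u v' = 0 -> B v u' = 0 -> B v v' = 0 -> B f h = 0.
Proof.
move=> [a [b ->]] [a' [b' ->]] h1 h2 h3 h4.
have scl x w w' : B (x *: w) w' = x * B w w'.
  by have := aw_form_scale x 1 w w'; rewrite scale1r mulr1.
have scr x w w' : B w (x *: w') = x * B w w'.
  by have := aw_form_scale 1 x w w'; rewrite scale1r mul1r.
have lin w : B w u' = 0 -> B w v' = 0 -> B w (a' *: u' + b' *: v') = 0.
  by move=> e1 e2; have := aw_form_linr w a' u' (b' *: v'); rewrite scr e1 e2 !mulr0 addr0.
have /= -> := aw_form_linl (a' *: u' + b' *: v') a u (b *: v).
by rewrite scl (lin u) // (lin v) // !mulr0 addr0.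
Qed.

(** The exponent j = 0 in the parameter conditions. It separates the two eigenvalues k1 and -1/k1 of
    [T1]. *)
Lemma k1_sqr_neqN1 : k1 t ^+ 2 != -1.
Proof.
have [_ _ /(_ (k1 t))/(_ _ 0)] := t_adm.
by rewrite !inE eqxx orbT expr0z => /(_ isT)[].
Qed.

Variables (P P' : int -> laurent C) (Pp Pm Pp' Pm' : nat -> laurent C).
Hypothesis fam : AW_families t P Pp Pm.
Hypothesis fam' : AW_families t' P' Pp' Pm'.

Lemma nonsymmetric_orth i j : i != j -> B (P i) (P' j) = 0.
Proof.
move=> ij; have [hP _ _] := fam; have [hP' _ _] := fam'.
have [[_ Yi] _] := hP i; have [[_ Yj] _] := hP' j.
apply: (aw_form_eigen (aw_form_Y (P i) (P' j)) Yi Yj).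
have [k00 k10 _ _] := params_neq0 t_adm; have q0 := q_neq0 t_adm.
have gj : gamma_ev t j != 0.
  by apply: mulf_neq0; apply: expfz_neq0 => //; exact: mulf_neq0.
rewrite gamma_inv; apply: contra (gamma_distinct (qh_neq0 t_adm) hP ij) => /eqP h.
by rewrite -[gamma_ev t i]mulr1 -(mulVf gj) mulrA h mul1r.
Qed.

Lemma sym_sym_orth m n : m <> n -> B (Pp m) (Pp' n) = 0.
Proof.
move=> mn; have [_ hp _] := fam; have [_ hp' _] := fam'.
have [[s1 _ _] _] := hp m; have [[s2 _ _] _] := hp' n.
by apply: (aw_form_span2 s1 s2); apply: nonsymmetric_orth; lia.
Qed.

Lemma anti_anti_orth m n : (0 < m)%N -> (0 < n)%N -> m <> n ->
  B (Pm m) (Pm' n) = 0.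
Proof.
move=> m0 n0 mn; have [_ _ hm] := fam; have [_ _ hm'] := fam'.
have [[s1 _ _] _] := hm m m0; have [[s2 _ _] _] := hm' n n0.
by apply: (aw_form_span2 s1 s2); apply: nonsymmetric_orth; lia.
Qed.

(** For m = n the eigenvalues of Y cannot separate the two spans, so [T1] is used: the products of
    its eigenvalues are -k1^2 and -k1^-2, neither equal to 1. *)
Lemma sym_anti_orth m n : (0 < n)%N ->
  B (Pp m) (Pm' n) = 0 /\ B (Pm n) (Pp' m) = 0.
Proof.
move=> n0; have [_ hp hm] := fam; have [_ hp' hm'] := fam'.
have [[_ _ e1] _] := hp m; have [[_ _ e2] _] := hm n n0.
have [[_ _ e1'] _] := hp' m; have [[_ _ e2'] _] := hm' n n0.
have kk := k1_sqr_neqN1; have [_ k10 _ _] := params_neq0 t_adm.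
split.
  apply: (aw_form_eigen (aw_form_T1 _ _) e1 e2').
  by rewrite [k1 t']/((k1 t)^-1) invrK mulrN -expr2 eqr_oppLR.
apply: (aw_form_eigen (aw_form_T1 _ _) e2 e1').
have -> : k1 t' = (k1 t)^-1 by [].
by rewrite mulNr -expr2 eqr_oppLR exprVn -[-1]invrK (inj_eq invr_inj) invrN invr1.
Qed.

Lemma AW_sym_bases : is_basis (AW_sym_family Pp Pm) /\ is_basis (AW_sym_family Pp' Pm').
Proof.
have kk := k1_sqr_neqN1; have [_ k10 _ _] := params_neq0 t_adm.
have kk1 : k1 t != - (k1 t)^-1.
  apply: contra kk => /eqP h; apply/eqP.
  by rewrite expr2 {1}h mulNr mulVf.
have kk2 : k1 t' != - (k1 t')^-1.
  have -> : k1 t' = (k1 t)^-1 by [].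
  by rewrite invrK eq_sym eqr_oppLR.
apply: (dual_bases aw_form_nondegenerate).
- exact: (AW_sym_family_neq0 fam).
- case=> [m|m] [n|n] /= mn.
  + by apply: sym_sym_orth => e; rewrite e eqxx in mn.
  + by have [] := sym_anti_orth m (ltn0Sn n).
  + by have [] := sym_anti_orth n (ltn0Sn m).
  + by apply: anti_anti_orth => // -[e]; rewrite e eqxx in mn.
- exact: (AW_sym_family_span kk1 fam).
- exact: (AW_sym_family_span kk2 fam').
Qed.

End Form.

Theorem proposition6p8 (R : realType) (t : params R[i]) (g : R -> R[i])
    (P P' : int -> laurent R[i]) (Pp Pm Pp' Pm' : nat -> laurent R[i]) :
  admissible_params t -> admissible_contour t g ->
  AW_families t P Pp Pm -> AW_families (inv_params t) P' Pp' Pm' ->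
  [/\ is_basis (AW_sym_family Pp Pm) /\ is_basis (AW_sym_family Pp' Pm'),
      (forall f h, exists I, is_contour_integral g (integrand t f h) I) /\
      nondegenerate_bilinear (aw_form t g),
      forall m n : nat, m <> n -> aw_form t g (Pp m) (Pp' n) = 0,
      forall m n : nat, (0 < m)%N -> (0 < n)%N -> m <> n ->
        aw_form t g (Pm m) (Pm' n) = 0
    & forall m n : nat, (0 < n)%N ->
        aw_form t g (Pp m) (Pm' n) = 0 /\ aw_form t g (Pm n) (Pp' m) = 0].
Proof.
move=> t_adm g_adm fam fam'; split.
- exact: (AW_sym_bases t_adm g_adm fam fam').
- by split; [exact: integrand_ci|exact: aw_form_nondegenerate].
- exact: (sym_sym_orth t_adm g_adm fam fam').
- exact: (anti_anti_orth t_adm g_adm fam fam').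
- exact: (sym_anti_orth t_adm g_adm fam fam').
Qed.
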